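(* Let $p=p'+p''$ with $p'\equiv3\pmod4$, $V=\mathbb R^{p,q}$, $W$ a $C\ell^0(V)$-module and $\Pi:\wedge^2W\to V$ an $\mathfrak o(V)$-equivariant linear map with canonical symmetric form $b$. Let $\hat K(p',p'')\subset\mathrm{Spin}(p,q)$ be the subgroup generated by $K(p',p'')$ and $\iota(\mathrm{Pin}(q))$. Then: (1) $\hat K(p',p'')$ consists of all elements of $\mathrm{Spin}(p,q)$ preserving (under $\mathrm{Ad}$) the orthogonal decomposition $V=E\oplus E'$ and preserving $b$; its identity component is $K(p',p'')=\hat K(p',p'')\cap\mathrm{Spin}_0(p,q)$. (2) The homogeneous space $\mathrm{Spin}(p,q)/\hat K(p',p'')$ is connected. (3) $\hat K(p',p'')$ is compact if and only if $q=0$ or $p''=0$. If $p''=0$ (so $p=p'$), then $\hat K(p,0)=\mathrm{Spin}(p)\cdot\iota(\mathrm{Pin}(q))$ is a maximal compact subgroup of $\mathrm{Spin}(p,q)$, $\hat K(p,0)\cong(\mathrm{Spin}(p)\times\mathrm{Pin}(q))/\{\pm1\}$, and the algebra $C\ell^0_{p,q}$ is generated by $1$ and $\hat K(p,0)$.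
   Context: Let $V=\mathbb{R}^{p,q}$ be $\mathbb R^{p+q}$ with the scalar product $\langle x,y\rangle=\sum_{i=1}^{p}x^iy^i-\sum_{j=p+1}^{p+q}x^jy^j$ and its standard orthonormal basis. The Clifford algebra $C\ell(V)=C\ell_{p,q}$ is generated by $V$ subject to $xy+yx=-2\langle x,y\rangle 1$, with even part $C\ell^0(V)$; $\mathrm{Pin}(V)$ is generated by unit vectors, $\mathrm{Spin}(V)=\mathrm{Pin}(V)\cap C\ell^0(V)$, $\mathrm{Spin}_0(V)$ its identity component, $\mathrm{Ad}(x)y=xyx^{-1}$. Identify $\mathfrak{o}(V)=\wedge^2V$ via $(x\wedge y)(z)=\langle y,z\rangle x-\langle x,z\rangle y$; $x\wedge y\mapsto-\frac14(xy-yx)$ identifies $\mathfrak o(V)$ with $\mathfrak{spin}(V)$, through which $\mathfrak o(V)$ acts on $C\ell^0(V)$-modules. Fix $p=p'+p''$ with $p'\equiv 3\pmod 4$; $e_1,\dots,e_{p'}$ are the first $p'$ standard basis vectors, spanning $E=\mathbb R^{p',0}$, and $E'=E^\perp\cong\mathbb R^{p'',q}$. The canonical symmetric form is $b(s,t)=\langle e_1,\Pi(e_2\cdots e_{p'}s\wedge t)\rangle$. $K(p',p'')=\mathrm{Spin}(p')\cdot\mathrm{Spin}_0(p'',q)$ is the connected subgroup of $\mathrm{Spin}_0(p,q)$ generated by $\mathrm{Spin}(E)$ and $\mathrm{Spin}_0(E')$. $\iota:C\ell_q\to C\ell^0_{p,q}$ is the algebra embedding extending $x\mapsto e_1\cdots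 e_{p'}\,x'$, where $C\ell_q=C\ell(\mathbb R^{q,0})$, $\mathrm{Pin}(q)=\mathrm{Pin}(\mathbb R^{q,0})$, and $x\mapsto x'$ sends the $k$-th standard basis vector of $\mathbb R^q$ to the $(p+k)$-th standard basis vector of $V$.
   Formalization: Π is assumed nonzero, since for Π = 0 and p'' > 0 part (1) fails (p'=3, p''=1, q=0: e_1e_4 preserves E, E' and b=0 but is not in K̂); the module W is taken finite-dimensional, to which the general case reduces by restricting to finite-dimensional submodules. *)

(* Defs.v *)
From HB Require Import structures.
From mathcomp Require Import all_boot all_order all_algebra.
From mathcomp Require Import boolp classical_sets functions reals.
From mathcomp Require Import topology_structure function_spaces connected compact.
From mathcomp Require Import product_topology num_topology subspace_topology.
Import Order.TTheory GRing.Theory Num.Theory numFieldTopology.Exports.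
Set Implicit Arguments.
Unset Strict Implicit.
Unset Printing Implicit Defensive.
Local Open Scope classical_set_scope.
Local Open Scope ring_scope.

(* The Clifford algebra Cl_{p,q} of R^{p,q}, n = p + q, realised on the    *)
(* standard basis of blades e_A (A a subset of {0..n-1}, e_A = e_{a1}...e_{ak} *)
(* with a1 < ... < ak).  Carrier: functions blade -> R with the product    *)
(* (= Euclidean, since finite-dimensional) topology.                       *)

Notation blade p q := {set 'I_(p + q)}.
Notation Cl R p q := {ptws blade p q -> R}.

Definition ip_sign (R : realType) (p q : nat) (i : 'I_(p + q)) : R :=
  if (i < p)%N then 1 else -1.

(* Clifford relation x y + y x = -2 <x,y> 1, so e_i^2 = - <e_i,e_i> *)
Definition blade_sign (R : realType) (p q : nat) (A B : blade p q) : R :=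
  (-1) ^+ #|[pred ab : 'I_(p + q) * 'I_(p + q) |
               [&& ab.1 \in A, ab.2 \in B & (ab.2 < ab.1)%N]]|
  * \prod_(i in A :&: B) (- ip_sign R i).

Definition symdiff (p q : nat) (A B : blade p q) : blade p q :=
  (A :\: B) :|: (B :\: A).

Definition cl_mul (R : realType) (p q : nat) (x y : Cl R p q) : Cl R p q :=
  fun C => \sum_(A : blade p q) \sum_(B : blade p q)
    (if symdiff A B == C then blade_sign R A B * x A * y B else 0).
Definition cl_add (R : realType) (p q : nat) (x y : Cl R p q) : Cl R p q :=
  fun C => x C + y C.
Definition cl_scale (R : realType) (p q : nat) (a : R) (x : Cl R p q) : Cl R p q :=
  fun C => a * x C.
Definition cl_zero (R : realType) (p q : nat) : Cl R p q := fun C => 0.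
Arguments cl_zero R p q : clear implicits.
Definition cl_one (R : realType) (p q : nat) : Cl R p q := fun C => (#|C| == 0)%N%:R.
Arguments cl_one R p q : clear implicits.
Definition cl_prod (R : realType) (p q : nat) (s : seq (Cl R p q)) : Cl R p q :=
  foldr (@cl_mul R p q) (cl_one R p q) s.

Definition cl_even (R : realType) (p q : nat) (x : Cl R p q) : Prop :=
  forall C : blade p q, odd #|C| -> x C = 0.

Notation Vec R p q := 'rV[R]_(p + q).
Definition ip (R : realType) (p q : nat) (v w : Vec R p q) : R :=
  \sum_(i < p + q) ip_sign R i * v ord0 i * w ord0 i.
Definition vec (R : realType) (p q : nat) (v : Vec R p q) : Cl R p q :=
  fun C => \sum_(i < p + q) (C == finset.set1 i)%:R * v ord0 i.
Definition basis_nat (R : realType) (p q : nat) (k : nat) : Vec R p q :=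
  \row_(j < p + q) (j == k :> nat)%:R.
Arguments basis_nat R p q k : clear implicits.

(* inverse in Cl (used only on invertible elements) *)
Definition cl_inv (R : realType) (p q : nat) (x : Cl R p q) : Cl R p q :=
  xget (cl_one R p q)
    (fun y => cl_mul x y = cl_one R p q /\ cl_mul y x = cl_one R p q).
Definition Ad (R : realType) (p q : nat) (x y : Cl R p q) : Cl R p q :=
  cl_mul (cl_mul x y) (cl_inv x).

Definition PinIn (R : realType) (p q : nat) (S : set (Vec R p q)) : set (Cl R p q) :=
  [set x | exists s : seq (Vec R p q),
     (forall v, v \in s -> S v /\ (ip v v = 1 \/ ip v v = -1))
     /\ x = cl_prod [seq vec v | v <- s]].
Definition SpinIn (R : realType) (p q : nat) (S : set (Vec R p q)) : set (Cl R p q) :=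
  PinIn S `&` @cl_even R p q.
Definition Spin0In (R : realType) (p q : nat) (S : set (Vec R p q)) : set (Cl R p q) :=
  connected_component (SpinIn S) (cl_one R p q).
Definition Pin (R : realType) (p q : nat) := PinIn (@setT (Vec R p q)).
Arguments Pin R p q : clear implicits.
Definition Spin (R : realType) (p q : nat) := SpinIn (@setT (Vec R p q)).
Arguments Spin R p q : clear implicits.
Definition Spin0 (R : realType) (p q : nat) := Spin0In (@setT (Vec R p q)).
Arguments Spin0 R p q : clear implicits.

Definition subgroup_closed (R : realType) (p q : nat) (G : set (Cl R p q)) : Prop :=
  [/\ G (cl_one R p q),
      (forall x y, G x -> G y -> G (cl_mul x y)) &
      (forall x, G x -> G (cl_inv x))].
Definition gen_group (R : realType) (p q : nat) (S : set (Cl R p q)) : set (Cl R p q) :=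
  [set x | forall G, subgroup_closed G -> S `<=` G -> G x].

Definition gen_alg (R : realType) (p q : nat) (X : set (Cl R p q)) : set (Cl R p q) :=
  [set x | forall S : set (Cl R p q),
     S (cl_one R p q) -> X `<=` S ->
     (forall y z, S y -> S z -> S (cl_add y z)) ->
     (forall a y, S y -> S (cl_scale a y)) ->
     (forall y z, S y -> S z -> S (cl_mul y z)) -> S x].

Definition EE (R : realType) (p q : nat) (p' : nat) : set (Vec R p q) :=
  [set v | forall i : 'I_(p + q), (p' <= i)%N -> v ord0 i = 0].
Arguments EE R p q p' : clear implicits.
Definition EE' (R : realType) (p q : nat) (p' : nat) : set (Vec R p q) :=
  [set v | forall i : 'I_(p + q), (i < p')%N -> v ord0 i = 0].
Arguments EE' R p q p' : clear implicits.

Definition Kgrp (R : realType) (p q : nat) (p' : nat) : set (Cl R p q) :=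
  gen_group (SpinIn (EE R p q p') `|` Spin0In (EE' R p q p')).
Arguments Kgrp R p q p' : clear implicits.

(* e_{k+1} e_{k+2} ... e_{l} (basis indices counted from 0: k .. l-1) *)
Definition eprod (R : realType) (p q : nat) (k l : nat) : Cl R p q :=
  cl_prod [seq vec (basis_nat R p q i) | i <- iota k (l - k)].
Arguments eprod R p q k l : clear implicits.

(* iota : Cl_q -> Cl^0_{p,q}, the algebra map extending x |-> e_1...e_p' x' *)
Definition cl_iota (R : realType) (p q : nat) (p' : nat) (x : Cl R q 0) : Cl R p q :=
  \big[@cl_add R p q/cl_zero R p q]_(A : blade q 0)
     cl_scale (x A)
       (cl_prod [seq cl_mul (eprod R p q 0 p') (vec (basis_nat R p q (p + nat_of_ord k)))
                | k <- enum A]).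

Arguments cl_iota R p q p' x : clear implicits.

Definition iotaPin (R : realType) (p q : nat) (p' : nat) : set (Cl R p q) :=
  [set y | exists x, Pin R q 0 x /\ y = cl_iota R p q p' x].
Arguments iotaPin R p q p' : clear implicits.
Definition Khat (R : realType) (p q : nat) (p' : nat) : set (Cl R p q) :=
  gen_group (Kgrp R p q p' `|` iotaPin R p q p').
Arguments Khat R p q p' : clear implicits.

Definition is_Cl0_module (R : realType) (p q m : nat) (rho : Cl R p q -> 'M[R]_m) : Prop :=
  [/\ rho (cl_one R p q) = 1%:M,
      (forall x y, cl_even x -> cl_even y -> rho (cl_add x y) = rho x + rho y),
      (forall a x, cl_even x -> rho (cl_scale a x) = a *: rho x) &
      (forall x y, cl_even x -> cl_even y -> rho (cl_mul x y) = rho x *m rho y)].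

(* Pi : wedge^2 W -> V, as a skew-symmetric bilinear map W x W -> V *)
Definition is_wedge2_map (R : realType) (p q m : nat) (Pi : 'cV[R]_m -> 'cV[R]_m -> Vec R p q) : Prop :=
  (forall s t, Pi s t = - Pi t s) /\
  (forall a s s' t, Pi (a *: s + s') t = a *: Pi s t + Pi s' t).

(* x /\ y in o(V): acts on V by z |-> <y,z> x - <x,z> y, and on W through
   x /\ y |-> -1/4 (x y - y x) in spin(V) *)
Definition wedge_act (R : realType) (p q : nat) (x y z : Vec R p q) : Vec R p q :=
  ip y z *: x - ip x z *: y.
Definition wedge_spin (R : realType) (p q : nat) (x y : Vec R p q) : Cl R p q :=
  cl_scale (- 4^-1)
    (cl_add (cl_mul (vec x) (vec y)) (cl_scale (-1) (cl_mul (vec y) (vec x)))).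
Definition equivariant (R : realType) (p q m : nat) (rho : Cl R p q -> 'M[R]_m)
    (Pi : 'cV[R]_m -> 'cV[R]_m -> Vec R p q) : Prop :=
  forall (x y : Vec R p q) (s t : 'cV[R]_m),
    Pi (rho (wedge_spin x y) *m s) t + Pi s (rho (wedge_spin x y) *m t)
    = wedge_act x y (Pi s t).

Definition bform (R : realType) (p q m : nat) (p' : nat) (rho : Cl R p q -> 'M[R]_m)
    (Pi : 'cV[R]_m -> 'cV[R]_m -> Vec R p q) (s t : 'cV[R]_m) : R :=
  ip (basis_nat R p q 0) (Pi (rho (eprod R p q 1 p') *m s) t).

Definition Ad_preserves (R : realType) (p q : nat) (g : Cl R p q) (S : set (Vec R p q)) : Prop :=
  forall v, S v -> exists w, S w /\ Ad g (vec v) = vec w.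

(* connectedness of G/H (right cosets gH, quotient topology from the topology
   of G as a subspace of Cl): no separation of G into two nonempty disjoint
   relatively open H-saturated subsets *)
Definition rel_open (R : realType) (p q : nat) (G A : set (Cl R p q)) : Prop :=
  exists U, open U /\ A = U `&` G.
Definition homog_connected (R : realType) (p q : nat) (G H : set (Cl R p q)) : Prop :=
  forall A B : set (Cl R p q),
    rel_open G A -> rel_open G B -> A `|` B = G -> A `&` B = set0 ->
    (forall g h, A g -> H h -> A (cl_mul g h)) ->
    (forall g h, B g -> H h -> B (cl_mul g h)) ->
    A = set0 \/ B = set0.

Definition max_compact_subgroup (R : realType) (p q : nat) (G K : set (Cl R p q)) : Prop :=
  [/\ K `<=` G, subgroup_closed K, compact K &
      forall H, H `<=` G -> subgroup_closed H -> compact H -> K `<=` H -> H = K].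

(* Main.v *)
Require Import Defs.
From HB Require Import structures.
From mathcomp Require Import all_boot all_order all_algebra.
From mathcomp Require Import boolp classical_sets functions reals.
From mathcomp Require Import topology_structure function_spaces connected compact.
From mathcomp Require Import product_topology num_topology subspace_topology.
From mathcomp Require Import supremum_topology normedtype realfun.
From mathcomp Require Import ring lra zify.
Import Order.TTheory GRing.Theory Num.Theory numFieldTopology.Exports.
Import numFieldNormedType.Exports.
Set Implicit Arguments.
Unset Strict Implicit.
Unset Printing Implicit Defensive.
Local Open Scope classical_set_scope.
Local Open Scope ring_scope.

(* Write omega = e_1 ... e_p'. As p' = 3 mod 4, omega has square 1, commutes with E and
   anticommutes with E'. The straightening of an orthonormal basis by reflections
   (Cartan-Dieudonne) shows that an element g of Spin preserving E and E' is a product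
   g = a c with a in Pin(E) and c in Pin(E'). Equivariance of Pi under o(V) integrates to
   Pi(g s, g t) = N(g) Ad(g) Pi(s, t), where N is the spinor norm; together with the identity
   <f, Pi(f x s, t)> = - <f, f> <x, Pi(s, t)> this gives b(g s, g t) = (c c~) b(s, t), where
   c~ is the reversal of c. Hence g preserves b iff c contains an even number of positive
   vectors. Two unit vectors of equal norm are joined, up to sign, by the normalised straight
   segment, so every product with evenly many positive and evenly many negative vectors lies
   in the identity component up to sign; the only other coset is that of omega f with f
   negative, which belongs to iota(Pin(q)) and has spinor norm -1. This yields (1) and (2).

   In the definite case Pin is compact because products of boundedly many unit vectors
   suffice, and for p'', q > 0 the boosts in E' are unbounded. When p'' = 0, a compact group
   H containing Khat preserves E: if h in H sends e_1 to cosh t u + sinh t z with t <> 0, an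
   element k of Khat aligns the two boosts in h k h, which then moves e_1 by at least 2 t,
   and iterating contradicts boundedness. *)

(** * The Clifford algebra *)

(** Signs are the obstacle. A rotation determines a product of unit vectors only up to sign, and -1
    need not lie in Spin_0(E'), so connectedness statements about E' are obtained only up to sign.
    The sign is absorbed on the side of E: as p' >= 3, -1 = (e_1 e_2)^2 lies in the connected group
    Spin(E). Both Khat and the stabiliser of b are compared with one explicit set of words, [KK],
    whose defining conditions can be read off from lengths and norms.

    The passage from o(V) to the group uses no exponential: u v satisfies a quadratic equation, and
    this turns the infinitesimal identity for Pi into the one for the group. In the formula for b,
    moving omega past c gives (-1)^|c| and the norm of a gives (-1)^|a|; these cancel because a c is
    even, which leaves c c~. *)

Section BladeSign.
Variables (R : realType) (p q : nat).
Implicit Types A B C D : blade p q.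

Lemma in_symdiff A B i : (i \in symdiff A B) = (i \in A) (+) (i \in B).
Proof. by rewrite /symdiff !inE; case: (i \in A); case: (i \in B). Qed.

Lemma symdiffC A B : symdiff A B = symdiff B A.
Proof. by apply/setP => i; rewrite !in_symdiff addbC. Qed.

Lemma symdiffA A B C : symdiff A (symdiff B C) = symdiff (symdiff A B) C.
Proof. by apply/setP => i; rewrite !in_symdiff addbA. Qed.

Lemma symdiffK A B : symdiff A (symdiff A B) = B.
Proof. by apply/setP => i; rewrite !in_symdiff addbA addbb. Qed.

Lemma symdiffxx A : symdiff A A = finset.set0.
Proof. by apply/setP => i; rewrite in_symdiff addbb inE. Qed.

Lemma symdiff0 A : symdiff A finset.set0 = A.
Proof. by apply/setP => i; rewrite in_symdiff inE addbF. Qed.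

Lemma sym0diff A : symdiff finset.set0 A = A.
Proof. by rewrite symdiffC symdiff0. Qed.

Lemma symdiff_eq A B C : (symdiff A B == C) = (B == symdiff A C).
Proof.
by apply/eqP/eqP => [<-|->]; rewrite symdiffK.
Qed.

(** As a product of signs over all pairs this is visibly bimultiplicative for [symdiff], which the
    cardinal in [blade_sign] does not display. *)
Definition inv_sign A B : R :=
  \prod_(a : 'I_(p + q)) \prod_(b : 'I_(p + q))
    (-1) ^+ [&& a \in A, b \in B & (b < a)%N].

Definition sq_sign A B : R :=
  \prod_(i : 'I_(p + q)) (- ip_sign R i) ^+ ((i \in A) && (i \in B)).

Lemma blade_signE A B : blade_sign R A B = inv_sign A B * sq_sign A B.
Proof.
rewrite /blade_sign; congr (_ * _).
  rewrite /inv_sign pair_big /= -prodr_const big_mkcond /=.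
  by apply: eq_bigr => -[a b] _; rewrite inE /=; case: ifP.
rewrite /sq_sign big_mkcond /=; apply: eq_bigr => i _.
by rewrite inE; case: ifP.
Qed.

Lemma inv_signDl A B C : inv_sign (symdiff A B) C = inv_sign A C * inv_sign B C.
Proof.
rewrite /inv_sign -big_split; apply: eq_bigr => a _ /=.
rewrite -big_split; apply: eq_bigr => b _ /=.
rewrite in_symdiff -signr_addb.
by case: (a \in A); case: (a \in B); case: (b \in C); case: (b < a)%N.
Qed.

Lemma inv_signDr A B C : inv_sign A (symdiff B C) = inv_sign A B * inv_sign A C.
Proof.
rewrite /inv_sign -big_split; apply: eq_bigr => a _ /=.
rewrite -big_split; apply: eq_bigr => b _ /=.
rewrite in_symdiff -signr_addb.
by case: (a \in A); case: (b \in B); case: (b \in C); case: (b < a)%N.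
Qed.

(** A 2-cocycle identity on the group of subsets under [symdiff]: it is associativity on blades, and
    presents the Clifford algebra as a twisted group algebra of (Z/2)^n. *)
Lemma blade_sign_cocycle A B C :
  blade_sign R A B * blade_sign R (symdiff A B) C =
  blade_sign R A (symdiff B C) * blade_sign R B C.
Proof.
rewrite !blade_signE inv_signDl inv_signDr.
rewrite !mulrA [LHS](ACl (1*3*4*(2*5))) [RHS](ACl (1*4*2*(3*5))) /=.
rewrite [_ * inv_sign A C * inv_sign B C](ACl (1*3*2)) /=.
congr (_ * _); rewrite /sq_sign -!big_split; apply: eq_bigr => i _ /=.
rewrite !in_symdiff; case: (i \in A); case: (i \in B); case: (i \in C) => /=;
  by rewrite ?expr0 ?expr1 ?mulr1 ?mul1r.
Qed.

Lemma blade_sign0l A : blade_sign R finset.set0 A = 1.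
Proof.
rewrite blade_signE /inv_sign /sq_sign !big1 ?mulr1 // => i _.
  by rewrite inE.
by rewrite big1 // => j _; rewrite inE.
Qed.

Lemma blade_sign0r A : blade_sign R A finset.set0 = 1.
Proof.
rewrite blade_signE /inv_sign /sq_sign !big1 ?mulr1 // => i _.
  by rewrite inE andbF.
by rewrite big1 // => j _; rewrite !inE andbF.
Qed.

Lemma ip_sign_sqr (i : 'I_(p + q)) : ip_sign R i * ip_sign R i = 1.
Proof. by rewrite /ip_sign; case: ifP; rewrite ?mulr1 ?mulrNN ?mulr1. Qed.

Lemma inv_sign_sqr A B : inv_sign A B * inv_sign A B = 1.
Proof.
rewrite /inv_sign -big_split /= big1 // => i _; rewrite -big_split big1 // => j _ /=.
by rewrite -signr_addb addbb.
Qed.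

Lemma blade_sign_sqr A B : blade_sign R A B * blade_sign R A B = 1.
Proof.
rewrite blade_signE mulrACA inv_sign_sqr mul1r /sq_sign -big_split big1 // => i _.
by case: (_ && _); rewrite /= ?expr1 ?expr0 ?mulr1 // mulrNN ip_sign_sqr.
Qed.

Definition sgn_card A : R := \prod_(i : 'I_(p + q)) (-1) ^+ (i \in A).

Lemma sgn_cardE A : sgn_card A = (-1) ^+ #|A|.
Proof.
rewrite /sgn_card -prodr_const [RHS]big_mkcond; apply: eq_bigr => i _.
by case: (i \in A).
Qed.

Lemma sgn_cardD A B : sgn_card (symdiff A B) = sgn_card A * sgn_card B.
Proof.
rewrite /sgn_card -big_split; apply: eq_bigr => i _ /=.
by rewrite in_symdiff signr_addb.
Qed.

(* The sign of the order-reversing permutation of the factors of e_A. *)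
Definition rev_sign A : R := inv_sign A A.

(** On blades this says that reversal is an anti-automorphism. *)
Lemma rev_signD A B :
  rev_sign (symdiff A B) * blade_sign R A B =
  rev_sign A * rev_sign B * blade_sign R B A.
Proof.
rewrite !blade_signE /rev_sign inv_signDl !inv_signDr.
have -> : sq_sign B A = sq_sign A B.
  by rewrite /sq_sign; apply: eq_bigr => i _; rewrite andbC.
by rewrite !mulrA; congr (_ * _); rewrite [LHS](ACl (1*4*3*(2*5))) /= inv_sign_sqr mulr1.
Qed.

Lemma inv_sign_comm A B :
  inv_sign A B * inv_sign B A =
  \prod_(a : 'I_(p + q)) \prod_(b : 'I_(p + q))
    (-1) ^+ [&& a \in A, b \in B & a != b].
Proof.
rewrite /inv_sign [X in _ * X]exchange_big -big_split; apply: eq_bigr => a _ /=.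
rewrite -big_split; apply: eq_bigr => b _ /=.
rewrite -signr_addb (_ : (a != b) = ((b < a)%N (+) (a < b)%N)).
  by case: (a \in A); case: (b \in B).
by rewrite -val_eqE /=; case: ltngtP.
Qed.

End BladeSign.

(* A separate carrier, because the canonical ring structure of [Cl] is the pointwise
   one of a function space; [clif] gets the Clifford product instead. *)
Definition clif (R : realType) (p q : nat) : Type := blade p q -> R.

Section CliffordAlgebra.
Variables (R : realType) (p q : nat).
Implicit Types (A B C D : blade p q) (x y z : Cl R p q).

Lemma cl_mulE x y C :
  cl_mul x y C = \sum_A blade_sign R A (symdiff A C) * x A * y (symdiff A C).
Proof.
apply: eq_bigr => A _; rewrite (bigD1 (symdiff A C)) //= symdiffK eqxx.
by rewrite big1 ?addr0 // => B BAC; rewrite symdiff_eq (negbTE BAC).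
Qed.

Lemma cl_mulA : associative (@cl_mul R p q).
Proof.
move=> x y z; apply/funext => D; rewrite !cl_mulE.
transitivity (\sum_A \sum_B blade_sign R A (symdiff A D) *
   blade_sign R B (symdiff B (symdiff A D)) * x A * y B * z (symdiff B (symdiff A D))).
  apply: eq_bigr => A _; rewrite cl_mulE mulr_sumr; apply: eq_bigr => B _.
  by ring.
transitivity (\sum_A \sum_C blade_sign R C (symdiff C D) *
   blade_sign R A (symdiff A C) * x A * y (symdiff A C) * z (symdiff C D)).
  apply: eq_bigr => A _.
  (* The blade of the product x y is traded for the blade of the factor y. *)
  rewrite [RHS](reindex_inj (can_inj (symdiffK A))); apply: eq_bigr => B _ /=.
  have e : symdiff (symdiff A B) D = symdiff B (symdiff A D).
    by rewrite symdiffA (symdiffC B).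
  rewrite e symdiffK; congr (_ * _ * _ * _).
  have := blade_sign_cocycle R A B (symdiff B (symdiff A D)).
  by rewrite symdiffK => <-; rewrite mulrC.
rewrite exchange_big; apply: eq_bigr => C _ /=; rewrite cl_mulE mulr_sumr mulr_suml.
by apply: eq_bigr => A _; ring.
Qed.

Lemma cl_mul1l : left_id (cl_one R p q) (@cl_mul R p q).
Proof.
move=> x; apply/funext => C; rewrite cl_mulE (bigD1 finset.set0) //=.
rewrite sym0diff blade_sign0l /cl_one cards0 eqxx !mul1r big1 ?addr0 // => A A0.
by rewrite cards_eq0 (negbTE A0) mulr0 mul0r.
Qed.

Lemma cl_mul1r : right_id (cl_one R p q) (@cl_mul R p q).
Proof.
move=> x; apply/funext => C; rewrite cl_mulE (bigD1 C) //=.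
rewrite symdiffxx blade_sign0r /cl_one cards0 eqxx mulr1 mul1r big1 ?addr0 // => A neA.
rewrite cards_eq0; case: eqP => [e|]; last by rewrite mulr0.
by case/eqP: neA; rewrite -[C](symdiffK A) e symdiff0.
Qed.

Lemma cl_mulDl : left_distributive (@cl_mul R p q) (@cl_add R p q).
Proof.
move=> x y z; apply/funext => C; rewrite /cl_add !cl_mulE -big_split.
by apply: eq_bigr => A _ /=; ring.
Qed.

Lemma cl_mulDr : right_distributive (@cl_mul R p q) (@cl_add R p q).
Proof.
move=> x y z; apply/funext => C; rewrite /cl_add !cl_mulE -big_split.
by apply: eq_bigr => A _ /=; ring.
Qed.

Lemma cl_one_neq0 : cl_one R p q <> cl_zero R p q.
Proof.
move/(congr1 (fun f => f finset.set0)); rewrite /cl_one /cl_zero cards0 eqxx.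
by move/eqP; rewrite oner_eq0.
Qed.

End CliffordAlgebra.

Section CliffordInstances.
Variables (R : realType) (p q : nat).

HB.instance Definition _ := gen_eqMixin (clif R p q).
HB.instance Definition _ := gen_choiceMixin (clif R p q).

Fact clif_addA : associative (@cl_add R p q : clif R p q -> clif R p q -> clif R p q).
Proof. by move=> x y z; apply/funext => C; rewrite /cl_add addrA. Qed.
Fact clif_addC : commutative (@cl_add R p q : clif R p q -> clif R p q -> clif R p q).
Proof. by move=> x y; apply/funext => C; rewrite /cl_add addrC. Qed.
Fact clif_add0 :
  left_id (cl_zero R p q) (@cl_add R p q : clif R p q -> clif R p q -> clif R p q).
Proof. by move=> x; apply/funext => C; rewrite /cl_add add0r. Qed.
Fact clif_addN : left_inverse (cl_zero R p q) (@cl_scale R p q (-1))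
  (@cl_add R p q : clif R p q -> clif R p q -> clif R p q).
Proof. by move=> x; apply/funext => C; rewrite /cl_add /cl_scale mulN1r addNr. Qed.

HB.instance Definition _ :=
  GRing.isZmodule.Build (clif R p q) clif_addA clif_addC clif_add0 clif_addN.

Fact clif_oner_neq0 : (cl_one R p q : clif R p q) != 0.
Proof. by apply/eqP/cl_one_neq0. Qed.

HB.instance Definition _ := GRing.Zmodule_isNzRing.Build (clif R p q)
  (@cl_mulA R p q) (@cl_mul1l R p q) (@cl_mul1r R p q)
  (@cl_mulDl R p q) (@cl_mulDr R p q) clif_oner_neq0.

Fact clif_scaleA (a b : R) (x : clif R p q) :
  cl_scale a (cl_scale b x) = cl_scale (a * b) x.
Proof. by apply/funext => C; rewrite /cl_scale mulrA. Qed.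
Fact clif_scale1 : left_id (1 : R) (@cl_scale R p q : R -> clif R p q -> clif R p q).
Proof. by move=> x; apply/funext => C; rewrite /cl_scale mul1r. Qed.
Fact clif_scaleDr :
  right_distributive (@cl_scale R p q : R -> clif R p q -> clif R p q) (@GRing.add (clif R p q)).
Proof. by move=> a x y; apply/funext => C; rewrite /cl_scale mulrDr. Qed.
Fact clif_scaleDl (x : clif R p q) :
  {morph (@cl_scale R p q)^~ x : a b / a + b >-> (a + b : clif R p q)}.
Proof. by move=> a b; apply/funext => C; rewrite /cl_scale mulrDl. Qed.

HB.instance Definition _ := GRing.Zmodule_isLmodule.Build R (clif R p q)
  clif_scaleA clif_scale1 clif_scaleDr clif_scaleDl.

Fact clif_scaleAl (a : R) (x y : clif R p q) : a *: (x * y) = a *: x * y.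
Proof.
apply/funext => C; rewrite [LHS](congr1 (fun t => a * t) (cl_mulE x y C)).
rewrite [RHS]cl_mulE mulr_sumr; apply: eq_bigr => A _.
by rewrite /GRing.scale /= /cl_scale; ring.
Qed.

HB.instance Definition _ := GRing.Lmodule_isLalgebra.Build R (clif R p q) clif_scaleAl.

Fact clif_scaleAr (a : R) (x y : clif R p q) : a *: (x * y) = x * (a *: y).
Proof.
apply/funext => C; rewrite [LHS](congr1 (fun t => a * t) (cl_mulE x y C)).
rewrite [RHS]cl_mulE mulr_sumr; apply: eq_bigr => A _.
by rewrite /GRing.scale /= /cl_scale; ring.
Qed.

HB.instance Definition _ := GRing.Lalgebra_isAlgebra.Build R (clif R p q) clif_scaleAr.

End CliffordInstances.

(** * Blade basis, vectors, grade involution and reversal *)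

Section CliffordTheory.
Variables (R : realType) (p q : nat).
Implicit Types (A B C D : blade p q) (x y z : clif R p q) (v w : Vec R p q).
Local Notation clif := (clif R p q).

Lemma clifME (x y : clif) : cl_mul x y = x * y. Proof. by []. Qed.
Lemma clifDE (x y : clif) : cl_add x y = x + y. Proof. by []. Qed.
Lemma clifZE a (x : clif) : cl_scale a x = a *: x. Proof. by []. Qed.
Lemma mul_coef x y C :
  (x * y) C = \sum_A blade_sign R A (symdiff A C) * x A * y (symdiff A C).
Proof. exact: cl_mulE. Qed.

Lemma add_coef x y C : (x + y) C = x C + y C. Proof. by []. Qed.
Lemma scale_coef a x C : (a *: x) C = a * x C. Proof. by []. Qed.
Lemma zero_coef C : (0 : clif) C = 0. Proof. by []. Qed.
Lemma opp_coef x C : (- x) C = - x C. Proof. by rewrite -scaleN1r scale_coef mulN1r. Qed.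
Lemma one_coef C : (1 : clif) C = (C == finset.set0)%:R.
Proof. by rewrite -cards_eq0. Qed.
Lemma sum_coef (I : Type) (r : seq I) (P : pred I) (F : I -> clif) C :
  (\sum_(i <- r | P i) F i) C = \sum_(i <- r | P i) F i C.
Proof. by elim/big_rec2: _ => // i y1 y2 _ <-. Qed.

Definition bl A : clif := fun C => (C == A)%:R.

Lemma bl_coef A C : bl A C = (C == A)%:R. Proof. by []. Qed.

Lemma bl0 : bl finset.set0 = 1.
Proof. by apply/funext => C; rewrite one_coef. Qed.

Lemma blE x : x = \sum_A x A *: bl A.
Proof.
apply/funext => C; rewrite sum_coef (bigD1 C) //= scale_coef bl_coef eqxx mulr1.
by rewrite big1 ?addr0 // => A neA; rewrite scale_coef bl_coef eq_sym (negbTE neA) mulr0.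
Qed.

Lemma blM A B : bl A * bl B = blade_sign R A B *: bl (symdiff A B).
Proof.
apply/funext => C; rewrite mul_coef (bigD1 A) //= scale_coef !bl_coef eqxx mulr1.
rewrite big1 ?addr0 => [|D DA]; last by rewrite bl_coef (negbTE DA) mulr0 mul0r.
rewrite symdiff_eq [C == _]eq_sym symdiff_eq eq_sym.
rewrite [symdiff A C == B]eq_sym; case: eqP => [->|]; rewrite ?mulr0 //.
Qed.

Definition cvec v : clif := vec v.

Lemma vecE v : cvec v = \sum_(i < p + q) v ord0 i *: bl (finset.set1 i).
Proof.
apply/funext => C; rewrite sum_coef; apply: eq_bigr => i _.
by rewrite scale_coef bl_coef mulrC.
Qed.

Lemma vec_coef1 v i : cvec v (finset.set1 i) = v ord0 i.
Proof.
rewrite /cvec /vec (bigD1 i) //= eqxx mul1r big1 ?addr0 // => j ji.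
rewrite (_ : (_ == _) = false) ?mul0r //; apply/eqP => /setP/(_ i).
by rewrite !inE eqxx eq_sym (negbTE ji).
Qed.

Lemma vec_inj : injective cvec.
Proof. by move=> v w e; apply/rowP => i; rewrite -!vec_coef1 e. Qed.

Lemma vecD v w : cvec (v + w) = cvec v + cvec w.
Proof.
by rewrite !vecE -big_split; apply: eq_bigr => i _ /=; rewrite mxE scalerDl.
Qed.

Lemma vecZ a v : cvec (a *: v) = a *: cvec v.
Proof. by rewrite !vecE scaler_sumr; apply: eq_bigr => i _; rewrite mxE scalerA. Qed.

Lemma vec0 : cvec 0 = 0.
Proof. by rewrite -(scale0r 0) vecZ scale0r. Qed.

Lemma vecN v : cvec (- v) = - cvec v.
Proof. by rewrite -scaleN1r vecZ scaleN1r. Qed.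

Lemma vecB v w : cvec (v - w) = cvec v - cvec w.
Proof. by rewrite vecD vecN. Qed.

Lemma blade_sign11 (i j : 'I_(p + q)) :
  blade_sign R (finset.set1 i) (finset.set1 j) =
  (-1) ^+ (j < i)%N * (- ip_sign R i) ^+ (i == j).
Proof.
rewrite blade_signE /inv_sign /sq_sign; congr (_ * _).
  rewrite (bigD1 i) //= [X in _ * X]big1 => [|a ai]; last first.
    by rewrite big1 // => b _; rewrite inE (negbTE ai).
  rewrite mulr1 (bigD1 j) //= !inE !eqxx /= big1 ?mulr1 // => b bj.
  by rewrite !inE (negbTE bj) ?andbF.
rewrite (bigD1 i) //= !inE eqxx /= big1 ?mulr1 // => k ki.
by rewrite !inE (negbTE ki).
Qed.

Lemma bl1_anti (i j : 'I_(p + q)) :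
  bl (finset.set1 i) * bl (finset.set1 j) + bl (finset.set1 j) * bl (finset.set1 i) =
  (- 2 * (ip_sign R i * (i == j)%:R))%:A.
Proof.
rewrite !blM (symdiffC (finset.set1 j)) -scalerDl !blade_sign11.
have [->|ij] := eqVneq i j.
  by rewrite ltnn symdiffxx bl0 !expr0 !expr1 !mul1r mulr1; congr (_ *: _); ring.
rewrite !expr0 !mulr1 mulr0 mulr0 scale0r.
have : (i < j)%N (+) (j < i)%N.
  by move: ij; rewrite -val_eqE /=; case: ltngtP.
by case: (i < j)%N; case: (j < i)%N; rewrite //= expr0 expr1 ?addNr ?addrN scale0r.
Qed.

Lemma vec_anti v w :
  cvec v * cvec w + cvec w * cvec v = (- 2 * ip v w)%:A.
Proof.
rewrite !vecE !mulr_suml (eq_bigr (fun i => \sum_j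
    (v ord0 i * w ord0 j) *: (bl (finset.set1 i) * bl (finset.set1 j)))); last first.
  move=> i _; rewrite mulr_sumr; apply: eq_bigr => j _.
  by rewrite -scalerAl -scalerAr scalerA.
rewrite [X in _ + X](eq_bigr (fun i => \sum_j
    (w ord0 i * v ord0 j) *: (bl (finset.set1 i) * bl (finset.set1 j)))); last first.
  move=> i _; rewrite mulr_sumr; apply: eq_bigr => j _.
  by rewrite -scalerAl -scalerAr scalerA.
rewrite [X in _ + X]exchange_big -big_split /= /ip mulr_sumr scaler_suml.
apply: eq_bigr => i _; rewrite -big_split /= (bigD1 i) //= (mulrC (w _ _)) -scalerDr bl1_anti eqxx.
rewrite big1 ?addr0 => [|j ji]; last first.
  rewrite (mulrC (w _ _)) -scalerDr bl1_anti (eq_sym i) (negbTE ji).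
  by rewrite !mulr0 scale0r scaler0.
by rewrite scalerA mulr1; congr (_ *: _); ring.
Qed.

Lemma ipC v w : ip v w = ip w v.
Proof. by apply: eq_bigr => i _; ring. Qed.

Lemma ipDl u v w : ip (u + v) w = ip u w + ip v w.
Proof. by rewrite -big_split; apply: eq_bigr => i _ /=; rewrite mxE; ring. Qed.

Lemma ipZl a v w : ip (a *: v) w = a * ip v w.
Proof. by rewrite mulr_sumr; apply: eq_bigr => i _; rewrite mxE; ring. Qed.

Lemma ipDr u v w : ip u (v + w) = ip u v + ip u w.
Proof. by rewrite !(ipC u) ipDl. Qed.

Lemma ipZr a v w : ip v (a *: w) = a * ip v w.
Proof. by rewrite !(ipC v) ipZl. Qed.

Lemma ipNl v w : ip (- v) w = - ip v w.
Proof. by rewrite -scaleN1r ipZl mulN1r. Qed.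

Lemma ipNr v w : ip v (- w) = - ip v w.
Proof. by rewrite -scaleN1r ipZr mulN1r. Qed.

Lemma ip0l w : ip 0 w = 0 :> R.
Proof. by rewrite -(scale0r 0) ipZl mul0r. Qed.

Lemma vec_sqr v : cvec v * cvec v = (- ip v v)%:A.
Proof.
have := vec_anti v v; rewrite -mulr2n -scaler_nat => /(congr1 (fun t => 2^-1 *: t)).
by rewrite !scalerA mulVf ?scale1r ?pnatr_eq0 // => ->; congr (_ *: _); field.
Qed.

(** The grade involution, the automorphism equal to -1 on V; its fixed points form the even part. *)
Definition par x : clif := fun A => sgn_card R A * x A.

Lemma parD x y : par (x + y) = par x + par y.
Proof. by apply/funext => A; rewrite /par !add_coef mulrDr. Qed.
Lemma parZ a x : par (a *: x) = a *: par x.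
Proof. by apply/funext => A; rewrite /par !scale_coef mulrCA. Qed.
Lemma parM x y : par (x * y) = par x * par y.
Proof.
apply/funext => C; rewrite mul_coef /par mul_coef mulr_sumr.
apply: eq_bigr => A _; rewrite -{1}[C](symdiffK A) sgn_cardD.
by ring.
Qed.
Lemma par1 : par 1 = 1.
Proof.
apply/funext => A; rewrite /par one_coef; case: eqP => [->|]; last by rewrite mulr0.
by rewrite sgn_cardE cards0 expr0 mulr1.
Qed.
Lemma par_vec v : par (cvec v) = - cvec v.
Proof.
apply/funext => A; rewrite opp_coef /par /cvec /vec mulr_sumr -sumrN; apply: eq_bigr => i _.
case: eqP => [->|]; last by rewrite mul0r mulr0 oppr0.
by rewrite sgn_cardE cards1 expr1 mulN1r.
Qed.

Lemma cl_evenP x : cl_even x <-> par x = x.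
Proof.
split=> [ex|ex C oC].
  apply/funext => A; rewrite /par sgn_cardE -signr_odd.
  by case: (boolP (odd #|A|)) => [/ex->|_]; rewrite ?mulr0 ?expr0 ?mul1r.
have := congr1 (fun f => f C) ex; rewrite /par sgn_cardE -signr_odd oC expr1 /=.
by lra.
Qed.

(** The reversal x~, the anti-automorphism equal to the identity on V. *)
Definition rv x : clif := fun A => rev_sign R A * x A.

Lemma rvZ a x : rv (a *: x) = a *: rv x.
Proof. by apply/funext => A; rewrite /rv !scale_coef mulrCA. Qed.
Lemma rvM x y : rv (x * y) = rv y * rv x.
Proof.
apply/funext => C; rewrite mul_coef /rv mul_coef mulr_sumr.
rewrite [RHS](reindex_inj (can_inj (symdiffK C))); apply: eq_bigr => A _ /=.
have -> : symdiff (symdiff C A) C = A by rewrite symdiffC symdiffK.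
rewrite (symdiffC C); set B := symdiff A C.
rewrite (_ : C = symdiff A B); last by rewrite symdiffK.
by rewrite [LHS]mulrA [in LHS]mulrA rev_signD; ring.
Qed.
Lemma rv1 : rv 1 = 1.
Proof.
apply/funext => A; rewrite /rv one_coef; case: eqP => [->|]; last by rewrite mulr0.
rewrite mulr1 /rev_sign /inv_sign big1 // => i _; rewrite big1 // => j _.
by rewrite inE.
Qed.
Lemma rv_vec v : rv (cvec v) = cvec v.
Proof.
apply/funext => A; rewrite /rv /cvec /vec mulr_sumr; apply: eq_bigr => i _.
case: eqP => [->|]; last by rewrite mul0r mulr0.
rewrite /rev_sign /inv_sign big1 ?mul1r // => a _; rewrite big1 // => b _.
by rewrite !inE; case: eqP => [->|//]; case: eqP => [->|//]; rewrite ltnn.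
Qed.

(** For i in A, e_i e_A = - (-1)^|A| e_A e_i, so the hypothesis, read at the blade A minus i, kills
    the coefficient of A. The twist by [par] matters: in odd dimension the volume element is central
    without being scalar. *)
Lemma twisted_center x :
  (forall i : 'I_(p + q),
     bl (finset.set1 i) * x = par x * bl (finset.set1 i)) -> x = (x finset.set0)%:A.
Proof.
move=> cx; apply/funext => A; rewrite scale_coef one_coef.
have [->|] := eqVneq; first by rewrite mulr1.
case/set0Pn => i iA; rewrite mulr0.
have := congr1 (fun f => f (symdiff (finset.set1 i) A)) (cx i).
rewrite !mul_coef (bigD1 (finset.set1 i)) //= symdiffK bl_coef eqxx mulr1.
rewrite big1 ?addr0 => [|B Bi]; last by rewrite bl_coef (negbTE Bi) mulr0 mul0r.
rewrite (bigD1 A) //= (symdiffC _ A) symdiffK bl_coef eqxx mulr1.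
rewrite big1 ?addr0 => [|B BA]; last first.
  rewrite bl_coef (_ : (_ == _) = false) ?mulr0 //.
  apply: contraNF BA => /eqP/setP e; apply/eqP/setP => k; move: (e k).
  by rewrite !in_symdiff; do 3!case: (k \in _).
rewrite /par => e.
suff E : blade_sign R (finset.set1 i) A = - (blade_sign R A (finset.set1 i) * sgn_card R A).
  have t0 : blade_sign R A (finset.set1 i) * sgn_card R A * x A = 0.
    by move: e; rewrite E; lra.
  have s2 : sgn_card R A * sgn_card R A = 1 by rewrite sgn_cardE -expr2 sqrr_sign.
  rewrite -[LHS]mul1r -(blade_sign_sqr R A (finset.set1 i)) -[LHS]mul1r -s2.
  transitivity (blade_sign R A (finset.set1 i) * sgn_card R A *
    (blade_sign R A (finset.set1 i) * sgn_card R A * x A)); first by ring.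
  by rewrite t0 mulr0.
have hs := blade_sign_sqr R A (finset.set1 i).
have : blade_sign R (finset.set1 i) A * blade_sign R A (finset.set1 i) = - sgn_card R A.
  rewrite !blade_signE mulrACA inv_sign_comm.
  have -> : sq_sign R A (finset.set1 i) = sq_sign R (finset.set1 i) A.
    by apply: eq_bigr => k _; rewrite andbC.
  have -> : sq_sign R (finset.set1 i) A * sq_sign R (finset.set1 i) A = 1.
    rewrite -big_split big1 // => k _ /=.
    by case: (_ && _); rewrite /= ?expr0 ?expr1 ?mulr1 // mulrNN ip_sign_sqr.
  rewrite mulr1 (bigD1 i) //= [X in _ * X]big1 => [|a ai]; last first.
    by rewrite big1 // => b _; rewrite inE (negbTE ai).
  rewrite mulr1 /sgn_card (bigD1 i) //= [in RHS](bigD1 i) //= iA eqxx !andbF.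
  rewrite expr0 mul1r expr1 mulN1r opprK; apply: eq_bigr => b bi.
  by rewrite inE eqxx /= (eq_sym i) bi andbT.
move=> h; rewrite -[LHS]mulr1 -hs mulrA h; ring.
Qed.

End CliffordTheory.

(** * Reflections and products of unit vectors *)

Section Reflections.
Variables (R : realType) (p q : nat).
Implicit Types (u v w : Vec R p q) (s h : seq (Vec R p q)) (J : pred 'I_(p + q)).
Local Notation clif := (clif R p q).
Local Notation Vec := (Vec R p q).

Definition vprod s : clif := \prod_(v <- s) cvec v.

Lemma vprod_nil : vprod [::] = 1. Proof. by rewrite /vprod big_nil. Qed.
Lemma vprod_cons v s : vprod (v :: s) = cvec v * vprod s.
Proof. by rewrite /vprod big_cons. Qed.
Lemma vprod_cat s h : vprod (s ++ h) = vprod s * vprod h.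
Proof. by rewrite /vprod big_cat. Qed.

Lemma cl_prodE s : cl_prod [seq vec v | v <- s] = vprod s.
Proof. by elim: s => [|v s IH]; rewrite ?vprod_nil // vprod_cons -IH. Qed.

Definition unitv v := ip v v = 1 \/ ip v v = -1.
Definition unit_seq (S : set Vec) s := forall v, v \in s -> S v /\ unitv v.

Lemma unit_seq_cons (S : set Vec) v s :
  unit_seq S (v :: s) <-> [/\ S v, unitv v & unit_seq S s].
Proof.
split=> [H|[Sv uv H] w]; last by rewrite inE => /orP[/eqP->|/H].
have [Sv uv] := H v (mem_head _ _); split=> // w ws; apply: H.
by rewrite inE ws orbT.
Qed.

Lemma unit_seq_cat (S : set Vec) s h :
  unit_seq S (s ++ h) <-> unit_seq S s /\ unit_seq S h.
Proof.
split=> [H|[H1 H2] w]; last by rewrite mem_cat => /orP[/H1|/H2].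
by split=> w ws; apply: H; rewrite mem_cat ws ?orbT.
Qed.

Lemma unit_seq_rev (S : set Vec) s : unit_seq S s -> unit_seq S (rev s).
Proof. by move=> H v; rewrite mem_rev; apply: H. Qed.

Lemma unit_seq_sub (S S' : set Vec) s : S `<=` S' -> unit_seq S s -> unit_seq S' s.
Proof. by move=> SS H v /H[/SS]. Qed.

Lemma PinInP (S : set Vec) (x : Cl R p q) :
  PinIn S x <-> exists2 s, unit_seq S s & x = vprod s.
Proof.
by split=> [[s [H ->]]|[s H ->]]; exists s; rewrite ?cl_prodE.
Qed.

Lemma par_vprod s : par (vprod s) = (-1) ^+ size s *: vprod s.
Proof.
elim: s => [|v s IH]; first by rewrite vprod_nil par1 scale1r.
by rewrite vprod_cons parM par_vec IH exprS -scalerA scaleN1r -scalerAr mulNr scalerN.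
Qed.

Lemma rv_vprod s : rv (vprod s) = vprod (rev s).
Proof.
elim: s => [|v s IH]; first by rewrite vprod_nil rv1.
by rewrite rev_cons -cats1 vprod_cat vprod_cons vprod_cons vprod_nil mulr1 rvM rv_vec IH.
Qed.

(* The spinor norm of a product of unit vectors, up to the sign (-1)^(size s). *)
Definition nu s : R := \prod_(v <- s) - ip v v.

Lemma nu_nil : nu [::] = 1. Proof. by rewrite /nu big_nil. Qed.
Lemma nu_cons v s : nu (v :: s) = - ip v v * nu s. Proof. by rewrite /nu big_cons. Qed.
Lemma nu_cat s h : nu (s ++ h) = nu s * nu h. Proof. by rewrite /nu big_cat. Qed.
Lemma nu_rev s : nu (rev s) = nu s.
Proof. by rewrite /nu (perm_big s) // perm_rev. Qed.

Lemma unitv_sqr v : unitv v -> ip v v * ip v v = 1.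
Proof. by case=> ->; rewrite ?mulr1 ?mulrNN ?mulr1. Qed.

Lemma nu_sqr S s : unit_seq S s -> nu s * nu s = 1.
Proof.
elim: s => [|v s IH]; first by rewrite nu_nil mulr1.
case/unit_seq_cons => _ uv /IH e.
by rewrite nu_cons mulrACA e mulr1 mulrNN unitv_sqr.
Qed.

Lemma vprod_rv s : vprod s * rv (vprod s) = (nu s)%:A.
Proof.
elim: s => [|v s IH]; first by rewrite vprod_nil rv1 nu_nil mulr1 scale1r.
rewrite vprod_cons rvM rv_vec mulrA -(mulrA (cvec v)) IH -scalerAr mulr1 -scalerAl vec_sqr.
by rewrite scalerA nu_cons mulrC.
Qed.

Lemma rv_vprodl s : rv (vprod s) * vprod s = (nu s)%:A.
Proof.
have := vprod_rv (rev s); rewrite !rv_vprod revK => ->.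
by rewrite nu_rev.
Qed.

(** The choice made by [cl_inv] is harmless: two-sided inverses are unique, and the default value is
    not reached. *)
Lemma cl_inv_uniq (x y : clif) : x * y = 1 -> y * x = 1 -> cl_inv x = y.
Proof.
move=> xy yx; pose z : clif := cl_inv x.
have [xz _] : x * z = 1 /\ z * x = 1.
  apply: (@xgetPex _ (cl_one R p q)
    (fun y => cl_mul x y = cl_one R p q /\ cl_mul y x = cl_one R p q)).
  by exists y.
have : y * (x * z) = y by rewrite xz mulr1.
by rewrite mulrA yx mul1r.
Qed.

Lemma vprod_inv S s : unit_seq S s -> cl_inv (vprod s) = nu s *: rv (vprod s).
Proof.
move=> us; apply: cl_inv_uniq.
  by rewrite -scalerAr vprod_rv scalerA (nu_sqr us) scale1r.
by rewrite -scalerAl rv_vprodl scalerA (nu_sqr us) scale1r.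
Qed.

(* The reflection in the hyperplane orthogonal to a unit vector u: multiplying by
   [ip u u] is then the same as dividing by it. *)
Definition refl u v := v - (2 * ip u v * ip u u) *: u.
Definition vrot s v := foldr refl v s.

Lemma refl_lin u a v w : refl u (a *: v + w) = a *: refl u v + refl u w.
Proof.
rewrite /refl ipDr ipZr scalerBr scalerA; apply/rowP => i; rewrite !mxE; ring.
Qed.

Lemma ip_refl u v w : unitv u -> ip (refl u v) (refl u w) = ip v w.
Proof.
move=> uu; rewrite /refl !(ipDl, ipDr, ipNl, ipNr, ipZl, ipZr) (ipC v u).
by case: uu => ->; ring.
Qed.

Lemma refl_orth u v : ip u v = 0 -> refl u v = v.
Proof. by rewrite /refl => ->; rewrite mulr0 mul0r scale0r subr0. Qed.

Lemma refl_conj u v : unitv u -> cvec (refl u v) * cvec u = - (cvec u * cvec v).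
Proof.
move=> uu; rewrite /refl vecB vecZ mulrBl -scalerAl vec_sqr scalerA.
have -> : cvec v * cvec u = (- 2 * ip u v)%:A - cvec u * cvec v.
  by rewrite -(vec_anti u v) [RHS]addrC addKr.
rewrite addrAC -scalerBl (_ : - 2 * ip u v - _ = 0) ?scale0r ?add0r //.
by case: uu => ->; ring.
Qed.

Lemma rot_lin s a v w : vrot s (a *: v + w) = a *: vrot s v + vrot s w.
Proof. by elim: s => //= u s IH; rewrite IH refl_lin. Qed.

Lemma ip_rot S s v w : unit_seq S s -> ip (vrot s v) (vrot s w) = ip v w.
Proof. by elim: s => //= u s IH /unit_seq_cons[_ uu /IH <-]; rewrite ip_refl. Qed.

Lemma rot_cat s h v : vrot (s ++ h) v = vrot s (vrot h v).
Proof. by rewrite /vrot foldr_cat. Qed.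

Lemma rot_orth s v : (forall u, u \in s -> ip u v = 0) -> vrot s v = v.
Proof.
elim: s => //= u s IH H; rewrite IH ?refl_orth ?H ?mem_head // => w ws.
by rewrite H // inE ws orbT.
Qed.

(** Conjugation by a unit vector is minus its reflection, whence the sign. Multiplying through by
    [vprod s] avoids inverses. *)
Lemma rot_conj S s v : unit_seq S s ->
  cvec (vrot s v) * vprod s = (-1) ^+ size s *: (vprod s * cvec v).
Proof.
elim: s => [|u s IH]; first by rewrite vprod_nil mulr1 mul1r scale1r.
case/unit_seq_cons => _ uu /IH e.
rewrite -[vrot (u :: s) v]/(refl u (vrot s v)) vprod_cons mulrA refl_conj //.
by rewrite mulNr -!mulrA e -scalerAr exprS -scalerA scaleN1r.
Qed.

Lemma refl_refl u v : unitv u -> refl u (refl u v) = v.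
Proof.
move=> uu; apply/rowP => i; rewrite /refl !(ipDr, ipNr, ipZr) !mxE.
by case: uu => ->; ring.
Qed.

Lemma rot_rev S s v : unit_seq S s -> vrot (rev s) (vrot s v) = v.
Proof.
elim: s v => //= u s IH v /unit_seq_cons[_ uu us].
by rewrite rev_cons -cats1 rot_cat /= refl_refl // IH.
Qed.

Definition ev (i : 'I_(p + q)) : Vec := delta_mx ord0 i.

Lemma cvec_ev i : cvec (ev i) = bl R (finset.set1 i).
Proof.
rewrite vecE (bigD1 i) //= mxE !eqxx scale1r big1 ?addr0 // => j ji.
by rewrite mxE (negbTE ji) andbF scale0r.
Qed.

Lemma ip_ev i v : ip (ev i) v = ip_sign R i * v ord0 i.
Proof.
rewrite /ip (bigD1 i) //= mxE !eqxx mulr1 big1 ?addr0 // => j ji.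
by rewrite mxE (negbTE ji) andbF mulr0 mul0r.
Qed.

Lemma ip_ev_ev i j : ip (ev i) (ev j) = ip_sign R i * (i == j)%:R.
Proof. by rewrite ip_ev mxE eqxx. Qed.

Lemma ev_unit i : unitv (ev i).
Proof. by rewrite /unitv ip_ev_ev eqxx mulr1 /ip_sign; case: ifP; [left|right]. Qed.

Lemma vec_evE v : v = \sum_i v ord0 i *: ev i.
Proof.
apply/rowP => j; rewrite summxE (bigD1 j) //= !mxE !eqxx mulr1 big1 ?addr0 // => i ij.
by rewrite !mxE (eq_sym j) (negbTE ij) andbF mulr0.
Qed.

(** The kernel of the twisted adjoint representation. A product inducing the identity is
    twisted-central, hence a scalar c; then c^2 = [nu s], which squares to 1, so c^4 = 1 and the
    real number c is 1 or -1. *)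
Lemma rot_id_pm1 S s : unit_seq S s -> (forall i, vrot s (ev i) = ev i) ->
  vprod s = 1 \/ vprod s = -1.
Proof.
move=> us H.
have e : vprod s = (vprod s finset.set0)%:A.
  apply: twisted_center => i.
  by rewrite par_vprod -scalerAl -!cvec_ev -(rot_conj _ us) H.
have := vprod_rv s; rewrite e rvZ rv1 -scalerAl mul1r scalerA.
set c := vprod s _ => ec.
have {ec} cc : c * c = nu s.
  have := congr1 (fun f => f finset.set0) ec.
  by rewrite !scale_coef one_coef eqxx !mulr1.
have : (c * c - 1) * (c * c + 1) = 0.
  by rewrite -subr_sqr !expr2 cc (nu_sqr us) mulr1 subrr.
move/eqP; rewrite mulf_eq0 => /orP[|]; last first.
  by rewrite gt_eqF // ltr_wpDl // -expr2 sqr_ge0.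
rewrite -expr2 subr_eq0 sqrf_eq1 => /orP[] /eqP ->; rewrite ?scale1r ?scaleN1r; tauto.
Qed.

Definition cspan J : set Vec := [set v | forall i, ~~ J i -> v ord0 i = 0].

Lemma cspan_lin J a v w : cspan J v -> cspan J w -> cspan J (a *: v + w).
Proof. by move=> hv hw i iJ; rewrite !mxE hv // hw // mulr0 addr0. Qed.

Lemma cspan0 J : cspan J 0. Proof. by move=> i _; rewrite mxE. Qed.

Lemma cspanZ J a v : cspan J v -> cspan J (a *: v).
Proof. by move=> hv i iJ; rewrite mxE hv // mulr0. Qed.

Lemma cspanD J v w : cspan J v -> cspan J w -> cspan J (v + w).
Proof. by move=> hv hw; rewrite -[v]scale1r; apply: cspan_lin. Qed.

Lemma cspanN J v : cspan J v -> cspan J (- v).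
Proof. by move=> hv; rewrite -scaleN1r; apply: cspanZ. Qed.

Lemma cspan_ev J i : J i -> cspan J (ev i).
Proof.
by move=> iJ j jJ; rewrite mxE [j == i](_ : _ = false) ?andbF //; apply: contraNF jJ => /eqP->.
Qed.

Lemma cspan_ip J v w : cspan J v -> cspan (predC J) w -> ip v w = 0.
Proof.
move=> hv hw; rewrite /ip big1 // => i _; case: (boolP (J i)) => iJ.
  by rewrite hw ?mulr0 //= iJ.
by rewrite hv // mulr0 mul0r.
Qed.

Lemma refl_cspan J u v : cspan J u -> cspan J v -> cspan J (refl u v).
Proof. by move=> hu hv; rewrite /refl addrC -scaleNr; apply: cspan_lin. Qed.

Lemma rot_cspan J s v : unit_seq (cspan J) s -> cspan J v -> cspan J (vrot s v).
Proof.
elim: s => //= u s IH /unit_seq_cons[hu _ hs] hv.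
by apply: refl_cspan => //; apply: IH.
Qed.

Lemma rot_fix J s v : unit_seq (cspan J) s -> cspan (predC J) v -> vrot s v = v.
Proof. by move=> us hv; apply: rot_orth => u /us[hu _]; apply: (cspan_ip hu hv). Qed.

Lemma rot_fixC J s v : unit_seq (cspan (predC J)) s -> cspan J v -> vrot s v = v.
Proof.
by move=> us hv; apply: rot_orth => u /us[hu _]; rewrite ipC; apply: (cspan_ip hv hu).
Qed.

Lemma normalise v : ip v v != 0 ->
  exists a, unitv (a *: v) /\ forall x, refl (a *: v) x = x - (2 * ip v x / ip v v) *: v.
Proof.
move=> v0; pose c := ip v v; exists (Num.sqrt `|c|)^-1.
have c0 : 0 < `|c| by rewrite normr_gt0.
have aa : (Num.sqrt `|c|)^-1 * (Num.sqrt `|c|)^-1 = `|c|^-1.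
  by rewrite -invfM -expr2 sqr_sqrtr // ltW.
split.
  rewrite /unitv ipZl ipZr mulrA aa -/c.
  have [cp|cn|ce] := ltrgt0P c; last by rewrite /c in ce; rewrite ce eqxx in v0.
    by left; rewrite mulVf // gt_eqF.
  by right; rewrite invrN mulNr mulVf // lt_eqF.
move=> x; rewrite /refl !ipZl ipZr scalerA -/c; congr (_ - _ *: _).
set k := (Num.sqrt _)^-1 in aa *.
transitivity (2 * ip v x * c * (k * k) * (k * k)); first by ring.
rewrite aa; have [cp|cn|ce] := ltrgt0P c; last by rewrite /c in ce; rewrite ce eqxx in v0.
  by field; rewrite gt_eqF.
by field; rewrite lt_eqF.
Qed.

(** The reflection in w - e sends w to e unless w - e is null. In that case <w + e, w + e> = 4 <e,
    e> is nonzero by the parallelogram identity; the reflection in w + e sends w to -e and the one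
    in e corrects the sign. All vectors used lie in the span of e and w, so whatever is orthogonal
    to both stays fixed. *)
Lemma move_vec e w : unitv e -> ip e e = ip w w ->
  exists h, [/\ (size h <= 2)%N, vrot h w = e &
    forall u, u \in h -> unitv u /\ exists a b, u = a *: e + b *: w].
Proof.
move=> ue ew; have [n0|n0] := eqVneq (ip (w - e) (w - e)) 0; last first.
  have [a [ua ra]] := normalise n0; exists [:: a *: (w - e)]; split=> //=.
    rewrite ra (_ : 2 * _ / _ = 1) ?scale1r ?subKr //.
    have e2 : ip (w - e) (w - e) = 2 * ip (w - e) w.
      rewrite !(ipDl, ipDr, ipNl, ipNr) (ipC w e) ew; ring.
    by rewrite -e2 divff.
  move=> u; rewrite inE => /eqP->; split=> //; exists (- a), a.
  by rewrite scalerBr addrC scaleNr.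
have e0 : ip e e != 0 by case: ue => ->; rewrite ?oppr_eq0 oner_eq0.
have n1 : ip (w + e) (w + e) != 0.
  have h : ip (w + e) (w + e) + ip (w - e) (w - e) = 4 * ip e e.
    by rewrite !(ipDl, ipDr, ipNl, ipNr) (ipC w e) -ew; ring.
  by move: h; rewrite n0 addr0 => ->; rewrite mulf_neq0 // pnatr_eq0.
have [a [ua ra]] := normalise n1; exists [:: e; a *: (w + e)]; split=> //=.
  rewrite ra (_ : 2 * _ / _ = 1) ?scale1r; last first.
    have e2 : ip (w + e) (w + e) = 2 * ip (w + e) w.
      rewrite !(ipDl, ipDr, ipNl, ipNr) (ipC w e) ew; ring.
    by rewrite -e2 divff.
  rewrite opprD addNKr /refl ipNr -mulrA mulNr unitv_sqr // mulrN1 scaleNr.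
  by rewrite opprK scaler_nat mulr2n addKr.
move=> u; rewrite !inE => /orP[] /eqP->; split=> //.
  by exists 1, 0; rewrite scale1r scale0r addr0.
by exists a, a; rewrite scalerDr addrC.
Qed.

(* Weak Cartan-Dieudonne: straighten the basis vectors one after the other; the
   reflections used for a basis vector are orthogonal to the ones already fixed. *)
Lemma cartan_dieudonne J (T : Vec -> Vec) :
  (forall v w, ip (T v) (T w) = ip v w) -> (forall i, J i -> cspan J (T (ev i))) ->
  exists h, [/\ unit_seq (cspan J) h, (size h <= 2 * (p + q))%N &
                forall i, J i -> vrot h (T (ev i)) = ev i].
Proof.
move=> iT jT.
suff [h [uh sh rh]] : exists h, [/\ unit_seq (cspan J) h,
    (size h <= 2 * size (enum J))%N & forall i, i \in enum J -> vrot h (T (ev i)) = ev i].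
  exists h; split=> //; last by move=> i iJ; apply: rh; rewrite mem_enum.
  rewrite (leq_trans sh) // leq_mul2l /= -cardE.
  by rewrite (leq_trans (max_card _)) // card_ord.
have : all J (enum J) by apply/allP => i; rewrite mem_enum.
have := enum_uniq J; elim: (enum J) => [_ _|i l IH /= /andP[il ul] /andP[iJ lJ]].
  by exists [::].
have [h [uh sh rh]] := IH ul lJ; pose w := vrot h (T (ev i)).
have wJ : cspan J w by apply: rot_cspan => //; apply: jT.
have ww : ip (ev i) (ev i) = ip w w by rewrite (ip_rot _ _ uh) iT.
have [k [sk rk uk]] := move_vec (ev_unit i) ww.
exists (k ++ h); split.
- apply/unit_seq_cat; split=> // u /uk[uu [a [b e]]]; split=> //.
  by rewrite e; apply: cspan_lin; [apply: cspan_ev|apply: cspanZ].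
- by rewrite size_cat /= mulnS leq_add.
move=> j; rewrite inE => /orP[/eqP->|jl]; first by rewrite rot_cat -/w rk.
rewrite rot_cat rh //; apply: rot_orth => u /uk[_ [a [b ->]]].
have ij : i != j by apply: contraNneq il => ->.
rewrite ipDl !ipZl ip_ev_ev (negbTE ij) !mulr0 add0r.
rewrite -[ev j]rh // (ip_rot _ _ uh) iT ip_ev_ev (negbTE ij).
by rewrite !mulr0.
Qed.

Lemma unit_seqT J s : unit_seq (cspan J) s -> unit_seq setT s.
Proof. exact: unit_seq_sub. Qed.

Lemma vprod_solve h s : unit_seq setT h -> vprod h * vprod s = 1 \/ vprod h * vprod s = -1 ->
  vprod s = vprod (rev h) \/ vprod s = - vprod (rev h).
Proof.
move=> uh H.
have [c c1 e] : exists2 c : R, c * c = 1 & vprod h * vprod s = c%:A.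
  by case: H => ->; [exists 1|exists (-1)];
    rewrite ?scale1r ?scaleN1r ?mulrNN ?mulr1.
have es : vprod s = (nu h * c) *: vprod (rev h).
  have := congr1 (fun t => nu h *: (rv (vprod h) * t)) e.
  rewrite mulrA rv_vprodl -scalerAl mul1r scalerA (nu_sqr uh) scale1r => ->.
  by rewrite -scalerAr mulr1 scalerA rv_vprod.
have : (nu h * c) ^+ 2 = 1.
  by rewrite expr2 mulrACA (nu_sqr uh) c1 mulr1.
rewrite es => /eqP; rewrite sqrf_eq1 => /orP[] /eqP ->; rewrite ?scale1r ?scaleN1r; tauto.
Qed.

(** The reflections that straighten the rotation of s, in reversed order, form a word with the same
    rotation, so the two products agree up to sign. The uniform bound on the length is the source of
    compactness. *)
Lemma pin_bounded J s : unit_seq (cspan J) s ->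
  exists h, [/\ unit_seq (cspan J) h, (size h <= 2 * (p + q))%N &
                vprod s = vprod h \/ vprod s = - vprod h].
Proof.
move=> us.
have [||h [uh sh rh]] := @cartan_dieudonne J (vrot s).
- by move=> v w; rewrite (ip_rot _ _ us).
- by move=> i iJ; apply: rot_cspan => //; apply: cspan_ev.
exists (rev h); split; rewrite ?size_rev //; first exact: unit_seq_rev.
apply: vprod_solve; first exact: unit_seqT uh.
rewrite -vprod_cat; apply: (@rot_id_pm1 (cspan J)); first exact/unit_seq_cat.
move=> i; rewrite rot_cat; case: (boolP (J i)) => iJ; first exact: rh.
by rewrite !(@rot_fix J) //; apply: cspan_ev.
Qed.

(** The two summands are straightened independently: reflections in vectors of one fix the other
    pointwise. *)
Lemma pin_split J s : unit_seq setT s ->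
  (forall v, cspan J v -> cspan J (vrot s v)) ->
  (forall v, cspan (predC J) v -> cspan (predC J) (vrot s v)) ->
  exists h1 h2, [/\ unit_seq (cspan J) h1, unit_seq (cspan (predC J)) h2 &
    vprod s = vprod h1 * vprod h2 \/ vprod s = - (vprod h1 * vprod h2)].
Proof.
move=> us sJ sC.
have is_ v w : ip (vrot s v) (vrot s w) = ip v w by rewrite (ip_rot _ _ us).
have [|h1 [u1 _ r1]] := @cartan_dieudonne J (vrot s) is_.
  by move=> i iJ; apply: sJ; apply: cspan_ev.
have [|h2 [u2 _ r2]] := @cartan_dieudonne (predC J) (vrot s) is_.
  by move=> i iJ; apply: sC; apply: cspan_ev.
exists (rev h1), (rev h2); split; try exact: unit_seq_rev.
rewrite -vprod_cat -rev_cat; apply: vprod_solve.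
  by apply/unit_seq_cat; split; apply: unit_seqT; eassumption.
rewrite -vprod_cat; apply: (@rot_id_pm1 setT).
  by apply/unit_seq_cat; split=> //; apply/unit_seq_cat; split; apply: unit_seqT; eassumption.
move=> i; rewrite !rot_cat; case: (boolP (J i)) => iJ.
  by rewrite r1 // (@rot_fix (predC J)) //; apply: cspan_ev; rewrite /= negbK.
by rewrite (@rot_fix J h1) ?r2 //; apply: sC; apply: cspan_ev.
Qed.

End Reflections.

(** * Equivariance of Pi *)

Section Equivariance.
Variables (R : realType) (p q m : nat).
Variables (rho : Cl R p q -> 'M[R]_m) (Pi : 'cV[R]_m -> 'cV[R]_m -> Vec R p q).
Hypotheses (rhoP : is_Cl0_module rho) (PiP : is_wedge2_map Pi).
Hypothesis PiE : equivariant rho Pi.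
Implicit Types (u v w z f : Vec R p q) (l : seq (Vec R p q)) (s t : 'cV[R]_m).
Local Notation clif := (clif R p q).

Lemma even1 : cl_even (1 : clif).
Proof. by apply/cl_evenP; rewrite par1. Qed.

Lemma evenM (x y : clif) : cl_even x -> cl_even y -> cl_even (x * y).
Proof. by move=> /cl_evenP ex /cl_evenP ey; apply/cl_evenP; rewrite parM ex ey. Qed.

Lemma evenD (x y : clif) : cl_even x -> cl_even y -> cl_even (x + y).
Proof. by move=> /cl_evenP ex /cl_evenP ey; apply/cl_evenP; rewrite parD ex ey. Qed.

Lemma evenZ a (x : clif) : cl_even x -> cl_even (a *: x).
Proof. by move=> /cl_evenP ex; apply/cl_evenP; rewrite parZ ex. Qed.

Lemma even_vprod l : ~~ odd (size l) -> cl_even (vprod l).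
Proof. by move=> h; apply/cl_evenP; rewrite par_vprod -signr_odd (negbTE h) scale1r. Qed.

Lemma even2 u v : cl_even (cvec u * cvec v).
Proof.
have := @even_vprod [:: u; v] isT.
by rewrite !vprod_cons vprod_nil mulr1.
Qed.

Lemma rho1 : rho (1 : clif) = 1%:M. Proof. by case: rhoP. Qed.
Lemma rhoD (x y : clif) : cl_even x -> cl_even y -> rho (x + y) = rho x + rho y.
Proof. by case: rhoP => _ h _ _; apply: h. Qed.
Lemma rhoZ a (x : clif) : cl_even x -> rho (a *: x) = a *: rho x.
Proof. by case: rhoP => _ _ h _; apply: h. Qed.
Lemma rhoM (x y : clif) : cl_even x -> cl_even y -> rho (x * y) = rho x *m rho y.
Proof. by case: rhoP => _ _ _ h; apply: h. Qed.

Lemma PiDl s s' t : Pi (s + s') t = Pi s t + Pi s' t.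
Proof. by case: PiP => _ h; rewrite -[s]scale1r h !scale1r. Qed.
Lemma Pi0l t : Pi 0 t = 0.
Proof. by apply: (@addrI _ (Pi 0 t)); rewrite -PiDl !addr0. Qed.
Lemma PiZl a s t : Pi (a *: s) t = a *: Pi s t.
Proof. by case: PiP => _ h; rewrite -[a *: s]addr0 h Pi0l addr0. Qed.
Lemma PiDr s t t' : Pi s (t + t') = Pi s t + Pi s t'.
Proof. by case: PiP => h _; rewrite h PiDl opprD -!(h s). Qed.
Lemma PiZr a s t : Pi s (a *: t) = a *: Pi s t.
Proof. by case: PiP => h _; rewrite h PiZl -scalerN -h. Qed.

(** Equivariance rewritten for the Clifford product: u v is -2 times [wedge_spin u v] minus <u, v>,
    and the scalar contributes once in each argument. *)
Lemma Pi_equiv u v s t :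
  Pi (rho (cvec u * cvec v) *m s) t + Pi s (rho (cvec u * cvec v) *m t) =
  - 2 *: wedge_act u v (Pi s t) - (2 * ip u v) *: Pi s t.
Proof.
have ws : wedge_spin u v = (- 2^-1) *: (cvec u * cvec v + (ip u v)%:A) :> clif.
  rewrite /wedge_spin.
  have -> : cl_mul (vec v) (vec u) = (- 2 * ip u v)%:A - cvec u * cvec v :> clif.
    by rewrite -(vec_anti u v) [RHS]addrC addKr.
  rewrite !clifZE -[cl_mul _ _]/(cvec u * cvec v) clifDE.
  rewrite scaleN1r opprB addrA -mulr2n -[cvec u * cvec v *+ 2]scaler_nat -scaleNr.
  rewrite !scalerDr !scalerA.
  by congr (_ *: _ + _ *: _); field.
have := PiE u v s t; rewrite ws rhoZ; last first.
  by apply: evenD; [apply: even2|apply/evenZ/even1].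
rewrite rhoD; [|exact: even2|exact/evenZ/even1].
rewrite rhoZ; last exact: even1.
rewrite rho1; set A := rho _.
rewrite -!scalemxAl !mulmxDl !PiZl !PiZr !PiDl !PiDr -!scalemxAl !mul1mx !PiZl !PiZr.
by move=> <-; apply/rowP => i; rewrite !mxE; field.
Qed.

Definition bivec u v z := (- 2) *: wedge_act u v z.

(** The step from the Lie algebra to the group. Since A^2 = -2 <u, v> A - <u, u><v, v>, the
    infinitesimal identity at (A s, t) and at (s, A t) expresses Pi(A s, A t) through Pi(A s, t) +
    Pi(s, A t), which is again given by that identity. *)
Lemma Pi_pair u v s t (A := rho (cvec u * cvec v)) :
  Pi (A *m s) (A *m t) =
  2^-1 *: bivec u v (bivec u v (Pi s t) - (2 * ip u v) *: Pi s t)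
  + (ip u u * ip v v) *: Pi s t.
Proof.
have AA x : A *m (A *m x) = - (2 * ip u v) *: (A *m x) + (- (ip u u * ip v v)) *: x.
  rewrite mulmxA -rhoM; try exact: even2.
  have -> : cvec u * cvec v * (cvec u * cvec v) =
            - (2 * ip u v) *: (cvec u * cvec v) + (- (ip u u * ip v v)) *: 1 :> clif.
    rewrite mulrA -(mulrA (cvec u)).
    have -> : cvec v * cvec u = (- 2 * ip u v)%:A - cvec u * cvec v.
      by rewrite -(vec_anti u v) [RHS]addrC addKr.
    rewrite mulrBr mulrBl -scalerAr mulr1 -scalerAl; congr (_ + _).
      by congr (_ *: _); ring.
    rewrite mulrA vec_sqr -!mulrA vec_sqr -scalerAr -scalerAl !mulr1 scalerA.
    by rewrite -scaleNr; congr (_ *: _); ring.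
  rewrite (rhoD (evenZ _ (even2 u v)) (evenZ _ even1)).
  rewrite (rhoZ _ even1) (rhoZ _ (even2 u v)).
  by rewrite rho1 mulmxDl -!scalemxAl mul1mx.
have h1 := Pi_equiv u v (A *m s) t; have h2 := Pi_equiv u v s (A *m t).
rewrite -/A in h1 h2.
rewrite AA PiDl !PiZl in h1.
rewrite AA PiDr !PiZr in h2.
have h3 := Pi_equiv u v s t; rewrite -/A in h3.
have bD x y : bivec u v (x + y) = bivec u v x + bivec u v y.
  by rewrite /bivec /wedge_act !ipDr; apply/rowP => i; rewrite !mxE; ring.
have -> : bivec u v (Pi s t) - (2 * ip u v) *: Pi s t =
    Pi (A *m s) t + Pi s (A *m t) by rewrite h3.
rewrite bD; move: h1 h2; rewrite -!/(bivec _ _ _).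
move: (bivec u v (Pi (A *m s) t)) (bivec u v (Pi s (A *m t))) => b1 b2.
set X := Pi (A *m s) (A *m t); set Y := Pi (A *m s) t; set Z := Pi s (A *m t).
move=> h1 h2; apply/rowP => i.
move/rowP/(_ i): h1; move/rowP/(_ i): h2; rewrite !mxE.
by move=> h2 h1; lra.
Qed.

Lemma Pi_pair_unit u v s t (A := rho (cvec u * cvec v)) : unitv u -> unitv v ->
  Pi (A *m s) (A *m t) = (ip u u * ip v v) *: refl u (refl v (Pi s t)).
Proof.
move=> uu uv; rewrite Pi_pair /bivec /wedge_act /refl.
rewrite !(ipDr, ipNr, ipZr) (ipC v u); apply/rowP => i; rewrite !mxE.
by case: uu => ->; case: uv => ->; field.
Qed.

(** The word is consumed two letters at a time, because [rho] is known to be multiplicative only on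
    the even part. *)
Lemma Pi_rot l s t : unit_seq setT l -> ~~ odd (size l) ->
  Pi (rho (vprod l) *m s) (rho (vprod l) *m t) = nu l *: vrot l (Pi s t).
Proof.
move=> ul el; have : size l = (size l)./2.*2 by rewrite even_halfK.
move: (size l)./2 => n {el}.
elim: n l ul => [|n IH] [|u [|v l]] //.
  by move=> _ _; rewrite vprod_nil rho1 !mul1mx nu_nil scale1r.
move=> /unit_seq_cons[_ uu /unit_seq_cons[_ uv ul]]; rewrite doubleS => -[sl].
have el : cl_even (vprod l) by apply: even_vprod; rewrite sl odd_double.
rewrite !vprod_cons mulrA (rhoM (even2 u v) el).
rewrite -!mulmxA Pi_pair_unit // IH // !nu_cons mulrA mulrNN /=.
have reflZ a w x : refl w (a *: x) = a *: refl w x.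
  by apply/rowP => i; rewrite /refl ipZr !mxE; ring.
by rewrite !reflZ scalerA.
Qed.

(** [Pi_equiv] gives the sum of the contractions with A acting on the first and on the second
    argument. The two are equal by [Pi_pair] at s and A t, where A^2 = - <v, v> and the nonzero <v,
    v> cancels; so each is half of the sum. *)
Lemma Pi_contract_orth f v s t : ip f f = 1 -> ip f v = 0 -> ip v v != 0 ->
  ip f (Pi (rho (cvec f * cvec v) *m s) t) = - ip v (Pi s t).
Proof.
move=> f1 fv v0; set A := rho _.
have := Pi_equiv f v s t; rewrite -/A fv mulr0 scale0r subr0.
move/(congr1 (ip f)); rewrite /wedge_act !(ipDr, ipNr, ipZr) f1 fv mulr0 subr0 mulr1.
have e2 : ip f (Pi (A *m s) t) = ip f (Pi s (A *m t)).
  have := Pi_pair f v s (A *m t); rewrite -/A /=.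
  have -> : A *m (A *m t) = - (ip v v) *: t.
    rewrite mulmxA -rhoM; try exact: even2.
    have -> : cvec f * cvec v * (cvec f * cvec v) = (- ip v v) *: 1 :> clif.
      rewrite mulrA -(mulrA (cvec f)).
      have -> : cvec v * cvec f = - (cvec f * cvec v).
        apply/eqP; rewrite -addr_eq0 addrC vec_anti fv mulr0 scale0r; exact/eqP.
      rewrite mulrN mulNr mulrA vec_sqr -!mulrA vec_sqr -scalerAr -scalerAl !mulr1 scalerA.
      by rewrite -scaleNr f1; congr (_ *: _); ring.
    by rewrite rhoZ ?rho1 -?scalemxAl ?mul1mx //; exact: even1.
  rewrite PiZr fv mulr0 scale0r subr0 f1 mul1r => /(congr1 (ip f)).
  rewrite /bivec /wedge_act !(ipDr, ipNr, ipZr) f1 fv (ipC v f) fv => e.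
  by apply: (mulfI v0); move: e; lra.
by move=> e1; lra.
Qed.

(** Split v into a multiple of f, where f^2 = -1 is used, and a part w orthogonal to f, where the
    orthogonal case is used. The hypothesis rules out a nonzero null w; for f and v in the definite
    space E it holds automatically. *)
Lemma Pi_contract f v s t : ip f f = 1 ->
  (ip (v - ip f v *: f) (v - ip f v *: f) = 0 -> v = ip f v *: f) ->
  ip f (Pi (rho (cvec f * cvec v) *m s) t) = - ip v (Pi s t).
Proof.
move=> f1 vf; set a := ip f v in vf *; pose w := v - a *: f.
have vE : v = a *: f + w by rewrite addrC subrK.
have fw : ip f w = 0 by rewrite /w ipDr ipNr ipZr f1 mulr1 subrr.
have hff : rho (cvec f * cvec (a *: f)) = - a *: 1%:M.
  by rewrite vecZ -scalerAr vec_sqr f1 scalerA mulrN1 rhoZ ?rho1 //; exact: even1.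
have [w0|w0] := eqVneq (ip w w) 0.
  rewrite {1}(vf w0) hff -scalemxAl mul1mx PiZl ipZr.
  by rewrite mulNr -ipZl -(vf w0).
rewrite {1}vE vecD mulrDr rhoD; try exact: even2.
rewrite hff mulmxDl -scalemxAl mul1mx PiDl PiZl ipDr ipZr Pi_contract_orth //.
have -> : ip v (Pi s t) = a * ip f (Pi s t) + ip w (Pi s t) by rewrite -ipZl -ipDl -vE.
by ring.
Qed.

End Equivariance.

(** * Identity components *)

Section Continuity.
Variables (R : realType) (p q : nat).
Local Notation clif := (clif R p q).
Local Notation Cl := (Cl R p q).

(** The topology is a supremum of the initial topologies of the coefficients, so convergence is
    tested coefficientwise. *)
Lemma cl_cvg (T : Type) (F : set_system T) (FF : Filter F) (f : T -> Cl) (l : Cl) :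
  (forall A, f t A @[t --> F] --> l A) -> f t @[t --> F] --> l.
Proof.
move=> H; apply/cvg_sup => A U /= [_ [[B oB <-] /= Bl sB]].
have nB : nbhs (l A) B by apply: open_nbhs_nbhs.
have := H A B nB; rewrite /nbhs /=; apply: filterS => t /= Bt.
by apply: sB.
Qed.

Lemma coef_cvg (T : Type) (F : set_system T) (FF : Filter F) (f : T -> Cl) (l : Cl) A :
  f t @[t --> F] --> l -> f t A @[t --> F] --> l A.
Proof.
move=> H; apply: (@cvg_comp _ _ _ f (fun x : Cl => x A) _ _ _ H).
exact: (@proj_continuous _ (fun _ : blade p q => R) A l).
Qed.

Lemma rsum_cvg (T I : Type) (F : set_system T) (FF : Filter F) (r : seq I) (P : pred I)
    (f : I -> T -> R) (l : I -> R) :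
  (forall i, P i -> f i t @[t --> F] --> l i) ->
  \sum_(i <- r | P i) f i t @[t --> F] --> \sum_(i <- r | P i) l i.
Proof.
move=> H; elim: r => [|i r IH].
  by rewrite big_nil; under eq_cvg do rewrite big_nil; exact: cvg_cst.
rewrite big_cons; under eq_cvg do rewrite big_cons.
by case: ifPn => // Pi; apply: cvgD => //; apply: H.
Qed.

Lemma mul_cvg (T : Type) (F : set_system T) (FF : Filter F) (f g : T -> Cl) (a b : Cl) :
  f t @[t --> F] --> a -> g t @[t --> F] --> b ->
  cl_mul (f t) (g t) @[t --> F] --> cl_mul a b.
Proof.
move=> fa gb; apply: cl_cvg => C; rewrite cl_mulE.
under eq_cvg do rewrite cl_mulE.
apply: rsum_cvg => A _; apply: cvgM; last exact: coef_cvg.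
by apply: cvgM; [exact: cvg_cst|exact: coef_cvg].
Qed.

Lemma rv_cvg (T : Type) (F : set_system T) (FF : Filter F) (f : T -> Cl) (a : Cl) :
  f t @[t --> F] --> a -> (rv (f t) : Cl) @[t --> F] --> (rv a : Cl).
Proof.
by move=> fa; apply: cl_cvg => A; apply: cvgM; [exact: cvg_cst|exact: coef_cvg].
Qed.

Lemma scale_cvg (T : Type) (F : set_system T) (FF : Filter F) (c : T -> R) (f : T -> Cl)
    (k : R) (a : Cl) :
  c t @[t --> F] --> k -> f t @[t --> F] --> a ->
  cl_scale (c t) (f t) @[t --> F] --> cl_scale k a.
Proof. by move=> ck fa; apply: cl_cvg => A; apply: cvgM => //; exact: coef_cvg. Qed.

Lemma vec_cvg (T : Type) (F : set_system T) (FF : Filter F) (f : T -> Vec R p q)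
    (v : Vec R p q) :
  (forall i, f t ord0 i @[t --> F] --> v ord0 i) -> vec (f t) @[t --> F] --> vec v.
Proof.
move=> H; apply: cl_cvg => A; apply: rsum_cvg => i _.
by apply: cvgM => //; exact: cvg_cst.
Qed.

Lemma mul_continuous (T : topologicalType) (f g : T -> Cl) :
  continuous f -> continuous g -> continuous (fun t => cl_mul (f t) (g t)).
Proof. by move=> cf cg t; exact: (mul_cvg (nbhs_filter t) (cf t) (cg t)). Qed.

Lemma id_continuous (T : topologicalType) : continuous (@id T).
Proof. by move=> x; apply: cvg_id. Qed.

Lemma mull_continuous (a : Cl) : continuous (cl_mul a).
Proof.
by move=> x; apply: (@mul_continuous _ (fun=> a) id (@cst_continuous _ _ a) (@id_continuous Cl) x).
Qed.

Lemma rv_continuous : continuous (fun x : Cl => rv x : Cl).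
Proof. by move=> x; exact: (rv_cvg (nbhs_filter x) (@id_continuous _ x)). Qed.

(** The spinor norm as the scalar part of x~ x: defined and continuous on the whole algebra, while
    [nu] belongs to a word. *)
Definition nrm (x : Cl) : R := (rv x * x) finset.set0.

Lemma nrm_continuous : continuous nrm.
Proof.
move=> x; have h := @mul_continuous _ _ _ rv_continuous (@id_continuous Cl) x.
exact: (coef_cvg (nbhs_filter x) (A := finset.set0) h).
Qed.

Lemma nrm_vprod s : nrm (vprod s) = nu s.
Proof. by rewrite /nrm rv_vprodl scale_coef one_coef eqxx mulr1. Qed.

End Continuity.

(** * Group laws of Pin and Spin, and words in the identity component *)

Section SpinGroups.
Variables (R : realType) (p q : nat) (J : pred 'I_(p + q)).
Implicit Types (u v w : Vec R p q) (s : seq (Vec R p q)).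
Local Notation clif := (clif R p q).
Local Notation Cl := (Cl R p q).
Local Notation S := (@cspan R p q J).

Lemma PinIn1 : PinIn S (1 : clif).
Proof. by apply/PinInP; exists [::]; rewrite ?vprod_nil. Qed.

Lemma PinInM (x y : clif) : PinIn S x -> PinIn S y -> PinIn S (x * y).
Proof.
move=> /PinInP[s us ->] /PinInP[h uh ->]; apply/PinInP; exists (s ++ h).
  exact/unit_seq_cat.
by rewrite vprod_cat.
Qed.

Lemma unitvN v : unitv v -> unitv (- v).
Proof. by rewrite /unitv ipNl ipNr opprK. Qed.

Lemma PinInN_cons v s : unit_seq S (v :: s) -> PinIn S (- vprod (v :: s)).
Proof.
move/unit_seq_cons => [Sv uv us]; apply/PinInP; exists (- v :: s).
  by apply/unit_seq_cons; split=> //; [exact: cspanN|exact: unitvN].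
by rewrite !vprod_cons vecN mulNr.
Qed.

Lemma nu_pm s : unit_seq S s -> nu s = 1 \/ nu s = -1.
Proof.
move=> us; have /eqP := nu_sqr us; rewrite -expr2 sqrf_eq1.
by case/orP => /eqP; [left|right].
Qed.

(** The inverse is [nu] times the reversed word. A minus sign goes into the first letter; the empty
    word has [nu] equal to 1 and never carries one. *)
Lemma PinInV (x : clif) : PinIn S x -> PinIn S (cl_inv x).
Proof.
move=> /PinInP[s us ->]; rewrite (vprod_inv us) rv_vprod.
have ur := unit_seq_rev us; rewrite -nu_rev.
have [->|] := nu_pm ur; first by rewrite scale1r; apply/PinInP; exists (rev s).
case: (rev s) ur => [_|v h uv ->]; last by rewrite scaleN1r; apply: PinInN_cons.
by rewrite nu_nil; lra.
Qed.

Lemma PinIn_inv (x : clif) : PinIn S x -> x * cl_inv x = 1 /\ (cl_inv x : clif) * x = 1.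
Proof.
move=> /PinInP[s us ->]; rewrite (vprod_inv us) -scalerAl -scalerAr.
by rewrite vprod_rv rv_vprodl scalerA (nu_sqr us) scale1r.
Qed.

Lemma SpinIn1 : SpinIn S (1 : clif).
Proof. by split; [exact: PinIn1|exact: even1]. Qed.

Lemma SpinInM (x y : clif) : SpinIn S x -> SpinIn S y -> SpinIn S (x * y).
Proof. by move=> [px ex] [py ey]; split; [exact: PinInM|exact: evenM]. Qed.

Lemma par_inv (x : clif) : PinIn S x -> par (cl_inv x) = cl_inv (par x).
Proof.
move=> px; have [h1 h2] := PinIn_inv px; apply/esym/cl_inv_uniq.
  by rewrite -parM h1 par1.
by rewrite -parM h2 par1.
Qed.

Lemma SpinInV (x : clif) : SpinIn S x -> SpinIn S (cl_inv x).
Proof.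
move=> [px ex]; split; first exact: PinInV.
by apply/cl_evenP; rewrite par_inv //; move/cl_evenP: ex => ->.
Qed.

Local Notation S0 := (Spin0In S).

Lemma Spin0_sub : S0 `<=` SpinIn S. Proof. exact: connected_component_sub. Qed.

Lemma Spin0_1 : S0 (1 : clif).
Proof. by apply: connected_component_refl; exact: SpinIn1. Qed.

Lemma image_connected (T U : topologicalType) (f : T -> U) (A : set T) :
  continuous f -> connected A -> connected (f @` A).
Proof.
by move=> cf cA; apply: connected_continuous_connected => //; exact: continuous_subspaceT.
Qed.

(** Left translation by x carries the component of 1 to a connected set through x. *)
Lemma Spin0M (x y : clif) : S0 x -> S0 y -> S0 (x * y).
Proof.
move=> x0 y0; apply: (connected_component_trans x0).
have : [set cl_mul x z | z in S0] `<=` connected_component (SpinIn S) x.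
  apply: connected_component_max.
  - by exists (1 : clif); [exact: Spin0_1|rewrite clifME mulr1].
  - move=> _ [z z0 <-]; apply: SpinInM; exact: Spin0_sub.
  - by apply: image_connected; [exact: mull_continuous|exact: component_connected].
by apply; exists y.
Qed.

Lemma Spin0V (x : clif) : S0 x -> S0 (cl_inv x).
Proof.
move=> x0; have [px _] := Spin0_sub x0; have [h1 h2] := PinIn_inv px.
have : [set cl_mul (cl_inv x) z | z in S0] `<=` S0.
  apply: connected_component_max.
  - by exists x.
  - by move=> _ [z z0 <-]; apply: SpinInM; [apply: SpinInV|]; exact: Spin0_sub.
  - by apply: image_connected; [exact: mull_continuous|exact: component_connected].
by apply; exists (1 : clif); [exact: Spin0_1|rewrite clifME mulr1].
Qed.


(* The normalised straight segment from u to v stays away from the null cone. *)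
Lemma Spin0_pair (e : R) u v : S u -> S v -> (e = 1 \/ e = -1) -> ip u u = e -> ip v v = e ->
  0 <= e * ip u v -> S0 (- e *: (cvec u * cvec v)).
Proof.
move=> Su Sv ee uu vv uv.
pose y t := (1 - t) *: u + t *: v.
pose d t := e * ip (y t) (y t).
have dE t : d t = (1 - t) ^+ 2 + t ^+ 2 + 2 * t * (1 - t) * (e * ip u v).
  rewrite /d /y !(ipDl, ipDr, ipZl, ipZr) uu vv (ipC v u).
  by case: ee => ->; ring.
have d_gt0 t : t \in `[0, 1] -> 0 < d t.
  rewrite in_itv /= => /andP[t0 t1]; rewrite dE.
  have : 0 <= 2 * t * (1 - t) * (e * ip u v).
    by rewrite mulr_ge0 // mulr_ge0 ?mulr_ge0 // subr_ge0.
  nra.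
pose f t : Cl := cl_scale (- e) (cl_mul (vec u) (cl_scale (Num.sqrt (d t))^-1 (vec (y t)))).
have fc : {within `[0 : R, 1], continuous f}.
  apply: continuous_in_subspaceT => t; rewrite inE /= => t01.
  apply: scale_cvg; first exact: cvg_cst.
  apply: mul_cvg; first exact: cvg_cst.
  have yc i : y s ord0 i @[s --> t] --> y t ord0 i.
    rewrite /y; under eq_cvg do rewrite !mxE; rewrite !mxE.
    apply: cvgD; apply: cvgM; try exact: cvg_cst; last exact: cvg_id.
    by apply: cvgB; [exact: cvg_cst|exact: cvg_id].
  apply: scale_cvg; last exact: vec_cvg.
  apply: cvgV; first by rewrite gt_eqF // sqrtr_gt0 d_gt0.
  apply: (@cvg_comp _ _ _ d (@Num.sqrt R)); last exact: sqrt_continuous.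
  apply: cvgM; first exact: cvg_cst.
  apply: rsum_cvg => i _; apply: cvgM; last exact: yc.
  by apply: cvgM; [exact: cvg_cst|exact: yc].
have := connected_continuous_connected (@segment_connected R 0 1) fc.
have f0 : f 0 = (1 : clif).
  rewrite /f !clifZE -[vec (y 0)]/(cvec (y 0)) -[vec u]/(cvec u).
  have -> : y 0 = u by rewrite /y subr0 scale1r scale0r addr0.
  rewrite dE subr0 expr1n expr0n /= mulr0 !mul0r !addr0 sqrtr1 invr1 scale1r.
  rewrite clifME vec_sqr uu scalerA; case: ee => ->; rewrite ?mulrNN ?mulr1 scale1r //.
have f1 : f 1 = - e *: (cvec u * cvec v).
  rewrite /f !clifZE -[vec (y 1)]/(cvec (y 1)) -[vec u]/(cvec u).
  have -> : y 1 = v by rewrite /y subrr scale1r scale0r add0r.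
  by rewrite dE subrr expr1n expr0n /= mulr0 !mul0r addr0 add0r sqrtr1 invr1 scale1r.
move=> cf; rewrite -f1.
apply: (@connected_component_max _ _ (f @` `[0, 1])) => //.
- by exists 0 => //=; rewrite in_itv /= lexx ler01.
- move=> _ [t t01 <-].
  have t01' : t \in `[0, 1] by [].
  set k := (Num.sqrt (d t))^-1.
  have yS : S (k *: y t) by apply: cspanZ; apply: cspanD; apply: cspanZ.
  have yu : unitv (k *: y t).
    rewrite /unitv ipZl ipZr mulrA /k -invfM -expr2 sqr_sqrtr ?ltW ?d_gt0 //.
    have dn := d_gt0 _ t01'; have dd : ip (y t) (y t) = e * d t.
      by rewrite /d mulrA; case: ee => ->; rewrite ?mulrNN !mulr1 mul1r.
    by rewrite dd mulrCA mulVf ?gt_eqF // mulr1.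
  have -> : f t = - e *: (cvec u * cvec (k *: y t)) by rewrite vecZ.
  split; last by apply: evenZ; exact: even2.
  have uu' : unitv u by rewrite /unitv uu.
  case: (ee) => ->; rewrite ?opprK ?scale1r ?scaleN1r; last first.
    apply/PinInP; exists [:: u; k *: y t]; last by rewrite !vprod_cons vprod_nil mulr1.
    by apply/unit_seq_cons; split=> //; apply/unit_seq_cons; split.
  have := @PinInN_cons u [:: k *: y t]; rewrite !vprod_cons vprod_nil mulr1; apply.
  by apply/unit_seq_cons; split=> //; apply/unit_seq_cons; split.
- by exists 1 => //=; rewrite in_itv /= lexx ler01.
Qed.

(* The sign cannot be dropped: -1 is not in the identity component for R^{1,1}. *)
Definition Spin0pm : set Cl := [set x | S0 x \/ S0 (- (x : clif))].

Lemma Spin0pmM (x y : clif) : Spin0pm x -> Spin0pm y -> Spin0pm (x * y).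
Proof.
move=> [hx|hx] [hy|hy]; have := Spin0M hx hy; rewrite ?mulNr ?mulrN ?opprK;
  by [left|right].
Qed.

(** One of v and -v makes the scalar product with u have the sign required by [Spin0_pair]. *)
Lemma Spin0pm_pair u v : S u -> S v -> unitv u -> ip v v = ip u u ->
  Spin0pm (cvec u * cvec v).
Proof.
move=> Su Sv uu vv; have [h|h] := leP 0 (ip u u * ip u v).
  have := Spin0_pair Su Sv uu erefl vv h.
  by case: uu => ->; rewrite ?opprK ?scale1r ?scaleN1r; [right|left].
have := @Spin0_pair (ip u u) u (- v) Su (cspanN Sv) uu erefl.
rewrite ipNl ipNr opprK ipNr mulrN oppr_ge0 => /(_ vv (ltW h)).
rewrite vecN mulrN scalerN.
by case: uu => ->; rewrite ?opprK ?scale1r ?scaleN1r ?opprK; [left|right].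
Qed.

Lemma ip_reflN u v : unitv u -> ip (- refl u v) (- refl u v) = ip v v.
Proof. by move=> uu; rewrite ipNl ipNr opprK ip_refl. Qed.

(** A factor can be moved past another one at the price of replacing the latter by minus its
    reflection, a vector of the same norm. This brings factors of equal norm together. *)
Lemma swap_left u v : unitv u -> cvec u * cvec v = cvec (- refl u v) * cvec u.
Proof. by move=> uu; rewrite vecN mulNr refl_conj // opprK. Qed.

Lemma swap_right u v : unitv u -> cvec v * cvec u = cvec u * cvec (- refl u v).
Proof. by move=> uu; rewrite vecN mulrN -refl_conj // refl_refl. Qed.

(** Induction on the length, splitting off two letters of equal norm. If the first two letters
    differ in norm, there is a third one, since otherwise [nu s] would be -1; it has the norm of one
    of them and is brought next to it by a swap. *)
Lemma vprod_Spin0pm s : unit_seq S s -> ~~ odd (size s) -> nu s = 1 -> Spin0pm (vprod s).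
Proof.
have [n] := ubnP (size s); elim: n s => // n IH [|u [|v s]] //=.
  by move=> _ _ _ _; rewrite vprod_nil; left; exact: Spin0_1.
rewrite !ltnS negbK => sn /unit_seq_cons[Su uu /unit_seq_cons[Sv uv us]] os.
rewrite !nu_cons mulrA mulrNN => nus.
have [vu|vu] := eqVneq (ip v v) (ip u u).
  rewrite !vprod_cons mulrA; apply: Spin0pmM; first exact: Spin0pm_pair.
  apply: IH => //; first exact: leq_trans sn.
  by move: nus; rewrite vu unitv_sqr // mul1r.
have uvN : ip u u * ip v v = -1.
  by move: vu; case: uu => ->; case: uv => -> //; rewrite ?eqxx // ?mul1r ?mulN1r ?mulr1.
case: s sn us os nus => [|w s] sn us os nus.
  by move: nus; rewrite uvN nu_nil mulN1r; lra.
have [Sw uw us'] := (unit_seq_cons S w s).1 us.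
rewrite nu_cons mulrA in nus.
have sn' : ((size s).+1 < n)%N by move: sn => /= /ltnW.
have [wv|wv] := eqVneq (ip w w) (ip v v).
  have -> : vprod [:: u, v, w & s] =
      cvec (- refl u v) * cvec (- refl u w) * vprod (u :: s).
    by rewrite !vprod_cons mulrA swap_left // -!mulrA [cvec u * (cvec w * _)]mulrA
      (swap_left w uu) !mulrA.
  apply: Spin0pmM.
    apply: Spin0pm_pair; rewrite ?ip_reflN //.
    - by apply/cspanN/refl_cspan.
    - by apply/cspanN/refl_cspan.
    - by rewrite /unitv ip_reflN.
  apply: IH => //; first by apply/unit_seq_cons; split.
  rewrite nu_cons; move: nus; rewrite wv -[_ * _ * _ * _]mulrA.
  rewrite (_ : ip u u * ip v v * (- ip v v * nu s) = - ip u u * (ip v v * ip v v) * nu s).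
    by rewrite unitv_sqr // mulr1.
  by ring.
have wu : ip w w = ip u u.
  by move: wv vu; case: uu => ->; case: uv => ->; case: uw => -> //; rewrite eqxx.
have -> : vprod [:: u, v, w & s] = cvec u * cvec w * vprod (- refl w v :: s).
  by rewrite !vprod_cons [cvec v * _]mulrA swap_right // !mulrA.
apply: Spin0pmM; first exact: Spin0pm_pair.
apply: IH => //.
  apply/unit_seq_cons; split=> //; first by apply/cspanN/refl_cspan.
  by rewrite /unitv ip_reflN.
rewrite nu_cons ip_reflN //; move: nus; rewrite wu -[_ * _ * _ * _]mulrA.
rewrite (_ : ip u u * ip v v * (- ip u u * nu s) = - ip v v * (ip u u * ip u u) * nu s).
  by rewrite unitv_sqr // mulr1.
by ring.
Qed.

(** For orthogonal positive unit vectors, e_i e_j lies in the identity component and squares to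
    -1. *)
Lemma Spin0_N1 i j : J i -> J j -> (i < p)%N -> (j < p)%N -> i != j -> S0 (- 1 : clif).
Proof.
move=> Ji Jj ip_ jp ij.
have hi : ip (ev R i) (ev R i) = 1 by rewrite ip_ev_ev eqxx mulr1 /ip_sign ip_.
have hj : ip (ev R j) (ev R j) = 1 by rewrite ip_ev_ev eqxx mulr1 /ip_sign jp.
have hij : ip (ev R i) (ev R j) = 0 by rewrite ip_ev_ev (negbTE ij) mulr0.
have h : S0 (cvec (ev R i) * cvec (ev R j)).
  have := @Spin0_pair 1 (ev R i) (- ev R j) (cspan_ev R Ji) (cspanN (cspan_ev R Jj)).
  rewrite ipNl ipNr opprK ipNr hij oppr0 mulr0 => /(_ (or_introl erefl) hi hj (lexx _)).
  by rewrite vecN mulrN scalerN scaleN1r opprK.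
have := Spin0M h h; rewrite mulrA -(mulrA (cvec _) (cvec _) (cvec (ev R i))).
have -> : cvec (ev R j) * cvec (ev R i) = - (cvec (ev R i) * cvec (ev R j)).
  by apply/eqP; rewrite -addr_eq0 addrC vec_anti hij mulr0 scale0r.
rewrite mulrN mulNr mulrA vec_sqr hi -!mulrA vec_sqr hj.
by rewrite -scalerAr -scalerAl mulr1 !scaleN1r opprK.
Qed.

(** The norm takes only the values 1 and -1; if -1 occurred on this connected set, so would 0. *)
Lemma Spin0_nrm (x : clif) : S0 x -> nrm x = 1.
Proof.
move=> x0; have hS (y : clif) : S0 y -> nrm y = 1 \/ nrm y = -1.
  by move=> /Spin0_sub[/PinInP[s us ->] _]; rewrite nrm_vprod; exact: nu_pm.
have [//|nx] := hS _ x0.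
have : is_interval (@nrm R p q @` S0).
  apply/connected_intervalP; apply: image_connected; first exact: nrm_continuous.
  exact: component_connected.
move=> /(_ (-1) 1) H.
have [|||z z0 e] := H _ _ 0.
- by exists x.
- by exists (1 : clif); [exact: Spin0_1|rewrite -vprod_nil nrm_vprod nu_nil].
- by rewrite lerN10 ler01.
by have := hS _ z0; rewrite e => -[]; lra.
Qed.

(** [par] acts on the word by (-1)^size, and a product of unit vectors is nonzero. *)
Lemma vprod_even_size (S' : set (Vec R p q)) s :
  unit_seq S' s -> cl_even (vprod s) -> ~~ odd (size s).
Proof.
move=> us ex; apply/negP => os; move/cl_evenP: ex.
rewrite par_vprod -signr_odd os expr1 scaleN1r => e.
have e0 : vprod s = 0.
  have : 2 *: vprod s = 0 by rewrite scaler_nat mulr2n -{1}e addNr.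
  by move/eqP; rewrite scaler_eq0 pnatr_eq0 => /eqP.
have := rv_vprodl s; rewrite e0 mulr0 => /esym/eqP; rewrite scaler_eq0 oner_eq0 orbF.
by move/eqP => n0; have := nu_sqr us; rewrite n0 mulr0; lra.
Qed.

Lemma SpinInP (x : Cl) : SpinIn S x <->
  exists s, [/\ unit_seq S s, ~~ odd (size s) & x = vprod s].
Proof.
split=> [[/PinInP[s us xE] ex]|[s [us es ->]]]; last first.
  by split; [apply/PinInP; exists s|exact: even_vprod].
by exists s; split=> //; apply: (vprod_even_size us); rewrite -xE.
Qed.

End SpinGroups.

(** * Clifford generators and the volume element *)

Section CliffordGenerators.
Variables (R : realType) (p q p2 q2 : nat).
Variables (c : 'I_(p2 + q2) -> clif R p q).
Hypothesis c_anti : forall i j, i != j -> c i * c j = - (c j * c i).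
Hypothesis c_sqr : forall i, c i * c i = (- ip_sign R i)%:A.

Definition gen_bl (B : blade p2 q2) : clif R p q := \prod_(k <- enum 'I_(p2 + q2) | k \in B) c k.

(** The factor c_i travels through the sorted word to its own place, anticommuting with every
    smaller member of B, and is squared if i is already in B. *)
Lemma gen_bl_seq (i : 'I_(p2 + q2)) (B : blade p2 q2) (s : seq 'I_(p2 + q2)) :
  sorted (fun a b : 'I_(p2 + q2) => (a < b)%N) s -> i \in s ->
  c i * \prod_(k <- s | k \in B) c k =
  (\prod_(k <- s) (-1) ^+ ((k \in B) && (k < i)%N) * (- ip_sign R i) ^+ (i \in B)) *:
    \prod_(k <- s | k \in symdiff (finset.set1 i) B) c k.
Proof.
elim: s => //= j s IH ps; rewrite inE.
have tr : transitive (fun a b : 'I_(p2 + q2) => (a < b)%N) by move=> ? ? ?; apply: ltn_trans.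
have ss := path_sorted ps.
have js : all (fun b : 'I_(p2 + q2) => (j < b)%N) s.
  by rewrite (path_sortedE tr) in ps; case/andP: ps.
rewrite !big_cons in_symdiff inE; have [ij|ij] /= := eqVneq i j.
  subst j; rewrite ?eqxx ltnn andbF expr0 mul1r => _.
  have -> : \prod_(k <- s) (-1) ^+ ((k \in B) && (k < i)%N) = 1 :> R.
    rewrite big_seq big1 // => k /(allP js) ik.
    by rewrite ltnNge (ltnW ik) andbF.
  have -> : \prod_(k <- s | k \in symdiff (finset.set1 i) B) c k = \prod_(k <- s | k \in B) c k.
    rewrite !(big_seq_cond (fun k => k \in _)); apply: eq_bigl => k.
    have [ks|//] := boolP (k \in s); rewrite in_symdiff inE.
    by have := allP js _ ks; rewrite ltn_neqAle eq_sym val_eqE => /andP[/negbTE-> _].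
  rewrite mul1r; case: (i \in B) => /=; last by rewrite expr0 scale1r.
  by rewrite mulrA c_sqr -scalerAl mul1r expr1.
move=> iS; have ji := allP js _ iS.
case: (j \in B) => /=; last by rewrite expr0 mul1r IH.
rewrite mulrA c_anti // mulNr -[c j * c i * _]mulrA IH // ji expr1 mulN1r mulNr scaleNr.
by rewrite -scalerAr.
Qed.

Lemma gen_bl1 i B : c i * gen_bl B =
  blade_sign R (finset.set1 i) B *: gen_bl (symdiff (finset.set1 i) B).
Proof.
rewrite /gen_bl gen_bl_seq ?mem_enum //; last first.
  by rewrite -[sorted _ _](@sorted_map _ _ val ltn) val_enum_ord iota_ltn_sorted.
congr (_ *: _); rewrite blade_signE /inv_sign /sq_sign.
rewrite [in RHS](bigD1 i) //= [X in _ * X * _]big1 ?mulr1 => [|a ai]; last first.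
  by rewrite big1 // => b _; rewrite inE (negbTE ai).
congr (_ * _); first by rewrite big_enum; apply: eq_bigr => b _; rewrite inE eqxx.
rewrite [in RHS](bigD1 i) //= big1 ?mulr1 => [|a ai]; last by rewrite inE (negbTE ai).
by rewrite inE eqxx.
Qed.

(** The map provided by the universal property of the Clifford algebra for elements c_i that satisfy
    its relations. *)
Definition gen_map (x : clif R p2 q2) : clif R p q := \sum_B x B *: gen_bl B.

Lemma gen_mapD x y : gen_map (x + y) = gen_map x + gen_map y.
Proof. by rewrite /gen_map -big_split; apply: eq_bigr => B _ /=; rewrite add_coef scalerDl. Qed.

Lemma gen_mapZ a x : gen_map (a *: x) = a *: gen_map x.
Proof. by rewrite /gen_map scaler_sumr; apply: eq_bigr => B _ /=; rewrite scale_coef scalerA. Qed.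

Lemma gen_map_sum (I : Type) (r : seq I) (P : pred I) F :
  gen_map (\sum_(i <- r | P i) F i) = \sum_(i <- r | P i) gen_map (F i).
Proof.
apply: (big_morph _ gen_mapD).
by rewrite /gen_map big1 // => B _; rewrite zero_coef scale0r.
Qed.

Lemma gen_map_bl B : gen_map (bl R B) = gen_bl B.
Proof.
rewrite /gen_map (bigD1 B) //= bl_coef eqxx scale1r big1 ?addr0 // => A AB.
by rewrite bl_coef (negbTE AB) scale0r.
Qed.

Lemma gen_map1 : gen_map 1 = 1.
Proof. by rewrite -bl0 gen_map_bl /gen_bl big_pred0 // => i; rewrite inE. Qed.

(** Multiplicativity for a vector on the left; induction on words extends it to factors in Pin. *)
Lemma gen_map_vec (v : Vec R p2 q2) x :
  gen_map (cvec v * x) = (\sum_i v ord0 i *: c i) * gen_map x.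
Proof.
rewrite vecE mulr_suml gen_map_sum mulr_suml; apply: eq_bigr => i _.
rewrite -!scalerAl gen_mapZ; congr (_ *: _).
rewrite {1}[x]blE mulr_sumr gen_map_sum {2}/gen_map mulr_sumr; apply: eq_bigr => B _.
by rewrite -!scalerAr gen_mapZ blM gen_mapZ gen_map_bl gen_bl1.
Qed.

End CliffordGenerators.

(** * The volume element omega of E *)

Section Omega.
Variables (R : realType) (p q p' : nat).
Hypotheses (p'3 : (p' %% 4 = 3)%N) (lep : (p' <= p)%N).
Implicit Types (u v w : Vec R p q) (s : seq (Vec R p q)).
Local Notation clif := (clif R p q).

Definition JE : pred 'I_(p + q) := fun i => (i < p')%N.

Lemma EEE : EE R p q p' = cspan JE.
Proof.
by apply/seteqP; split=> v /= h i hi; apply: h; move: hi; rewrite /JE -leqNgt.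
Qed.

Lemma EE'E : EE' R p q p' = cspan (predC JE).
Proof.
by apply/seteqP; split=> v /= h i hi; apply: h; move: hi; rewrite /JE /= ?negbK.
Qed.

Lemma basis_natE (i : 'I_(p + q)) (k : nat) : k = i -> basis_nat R p q k = ev R i.
Proof. by move=> ->; apply/rowP => j; rewrite !mxE eqxx /= val_eqE. Qed.

Lemma lepq : (p' <= p + q)%N. Proof. by rewrite (leq_trans lep) // leq_addr. Qed.

Definition om_idx : seq 'I_(p + q) := [seq widen_ord lepq i | i <- enum 'I_p'].
Definition om_seq : seq (Vec R p q) := [seq ev R i | i <- om_idx].
Definition om : clif := vprod om_seq.

Lemma size_om : size om_seq = p'.
Proof. by rewrite size_map size_map size_enum_ord. Qed.

Lemma mem_om_idx i : (i \in om_idx) = (i < p')%N.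
Proof.
apply/mapP/idP => [[k _ ->]|ik]; first exact: (ltn_ord k).
exists (Ordinal ik); first by rewrite mem_enum.
exact/val_inj.
Qed.

Lemma uniq_om_idx : uniq om_idx.
Proof.
rewrite map_inj_uniq ?enum_uniq // => i j /(congr1 val) /= e; exact/val_inj.
Qed.

Lemma eprod_om : eprod R p q 0 p' = om.
Proof.
rewrite /eprod subn0 /om -cl_prodE; congr cl_prod.
rewrite /om_seq /om_idx -val_enum_ord -!map_comp; apply: eq_map => i.
exact: (congr1 (@vec R p q) (@basis_natE (widen_ord lepq i) _ erefl)).
Qed.

Lemma om_unit : unit_seq (cspan JE) om_seq.
Proof.
move=> _ /mapP[i il ->]; split; last exact: ev_unit.
by apply: cspan_ev; rewrite /JE -mem_om_idx.
Qed.

Lemma odd_p' : odd p'.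
Proof. by rewrite (divn_eq p' 4) p'3 oddD oddM andbF. Qed.

Lemma p'_gt2 : (2 < p')%N.
Proof. by rewrite (divn_eq p' 4) p'3; lia. Qed.

Lemma vrot_ev (l : seq 'I_(p + q)) (i : 'I_(p + q)) : uniq l ->
  vrot [seq ev R j | j <- l] (ev R i) = (-1) ^+ (i \in l) *: ev R i.
Proof.
elim: l => [|j l IH] /=; first by rewrite scale1r.
case/andP => jl /IH ->; rewrite inE.
have -> : refl (ev R j) ((-1) ^+ (i \in l) *: ev R i) =
          (-1) ^+ (i \in l) *: refl (ev R j) (ev R i).
  by apply/rowP => k; rewrite /refl ipZr !mxE; ring.
have [->|ij] /= := eqVneq i j.
  rewrite (negbTE jl) scale1r expr1 scaleN1r /refl -mulrA unitv_sqr; last exact: ev_unit.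
  by rewrite mulr1 scaler_nat mulr2n opprD addrA subrr sub0r.
by rewrite refl_orth // ip_ev_ev eq_sym (negbTE ij) mulr0.
Qed.

(** The reflections in e_1, ..., e_p' together act as -1 on E, which cancels the sign (-1)^p' = -1
    of [rot_conj]. *)
Lemma om_comm v : cspan JE v -> om * cvec v = cvec v * om.
Proof.
move=> hv; rewrite [v in cvec v]vec_evE.
have cv_sum F : cvec (\sum_i F i) = \sum_(i < p + q) cvec (F i) :> clif.
  by apply: (big_morph (@cvec R p q)); [exact: vecD|exact: vec0].
rewrite cv_sum mulr_sumr mulr_suml; apply: eq_bigr => i _.
rewrite vecZ -scalerAr -scalerAl.
have [iJ|/hv->] := boolP (JE i); last by rewrite !scale0r.
congr (_ *: _); have := rot_conj (ev R i) om_unit.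
rewrite vrot_ev ?uniq_om_idx // mem_om_idx -/(JE i) iJ expr1 scaleN1r vecN mulNr.
by rewrite size_om -signr_odd odd_p' expr1 scaleN1r => /oppr_inj.
Qed.

(** The reflections fix E' pointwise, so only the sign (-1)^p' = -1 remains. *)
Lemma om_anti v : cspan (predC JE) v -> om * cvec v = - (cvec v * om).
Proof.
move=> hv; have := rot_conj v om_unit; rewrite (rot_fix om_unit) //.
by rewrite size_om -signr_odd odd_p' expr1 scaleN1r => ->; rewrite opprK.
Qed.

Lemma vprod_rev_orth s : pairwise (fun u v => ip u v == 0) s ->
  vprod (rev s) = (-1) ^+ 'C(size s, 2) *: vprod s.
Proof.
elim: s => [|u s IH] /=; first by rewrite scale1r.
case/andP => us /IH e; rewrite rev_cons -cats1 vprod_cat e vprod_cons vprod_nil mulr1.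
rewrite -scalerAl binS bin1 exprD -scalerA vprod_cons; congr (_ *: _).
elim: s us {IH e} => [|v s IH] /=; first by rewrite vprod_nil mulr1 mul1r scale1r.
case/andP => /eqP uv /IH e; rewrite vprod_cons -mulrA e -scalerAr !mulrA.
have -> : cvec u * cvec v = - (cvec v * cvec u).
  by apply/eqP; rewrite -addr_eq0 vec_anti uv mulr0 scale0r.
by rewrite mulNr exprS mulN1r scaleNr scalerN opprK.
Qed.

Lemma om_pos v : v \in om_seq -> ip v v = 1.
Proof.
case/mapP => i; rewrite mem_om_idx => ip' ->.
by rewrite ip_ev_ev eqxx mulr1 /ip_sign (leq_trans ip' lep).
Qed.

Lemma nu_pos s : (forall v, v \in s -> ip v v = 1) -> nu s = (-1) ^+ size s.
Proof.
elim: s => [|v s IH] h; first by rewrite nu_nil.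
rewrite nu_cons h ?mem_head // IH ?exprS // => w ws; apply: h.
by rewrite inE ws orbT.
Qed.

(** omega omega~ = (-1)^p' and omega~ = (-1)^C(p',2) omega; the exponents add up to C(p'+1,2), which
    is even because 4 divides p'+1. *)
Lemma om_sqr : om * om = 1.
Proof.
have pw : pairwise (fun u v => ip u v == 0) om_seq.
  rewrite pairwise_map; have := uniq_om_idx; rewrite uniq_pairwise.
  apply: sub_pairwise => i j /= ij; by rewrite ip_ev_ev (negbTE ij) mulr0.
have := vprod_rv om_seq; rewrite rv_vprod (vprod_rev_orth pw) nu_pos; last exact: om_pos.
rewrite size_om -scalerAr => /(congr1 (fun t => (-1) ^+ 'C(p', 2) *: t)).
rewrite !scalerA -!exprD -signr_odd oddD addbb scale1r => ->.
rewrite -signr_odd (_ : odd _ = false) ?scale1r //.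
have -> : ('C(p', 2) + p' = 'C(p'.+1, 2))%N by rewrite binS bin1.
have [k ->] : exists k, p'.+1 = (k * 4)%N.
  by exists (p' %/ 4).+1; rewrite {1}(divn_eq p' 4) p'3; lia.
rewrite bin2 (_ : k * 4 * (k * 4).-1 = ((k * (k * 4).-1).*2).*2)%N; last by lia.
by rewrite doubleK odd_double.
Qed.

Lemma i0P : (0 < p + q)%N. Proof. by rewrite (leq_trans _ lepq) //; have := p'_gt2; lia. Qed.
Lemma i1P : (1 < p + q)%N. Proof. by rewrite (leq_trans _ lepq) //; have := p'_gt2; lia. Qed.
Definition i0 : 'I_(p + q) := Ordinal i0P.
Definition i1 : 'I_(p + q) := Ordinal i1P.
(** [e0] and [e1] are the vectors e_1 and e_2 of the statement, as indices start at 0 here. *)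
Definition e0 : Vec R p q := ev R i0.
Definition e1 : Vec R p q := ev R i1.

Lemma i0J : JE i0. Proof. by have := p'_gt2; rewrite /JE /=; lia. Qed.
Lemma i1J : JE i1. Proof. by have := p'_gt2; rewrite /JE /=; lia. Qed.
Lemma JE_pos i : JE i -> (i < p)%N. Proof. by move=> ip; apply: leq_trans ip lep. Qed.
Lemma e0E : cspan JE e0. Proof. exact/cspan_ev/i0J. Qed.
Lemma e1E : cspan JE e1. Proof. exact/cspan_ev/i1J. Qed.
Lemma ip_e0 : ip e0 e0 = 1.
Proof. by rewrite ip_ev_ev eqxx mulr1 /ip_sign (JE_pos i0J). Qed.
Lemma ip_e01 : ip e0 e1 = 0. Proof. by rewrite ip_ev_ev mulr0. Qed.

Definition om1 : clif := eprod R p q 1 p'.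

Lemma om1P : exists s, [/\ unit_seq setT s, size s = p'.-1 & om1 = vprod s].
Proof.
exists [seq basis_nat R p q i | i <- iota 1 (p' - 1)]; split.
- move=> _ /mapP[k + ->]; rewrite mem_iota => /andP[k0 k1]; split=> //.
  have kp : (k < p + q)%N by apply: leq_trans lepq; move: k1; lia.
  by rewrite (@basis_natE (Ordinal kp)) //; exact: ev_unit.
- by rewrite size_map size_iota subn1.
- by rewrite -cl_prodE -map_comp.
Qed.

Lemma om_e0 : om = cvec e0 * om1.
Proof.
rewrite -eprod_om /om1 /eprod subn0.
have e : p' = (p' - 1).+1 by have := p'_gt2; lia.
by rewrite {1}e /e0 -(@basis_natE i0 0%N erefl).
Qed.

(** Expresses the factor e_2...e_p' of b through omega, whose commutation rules are known. *)
Lemma om1_e0 : om1 = - (cvec e0 * om).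
Proof. by rewrite om_e0 mulrA vec_sqr ip_e0 scaleN1r mulN1r opprK. Qed.

Lemma even_om1 : cl_even om1.
Proof.
have [s [_ ss ->]] := om1P; apply: even_vprod; rewrite ss.
by have := odd_p'; case: (p').
Qed.

End Omega.

(** * The groups K and Khat *)

Section Khat.
Variables (R : realType) (p q p' : nat).
Hypotheses (p'3 : (p' %% 4 = 3)%N) (lep : (p' <= p)%N).
Implicit Types (u v w : Vec R p q) (s : seq (Vec R p q)).
Local Notation clif := (clif R p q).
Local Notation Cl := (Cl R p q).
Local Notation JE := (@JE p q p').
Local Notation E := (@cspan R p q JE).
Local Notation E' := (@cspan R p q (predC JE)).
Local Notation om := (@om R p q p' lep).
Local Notation e0 := (e0 R q p'3 lep).

Lemma cspanT : (@setT (Vec R p q)) = cspan predT.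
Proof. by apply/seteqP; split=> v. Qed.

Lemma E_pos v : E v -> 0 <= ip v v.
Proof.
move=> hv; apply: sumr_ge0 => i _; rewrite -mulrA.
have [iJ|/hv->] := boolP (JE i); last by rewrite mulr0 mulr0.
by rewrite /ip_sign (JE_pos lep iJ) mul1r -expr2 sqr_ge0.
Qed.

Lemma E_unit v : E v -> unitv v -> ip v v = 1.
Proof. by move=> /E_pos h [//|e]; move: h; rewrite e; lra. Qed.

Lemma E_def v : E v -> ip v v = 0 -> v = 0.
Proof.
move=> hv /eqP; rewrite psumr_eq0 => [/allP h|i _]; last first.
  rewrite -mulrA; have [iJ|/hv->] := boolP (JE i); last by rewrite !mulr0.
  by rewrite /ip_sign (JE_pos lep iJ) mul1r -expr2 sqr_ge0.
apply/rowP => i; rewrite mxE; have [iJ|/hv//] := boolP (JE i).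
have /implyP := h i (mem_index_enum _) => /(_ isT).
by rewrite /ip_sign (JE_pos lep iJ) mul1r mulf_eq0 orbb => /eqP.
Qed.

Lemma nu_E s : unit_seq E s -> nu s = (-1) ^+ size s.
Proof. by move=> us; apply: nu_pos => v /us[hv uv]; exact: E_unit. Qed.

Lemma PinE_N (x : clif) : PinIn E x -> PinIn E (- x).
Proof.
move=> px; have -> : - x = cvec e0 * cvec e0 * x by rewrite vec_sqr ip_e0 scaleN1r mulN1r.
apply: PinInM => //; apply/PinInP; exists [:: e0; e0].
  have [h1 h2] : E e0 /\ unitv e0 by split; [exact: e0E|exact: ev_unit].
  by apply/unit_seq_cons; split=> //; apply/unit_seq_cons; split.
by rewrite !vprod_cons vprod_nil mulr1.
Qed.

Lemma SpinE_N (x : clif) : SpinIn E x -> SpinIn E (- x).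
Proof. by move=> [px ex]; split; [exact: PinE_N|rewrite -scaleN1r; exact: evenZ]. Qed.

Lemma om_Pin : PinIn E om.
Proof. by apply/PinInP; exists (om_seq R q lep) => //; exact: om_unit. Qed.

Lemma vec_swap u v : E u -> E' v -> cvec v * cvec u = - (cvec u * cvec v).
Proof.
by move=> hu hv; apply/eqP; rewrite -addr_eq0 vec_anti ipC (cspan_ip hu hv) mulr0 scale0r.
Qed.

Lemma vprod_swap s h : unit_seq E s -> unit_seq E' h ->
  vprod h * vprod s = (-1) ^+ (size s * size h) *: (vprod s * vprod h).
Proof.
move=> us uh; elim: s us => [_|u s IH /unit_seq_cons[Eu _ us]].
  by rewrite vprod_nil mulr1 mul1r scale1r.
rewrite vprod_cons mulrA.
have -> : vprod h * cvec u = (-1) ^+ size h *: (cvec u * vprod h).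
  elim: h uh {IH} => [_|v h IH /unit_seq_cons[E'v _ uh]].
    by rewrite vprod_nil mulr1 mul1r scale1r.
  rewrite vprod_cons -mulrA IH // -scalerAr [cvec v * (_ * _)]mulrA vec_swap // mulNr -mulrA.
  by rewrite exprS mulN1r scaleNr scalerN.
by rewrite -scalerAl -!mulrA IH // -scalerAr scalerA mulSn exprD.
Qed.

Lemma swap_even s h : unit_seq E s -> unit_seq E' h -> ~~ odd (size s * size h) ->
  vprod h * vprod s = vprod s * vprod h.
Proof.
by move=> us uh o; rewrite vprod_swap // -signr_odd (negbTE o) scale1r.
Qed.

Lemma om_vprod h : unit_seq E' h -> om * vprod h = (-1) ^+ size h *: (vprod h * om).
Proof.
move=> uh; rewrite (vprod_swap (@om_unit R p q p' lep) uh) size_om scalerA -exprD.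
by rewrite -signr_odd oddD oddM (odd_p' p'3) /= addbb scale1r.
Qed.

(* As [nu h = 1] means that h has an even number of positive vectors and
   [b (g s) (g t) = nu h * b s t], this is the stabiliser of b among the elements of
   Spin preserving E and E'. *)
Definition KK : set Cl := [set x | exists s h,
  [/\ unit_seq E s, unit_seq E' h, ~~ odd (size s + size h), nu h = 1 &
      x = vprod s * vprod h]].

Lemma KK_N (x : clif) : KK x -> KK (- x).
Proof.
move=> [s [h [us uh o n ->]]]; exists (e0 :: e0 :: s), h; split=> //=.
- have h0 : E e0 /\ unitv e0 by split; [exact: e0E|exact: ev_unit].
  by case: h0 => ? ?; apply/unit_seq_cons; split=> //; apply/unit_seq_cons; split.
- by rewrite negbK.
- by rewrite !vprod_cons !mulrA vec_sqr ip_e0 scaleN1r !mulN1r !mulNr.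
Qed.

Lemma KK_pm (a : R) (x : clif) : a * a = 1 -> KK x -> KK (a *: x).
Proof.
move=> /eqP; rewrite -expr2 sqrf_eq1 => /orP[] /eqP ->; rewrite ?scale1r //.
by rewrite scaleN1r; exact: KK_N.
Qed.

Lemma sign_sqr n : (-1) ^+ n * (-1) ^+ n = 1 :> R.
Proof. by rewrite -expr2 sqrr_sign. Qed.

Lemma KK_group : subgroup_closed KK.
Proof.
split.
- by exists [::], [::]; rewrite vprod_nil nu_nil mulr1.
- move=> _ _ [s [h [us uh o n ->]]] [s2 [h2 [us2 uh2 o2 n2 ->]]].
  rewrite clifME !mulrA -(mulrA (vprod s)) (vprod_swap us2 uh) -!scalerAr -!scalerAl.
  apply: KK_pm; first exact: sign_sqr.
  exists (s ++ s2), (h ++ h2); split; try exact/unit_seq_cat.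
  - by move: o o2; rewrite !size_cat !oddD; do 4!case: (odd _).
  - by rewrite nu_cat n n2 mulr1.
  - by rewrite !vprod_cat !mulrA.
- move=> _ [s [h [us uh o n ->]]].
  have ucat : unit_seq setT (s ++ h).
    by apply/unit_seq_cat; split; apply: unit_seqT; eassumption.
  rewrite -vprod_cat (vprod_inv ucat) rv_vprod rev_cat vprod_cat.
  rewrite (vprod_swap (unit_seq_rev us) (unit_seq_rev uh)).
  apply: KK_pm; first exact: (nu_sqr ucat).
  apply: KK_pm; first exact: sign_sqr.
  by exists (rev s), (rev h); split; rewrite ?size_rev ?nu_rev //; exact: unit_seq_rev.
Qed.

Lemma KK_SpinE (x : clif) : SpinIn E x -> KK x.
Proof.
move=> /SpinInP[s [us es ->]]; exists s, [::]; split; rewrite ?addn0 ?nu_nil //.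
by rewrite vprod_nil mulr1.
Qed.

Lemma KK_Spin0 (x : clif) : Spin0In E' x -> KK x.
Proof.
move=> x0; have /SpinInP[h [uh eh xE]] := Spin0_sub x0; exists [::], h; split=> //.
  by have := Spin0_nrm x0; rewrite xE nrm_vprod.
by rewrite vprod_nil mul1r.
Qed.

Lemma gen_group_min (S G : set Cl) : subgroup_closed G -> S `<=` G -> gen_group S `<=` G.
Proof. by move=> sG SG x; apply. Qed.

Lemma gen_group_sub (S : set Cl) : S `<=` gen_group S.
Proof. by move=> x Sx G _; apply. Qed.

Lemma gen_group_closed (S : set Cl) : subgroup_closed (gen_group S).
Proof.
split=> [G [] //|x y hx hy G sG SG|x hx G sG SG]; case: (sG) => h1 hM hV.
  by apply: hM; [apply: hx|apply: hy].
by apply: hV; apply: hx.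
Qed.

(** The explicit form of K(p',p''): Spin(E) commutes with Spin_0(E'), so these products already form
    a group. *)
Definition K0 : set Cl := [set x | exists a c : clif, [/\ SpinIn E a, Spin0In E' c & x = a * c]].

Lemma SpinE_comm (a c : clif) : SpinIn E a -> PinIn E' c -> c * a = a * c.
Proof.
move=> /SpinInP[s [us es ->]] /PinInP[h uh ->]; apply: swap_even => //.
by rewrite oddM (negbTE es).
Qed.

Lemma KgrpE : Kgrp R p q p' = K0.
Proof.
rewrite /Kgrp EEE EE'E; apply/seteqP; split.
  apply: gen_group_min; last first.
    move=> x [hx|hx]; [exists x, 1|exists 1, x]; rewrite ?mulr1 ?mul1r; split=> //.
      exact: Spin0_1.
    exact: SpinIn1.
  split.
  - by exists 1, 1; rewrite mulr1; split=> //; [exact: SpinIn1|exact: Spin0_1].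
  - move=> _ _ [a [c [ha hc ->]]] [a2 [c2 [ha2 hc2 ->]]].
    exists (a * a2), (c * c2); split; [exact: SpinInM|exact: Spin0M|].
    have [pc _] := Spin0_sub hc.
    by rewrite clifME !mulrA -(mulrA a) (SpinE_comm ha2 pc) !mulrA.
  - move=> _ [a [c [ha hc ->]]]; have [pa _] := ha; have [pc _] := Spin0_sub hc.
    have [a1 a2] := PinIn_inv pa; have [c1 c2] := PinIn_inv pc.
    exists (cl_inv a), (cl_inv c); split; [exact: SpinInV|exact: Spin0V|].
    rewrite -(SpinE_comm (SpinInV ha) (PinInV pc)).
    apply: cl_inv_uniq.
      by rewrite mulrA -(mulrA a) c1 mulr1 a1.
    by rewrite mulrA -(mulrA (cl_inv c : clif)) a2 mulr1 c2.
move=> _ [a [c [ha hc ->]]]; have [_ hM _] := gen_group_closed (SpinIn E `|` Spin0In E').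
by apply: hM; apply: gen_group_sub; [left|right].
Qed.

(** The undetermined sign of c is moved to a, because -1 belongs to Spin(E). *)
Lemma K0_pm (a c : clif) : SpinIn E a -> Spin0pm (predC JE) c -> K0 (a * c).
Proof.
move=> ha [hc|hc]; first by exists a, c.
by exists (- a), (- c); split=> //; [exact: SpinE_N|rewrite mulrNN].
Qed.

(** E is positive definite of dimension at least 3, so [nu] is 1 on even words and -1 lies in the
    component, which removes the sign left by [vprod_Spin0pm]. *)
Lemma SpinE_connected : SpinIn E `<=` Spin0In E.
Proof.
move=> x /SpinInP[s [us es ->]].
have nN1 : Spin0In E (-1 : clif).
  apply: (Spin0_N1 R (i0J q p'3 lep) (i1J q p'3 lep)) => //.
    exact: (JE_pos lep (i0J q p'3 lep)).
  exact: (JE_pos lep (i1J q p'3 lep)).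
have := vprod_Spin0pm us es; rewrite nu_E // -signr_odd (negbTE es) => /(_ erefl).
by case=> // /(Spin0M nN1); rewrite mulN1r opprK.
Qed.

(** 1 is joined to a inside Spin(E), and then a to a c by translating Spin_0(E'). *)
Lemma K0_connected (G : set Cl) : K0 `<=` G -> K0 `<=` connected_component G (1 : clif).
Proof.
move=> KG _ [a [c [ha hc ->]]].
have a1 : connected_component G (1 : clif) a.
  have h : Spin0In E `<=` connected_component G (1 : clif).
    apply: connected_component_max; [exact: Spin0_1| |exact: component_connected].
    move=> x x0; apply: KG; exists x, 1; split; rewrite ?mulr1 //.
      exact: Spin0_sub.
    exact: Spin0_1.
  by apply: h; exact: SpinE_connected.
apply: (connected_component_trans a1).
have : [set cl_mul a z | z in Spin0In E'] `<=` connected_component G a.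
  apply: connected_component_max.
  - by exists (1 : clif); [exact: Spin0_1|rewrite clifME mulr1].
  - by move=> _ [z z0 <-]; apply: KG; exists a, z.
  - by apply: image_connected; [exact: mull_continuous|exact: component_connected].
by apply; exists c.
Qed.

Lemma KK_Spin (x : clif) : KK x -> Spin R p q x.
Proof.
move=> [s [h [us uh o n ->]]]; rewrite /Spin cspanT; apply/SpinInP.
exists (s ++ h); rewrite size_cat vprod_cat; split=> //.
by rewrite -cspanT; apply/unit_seq_cat; split; apply: unit_seqT; eassumption.
Qed.

(** On E the value [nu s] is (-1)^|s|; as [nu h] is 1, norm 1 makes s even, hence h even too, and
    both factors lie in their Spin groups. *)
Lemma KK_K0 (x : clif) : KK x -> nrm x = 1 -> K0 x.
Proof.
move=> [s [h [us uh o n ->]]]; rewrite -vprod_cat nrm_vprod nu_cat n mulr1 nu_E //.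
rewrite -signr_odd; case: (boolP (odd (size s))) => [_|os _]; first by rewrite expr1; lra.
have oh : ~~ odd (size h) by move: o; rewrite oddD (negbTE os).
rewrite vprod_cat; apply: K0_pm; last exact: vprod_Spin0pm.
by apply/SpinInP; exists s.
Qed.

Lemma K0_KK : K0 `<=` KK.
Proof.
move=> _ [a [c [ha hc ->]]]; have [_ hM _] := KK_group.
by apply: hM; [exact: KK_SpinE|exact: KK_Spin0].
Qed.

Lemma Spin0V_nrm (x : clif) : Spin0 R p q x -> nrm x = 1.
Proof. by rewrite /Spin0 cspanT; exact: Spin0_nrm. Qed.

(** Three inclusions closing up in a circle: [K0], the component of 1 in [KK], the part of [KK] in
    Spin_0, and [K0] again. *)
Lemma K_component : connected_component KK (1 : clif) = K0 /\ K0 = KK `&` Spin0 R p q.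
Proof.
have h1 : K0 `<=` connected_component KK (1 : clif) := K0_connected K0_KK.
have h2 : connected_component KK (1 : clif) `<=` KK `&` Spin0 R p q.
  move=> x xK; split; first exact: connected_component_sub xK.
  move: x xK; apply: connected_component_max.
  - by apply: connected_component_refl; case: KK_group.
  - by move=> x /connected_component_sub/KK_Spin.
  - exact: component_connected.
have h3 : KK `&` Spin0 R p q `<=` K0.
  by move=> x [xK /Spin0V_nrm]; exact: KK_K0.
split; apply/seteqP; split=> //.
- by apply: subset_trans h2 h3.
- by apply: subset_trans h1 h2.
Qed.

Lemma jqP : (0 < q)%N -> (p < p + q)%N.
Proof. by move=> q0; rewrite -[X in (X < _)%N]addn0 ltn_add2l. Qed.

Definition fneg (q0 : (0 < q)%N) : Vec R p q := ev R (Ordinal (jqP q0)).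

Lemma fnegP q0 : [/\ E' (fneg q0), unitv (fneg q0) & ip (fneg q0) (fneg q0) = -1].
Proof.
split; [|exact: ev_unit|by rewrite ip_ev_ev eqxx mulr1 /ip_sign ltnn].
by apply: cspan_ev; rewrite /= /JE -leqNgt.
Qed.

Lemma q0_nu s : unit_seq setT s -> q = 0%N -> nu s = (-1) ^+ size s.
Proof.
move=> us q0; apply: nu_pos => v /us[_ [//|hv]].
have : 0 <= ip v v.
  apply: sumr_ge0 => i _; rewrite -mulrA /ip_sign.
  have ip_ : (i < p)%N by apply: leq_trans (ltn_ord i) _; rewrite q0 addn0.
  by rewrite ip_ mul1r -expr2 sqr_ge0.
by rewrite hv; lra.
Qed.

Definition omf (q0 : (0 < q)%N) : clif := om * cvec (fneg q0).

Lemma omf_KK q0 : KK (omf q0).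
Proof.
have [h1 h2 h3] := fnegP q0.
exists (om_seq R q lep), [:: fneg q0]; split.
- exact: om_unit.
- by apply/unit_seq_cons; split.
- by rewrite size_om addn1 /= (odd_p' p'3).
- by rewrite nu_cons nu_nil h3 mulr1 opprK.
- by rewrite vprod_cons vprod_nil mulr1.
Qed.

Lemma omf_sqr q0 : omf q0 * omf q0 = -1.
Proof.
have [h1 h2 h3] := fnegP q0.
rewrite /omf mulrA -(mulrA om) -[cvec _ * om]opprK -om_anti // mulrN mulNr.
by rewrite mulrA om_sqr // mul1r vec_sqr h3 opprK scale1r.
Qed.

(* Modulo K the only new element is omega f, which has spinor norm -1. *)
Lemma KK_decomp (x : clif) : KK x -> K0 x \/ exists q0, K0 (x * omf q0).
Proof.
move=> xK; have [s [h [us uh o n xE]]] := xK.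
have ucat : unit_seq setT (s ++ h).
  by apply/unit_seq_cat; split; apply: unit_seqT; eassumption.
have nx : nrm x = nu (s ++ h) by rewrite xE -vprod_cat nrm_vprod.
have [n1|n1] := nu_pm (J := predT) (eq_rect _ (fun S => unit_seq S _) ucat _ cspanT).
  by left; apply: KK_K0 => //; rewrite nx.
(* For q = 0 every letter is positive and an even word has [nu] equal to 1, so q > 0 and a negative
   vector exists. *)
right; have [q0|q0] : q = 0%N \/ (0 < q)%N by lia.
  move: n1; rewrite q0_nu // size_cat -signr_odd (negbTE o); lra.
exists q0; apply: KK_K0; first by case: KK_group => _ hM _; apply: hM => //; exact: omf_KK.
have [h1 h2 h3] := fnegP q0.
rewrite /omf xE -vprod_cat mulrA -vprod_cat.
have -> : cvec (fneg q0) = vprod [:: fneg q0] by rewrite vprod_cons vprod_nil mulr1.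
rewrite -vprod_cat nrm_vprod !nu_cat -nu_cat n1 nu_cons nu_nil h3 (nu_E (@om_unit R p q p' lep)).
by rewrite size_om -signr_odd (odd_p' p'3) expr1; lra.
Qed.

End Khat.

(** * The embedding iota and the explicit form of Khat *)

Section Characterisation.
Variables (R : realType) (p q p' : nat).
Hypotheses (p'3 : (p' %% 4 = 3)%N) (lep : (p' <= p)%N).
Implicit Types (u v w : Vec R p q) (s : seq (Vec R p q)).
Local Notation CL := (clif R p q).
Local Notation JE := (@JE p q p').
Local Notation E := (@cspan R p q JE).
Local Notation E' := (@cspan R p q (predC JE)).
Local Notation om := (@om R p q p' lep).
Local Notation om1 := (@om1 R p q p').
Local Notation e0 := (e0 R q p'3 lep).
Local Notation KK := (@KK R p q p').

Lemma ltq (k : 'I_(q + 0)) : (k < q)%N.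
Proof. by apply: leq_trans (ltn_ord k) _; rewrite addn0. Qed.

Lemma kidxP (k : 'I_(q + 0)) : (p + k < p + q)%N.
Proof. by rewrite ltn_add2l ltq. Qed.
(** The index p + k of the image x' of a basis vector; ['I_(q + 0)] appears because the algebra of
    R^q is [Cl R q 0]. *)
Definition kidx (k : 'I_(q + 0)) : 'I_(p + q) := Ordinal (kidxP k).

Lemma kidx_E' k : predC JE (kidx k).
Proof. by rewrite /= /JE -leqNgt /= (leq_trans lep) // leq_addr. Qed.

Lemma kidx_inj : injective kidx.
Proof. by move=> k l /(congr1 val) /= /addnI e; exact/val_inj. Qed.

Definition emb (v : Vec R q 0) : Vec R p q := \sum_k v ord0 k *: ev R (kidx k).
Definition cgen (k : 'I_(q + 0)) : CL := om * cvec (ev R (kidx k)).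

Lemma emb_E' (v : Vec R q 0) : E' (emb v).
Proof.
rewrite /emb; elim/big_ind: _ => [|x y|k _]; [exact: cspan0|exact: cspanD|].
exact/cspanZ/cspan_ev/kidx_E'.
Qed.

Lemma cvec_sum (I : Type) (r : seq I) (P : pred I) (F : I -> Vec R p q) :
  cvec (\sum_(i <- r | P i) F i) = \sum_(i <- r | P i) cvec (F i).
Proof. by apply: (big_morph (@cvec R p q)); [exact: vecD|exact: vec0]. Qed.

Lemma emb_gen (v : Vec R q 0) : \sum_k v ord0 k *: cgen k = om * cvec (emb v).
Proof.
rewrite /emb cvec_sum mulr_sumr; apply: eq_bigr => k _.
by rewrite vecZ -scalerAr.
Qed.

Lemma ip_kidx k l : ip (ev R (kidx k)) (ev R (kidx l)) = - (k == l)%:R.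
Proof.
rewrite ip_ev_ev (inj_eq kidx_inj) /ip_sign ltnNge leq_addr /=.
by rewrite mulN1r.
Qed.

Lemma emb_coef (v : Vec R q 0) k : emb v ord0 (kidx k) = v ord0 k.
Proof.
rewrite summxE (bigD1 k) //= !mxE !eqxx mulr1 big1 ?addr0 // => l lk.
by rewrite !mxE (inj_eq kidx_inj) eq_sym (negbTE lk) andbF mulr0.
Qed.

Lemma ip_emb (v : Vec R q 0) : ip (emb v) (emb v) = - ip v v.
Proof.
have h (w : Vec R p q) : ip (emb v) w = \sum_k v ord0 k * ip (ev R (kidx k)) w.
  rewrite /emb; elim/big_ind2: _ => [|x a y b <- <-|k _]; rewrite ?ip0l ?ipDl ?ipZl //.
rewrite h /ip -sumrN; apply: eq_bigr => k _; rewrite -/(ip _ _) ip_ev emb_coef.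
rewrite /ip_sign /= ltnNge leq_addr /=.
by rewrite ltq; ring.
Qed.

(** For u and v in E', (omega u)(omega v) = - u v. Hence the elements omega u satisfy the Clifford
    relations of the negated form, and the negative directions of V turn into those of positive
    definite R^q. *)
Lemma omv_anti u v : E' u -> E' v -> ip u v = 0 ->
  om * cvec u * (om * cvec v) = - (om * cvec v * (om * cvec u)).
Proof.
move=> hu hv uv.
have sw w : E' w -> cvec w * om = - (om * cvec w).
  by move=> hw; rewrite (om_anti p'3 lep hw) opprK.
rewrite !mulrA -!(mulrA om (cvec _) om) !sw // !mulrN !mulNr !mulrA om_sqr // !mul1r.
congr (- _); apply/eqP; rewrite -addr_eq0 vec_anti uv mulr0 scale0r; exact/eqP.
Qed.

Lemma omv_sqr u : E' u -> om * cvec u * (om * cvec u) = (ip u u)%:A.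
Proof.
move=> hu; rewrite mulrA -(mulrA om (cvec _) om) -[cvec u * om]opprK -(om_anti p'3 lep hu).
by rewrite mulrN mulNr mulrA om_sqr // mul1r vec_sqr scaleNr opprK.
Qed.

Lemma cgen_anti k l : k != l -> cgen k * cgen l = - (cgen l * cgen k).
Proof.
move=> kl; apply: omv_anti; try exact/cspan_ev/kidx_E'.
by rewrite ip_kidx (negbTE kl) oppr0.
Qed.

Lemma cgen_sqr k : cgen k * cgen k = (- ip_sign R k)%:A.
Proof.
rewrite omv_sqr; last exact/cspan_ev/kidx_E'.
by rewrite ip_kidx eqxx /ip_sign ltq.
Qed.

Lemma cl_prod_big (r : seq CL) : cl_prod r = \prod_(x <- r) x.
Proof. by elim: r => [|x r IH]; rewrite ?big_nil // big_cons -IH. Qed.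

(** Identifies iota, given by its values on blades, with the map of the universal property, from
    which its multiplicativity is obtained. *)
Lemma cl_iotaE (x : clif R q 0) : cl_iota R p q p' x = gen_map cgen x.
Proof.
rewrite /cl_iota /gen_map.
transitivity (\sum_(A : blade q 0) x A *: (cl_prod [seq cl_mul (eprod R p q 0 p')
   (vec (basis_nat R p q (p + nat_of_ord k))) | k <- enum A] : CL)) => //.
apply: eq_bigr => A _; congr (_ *: _); rewrite cl_prod_big big_map /gen_bl.
rewrite -[RHS]big_filter; have -> : [seq i <- enum 'I_(q + 0) | i \in A] = enum A.
  by rewrite enumT; exact: eq_filter.
apply: eq_bigr => k _; rewrite (eprod_om R q lep) (@basis_natE R p q (kidx k)) //.
Qed.

Lemma iota_vprod (s : seq (Vec R q 0)) :
  gen_map cgen (vprod s) = \prod_(v <- s) (om * cvec (emb v)).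
Proof.
elim: s => [|v s IH]; first by rewrite vprod_nil big_nil gen_map1.
by rewrite vprod_cons gen_map_vec ?emb_gen ?big_cons ?IH //; [exact: cgen_anti|exact: cgen_sqr].
Qed.

Lemma ip_q_ge0 (v : Vec R q 0) : 0 <= ip v v.
Proof.
by apply: sumr_ge0 => k _; rewrite /ip_sign ltq mul1r -expr2 sqr_ge0.
Qed.

Lemma emb_unit (v : Vec R q 0) : unitv v -> ip (emb v) (emb v) = -1.
Proof. by rewrite ip_emb => -[->//|h]; have := ip_q_ge0 v; rewrite h; lra. Qed.

Lemma omv_KK u : E' u -> ip u u = -1 -> KK (om * cvec u).
Proof.
move=> hu uu; exists (om_seq R q lep), [:: u]; split.
- exact: om_unit.
- by apply/unit_seq_cons; split=> //; right.
- by rewrite size_om addn1 /= (odd_p' p'3).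
- by rewrite nu_cons nu_nil uu mulr1 opprK.
- by rewrite vprod_cons vprod_nil mulr1.
Qed.

Lemma iotaPinP (x : CL) : iotaPin R p q p' x <->
  exists2 s : seq (Vec R q 0), unit_seq setT s & x = \prod_(v <- s) (om * cvec (emb v)).
Proof.
split=> [[y [/PinInP[s us ->] ->]]|[s us ->]].
  by exists s => //; rewrite -iota_vprod -cl_iotaE.
exists (vprod s); split; first by apply/PinInP; exists s.
by rewrite -iota_vprod -cl_iotaE.
Qed.

Lemma KK_iota (x : CL) : iotaPin R p q p' x -> KK x.
Proof.
have [h1 hM _] := KK_group R q p'3 lep.
move=> /iotaPinP[s us ->]; elim: s us => [_|v s IH /unit_seq_cons[_ uv us]].
  by rewrite big_nil.
rewrite big_cons; apply: hM; last exact: IH.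
by apply: omv_KK; [exact: emb_E'|exact: emb_unit].
Qed.

Lemma omf_iota (q0 : (0 < q)%N) : iotaPin R p q p' (omf R lep q0).
Proof.
have k0P : (0 < q + 0)%N by rewrite addn0.
pose k0 : 'I_(q + 0) := Ordinal k0P.
apply/iotaPinP; exists [:: ev R k0].
  by apply/unit_seq_cons; split=> //; exact: ev_unit.
rewrite big_cons big_nil mulr1; congr (om * cvec _).
rewrite /emb (bigD1 k0) //= !mxE !eqxx scale1r big1 ?addr0 => [|l lk].
  by congr (ev R _); apply/val_inj; rewrite /= addn0.
by rewrite mxE (negbTE lk) andbF scale0r.
Qed.

(** By [KK_decomp] an element outside K becomes one of K after multiplication by [omf], which is the
    image under iota of the first basis vector of R^q. *)
Lemma KhatE : Khat R p q p' = KK.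
Proof.
rewrite /Khat KgrpE; apply/seteqP; split.
  apply: gen_group_min; first exact: KK_group.
  by move=> x [/(K0_KK p'3 lep)|/KK_iota].
move=> x /(KK_decomp p'3 lep)[xK|[q0 xK]].
  by apply: gen_group_sub; left.
have [_ hM hV] := gen_group_closed (@K0 R p q p' `|` iotaPin R p q p').
have -> : x = cl_mul (cl_mul x (omf R lep q0)) (cl_inv (omf R lep q0)).
  have -> : cl_inv (omf R lep q0) = - omf R lep q0 :> CL.
    by apply: cl_inv_uniq; rewrite ?mulrN ?mulNr (omf_sqr R p'3 lep) opprK.
  by rewrite !clifME -mulrA mulrN (omf_sqr R p'3 lep) opprK mulr1.
apply: hM; first by apply: gen_group_sub; left.
by apply: hV; apply: gen_group_sub; right; exact: omf_iota.
Qed.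

Lemma Ad_vprod s v : unit_seq setT s -> ~~ odd (size s) ->
  Ad (vprod s) (vec v) = cvec (vrot s v).
Proof.
move=> us es; rewrite /Ad (vprod_inv us).
have := rot_conj v us; rewrite -signr_odd (negbTE es) scale1r => e.
rewrite -[cl_mul _ (vec v)]/(vprod s * cvec v) -e clifME -mulrA -scalerAr vprod_rv.
by rewrite scalerA (nu_sqr us) scale1r mulr1.
Qed.

Lemma Ad_preserves_vprod J s : unit_seq setT s -> ~~ odd (size s) ->
  Ad_preserves (vprod s) (cspan J) <-> forall v, cspan J v -> cspan J (vrot s v).
Proof.
move=> us es; split=> H v hv.
  by have [w [hw]] := H v hv; rewrite Ad_vprod // => /vec_inj ->.
by exists (vrot s v); split; [exact: H|rewrite Ad_vprod].
Qed.

End Characterisation.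

(** * Invariance of the canonical form *)

Section Invariance.
Variables (R : realType) (p q p' m : nat).
Hypotheses (p'3 : (p' %% 4 = 3)%N) (lep : (p' <= p)%N).
Variables (rho : Cl R p q -> 'M[R]_m) (Pi : 'cV[R]_m -> 'cV[R]_m -> Vec R p q).
Hypotheses (rhoP : is_Cl0_module rho) (PiP : is_wedge2_map Pi).
Hypothesis PiE : equivariant rho Pi.
Local Notation clif := (clif R p q).
Local Notation JE := (@JE p q p').
Local Notation E := (@cspan R p q JE).
Local Notation E' := (@cspan R p q (predC JE)).
Local Notation om := (@om R p q p' lep).
Local Notation om1 := (@om1 R p q p').
Local Notation e0 := (e0 R q p'3 lep).
Local Notation b := (bform p' rho Pi).

Lemma bformE x y : b x y = ip e0 (Pi (rho om1 *m x) y).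
Proof. by rewrite /bform (@basis_natE R p q (i0 q p'3 lep)). Qed.

(** Write g for the product and f = Ad(g)^-1 e_1, a unit vector of E. From e_2...e_p' = - e_1 omega
    one gets e_2...e_p' g = - (-1)^|h| g f e_1 e_2...e_p'. [Pi_rot] then removes g with the factor
    (-1)^|s| [nu h], and [Pi_contract] removes f with a minus sign; the powers of -1 cancel because
    |s| + |h| is even. *)
Lemma bform_vprod s h x y : unit_seq E s -> unit_seq E' h -> ~~ odd (size s + size h) ->
  b (rho (vprod s * vprod h) *m x) (rho (vprod s * vprod h) *m y) = nu h * b x y.
Proof.
move=> us uh o; pose l := s ++ h; pose g := vprod l.
have ul : unit_seq setT l.
  by apply/unit_seq_cat; split; apply: unit_seqT; eassumption.
have ol : ~~ odd (size l) by rewrite size_cat.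
have eg : cl_even g := even_vprod ol.
rewrite -vprod_cat -/l -/g !bformE.
pose f := vrot (rev l) e0.
have lf : vrot l f = e0 by rewrite -[l in vrot l]revK (rot_rev _ (unit_seq_rev ul)).
have fE : E f.
  rewrite /f rev_cat rot_cat (rot_fixC (J := JE) (unit_seq_rev uh)).
    by apply: rot_cspan; [exact: unit_seq_rev|exact: e0E].
  by apply: rot_cspan; [exact: unit_seq_rev|exact: e0E].
have ff : ip f f = 1 by rewrite (ip_rot _ _ (unit_seq_rev ul)) ip_e0.
have e0g : cvec e0 * g = g * cvec f.
  by have := rot_conj f ul; rewrite lf -signr_odd (negbTE ol) scale1r.
have omg : om * g = (-1) ^+ size h *: (g * om).
  rewrite /g vprod_cat mulrA.
  have -> : om * vprod s = vprod s * om.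
    elim: (s) us => [_|u r IH /unit_seq_cons[Eu _ ur]].
      by rewrite vprod_nil mulr1 mul1r.
    by rewrite vprod_cons mulrA (om_comm p'3 lep) // -!mulrA IH.
  by rewrite -mulrA (om_vprod p'3) // -scalerAr mulrA.
have om1g : om1 * g = (- (-1) ^+ size h) *: (g * (cvec f * cvec e0 * om1)).
  rewrite {1}(om1_e0 R q p'3 lep) mulNr -[cvec e0 * om * g]mulrA omg -scalerAr scaleNr; congr (- _).
  by congr (_ *: _); rewrite !mulrA e0g (om_e0 R q p'3 lep) !mulrA.
have e1 := @even_om1 R p q p' p'3 lep; have e2 := even2 f e0.
have e3 := evenM e2 e1; have e4 := evenM eg e3.
rewrite mulmxA -(rhoM rhoP e1 eg) om1g (rhoZ rhoP _ e4).
rewrite -scalemxAl (PiZl PiP) ipZr (rhoM rhoP eg e3).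
rewrite -mulmxA (Pi_rot rhoP PiP PiE) // ipZr -{1}lf (ip_rot _ _ ul) (rhoM rhoP e2 e1).
rewrite -mulmxA (Pi_contract rhoP PiP PiE) //; last first.
  move=> h0; apply/eqP; rewrite -subr_eq0; apply/eqP/(E_def lep) => //.
  by apply: cspanD; [exact: e0E|exact/cspanN/cspanZ].
rewrite nu_cat (nu_E lep us).
have sg : (-1) ^+ size h * (-1) ^+ size s = 1 :> R.
  by rewrite -exprD addnC -signr_odd (negbTE o).
set B := ip e0 _.
transitivity ((-1) ^+ size h * (-1) ^+ size s * nu h * B); first by ring.
by rewrite sg mul1r.
Qed.

(** If b vanished, so would <e_1, Pi>, since e_2...e_p' is invertible. Equivariance under the wedge
    of e_1 and e_j turns this into <e_j, Pi> = 0 for every j. *)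
Lemma bform_neq0 : (exists s t, Pi s t != 0) -> exists s t, b s t != 0.
Proof.
move=> [s [t st]]; apply: contrapT => H.
have b0 x y : b x y = 0.
  by apply/eqP/negPn/negP => h; apply: H; exists x, y.
have h0 x y : ip e0 (Pi x y) = 0.
  have [l [ul sl e]] := om1P R q p'3 lep.
  (* [nu l *: rv om1] is the inverse of [om1]; inserting it strips [om1] from b. *)
  have := b0 (rho (nu l *: rv om1) *m x) y; rewrite bformE mulmxA.
  have ev1 := @even_om1 R p q p' p'3 lep.
  have ev2 : cl_even (nu l *: rv om1).
    apply: evenZ; rewrite e rv_vprod; apply: even_vprod; rewrite size_rev sl.
    by have := odd_p' p'3; case: (p').
  rewrite -(rhoM rhoP) // -scalerAr {1 2}e vprod_rv scalerA (nu_sqr ul) scale1r.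
  by rewrite (rho1 rhoP) mul1mx.
move/eqP: st; apply; apply/rowP => j; rewrite mxE.
have hj : ip (ev R j) (Pi s t) = 0.
  have [->|j0] := eqVneq j (i0 q p'3 lep); first exact: h0.
  have := Pi_equiv rhoP PiP PiE e0 (ev R j) s t => /(congr1 (ip e0)).
  rewrite /wedge_act !(ipDr, ipNr, ipZr) !h0 ip_e0.
  by lra.
move: hj; rewrite ip_ev => /eqP; rewrite mulf_eq0 => /orP[/eqP h|/eqP //].
by have := ip_sign_sqr R j; rewrite h mul0r => /esym/eqP; rewrite oner_eq0.
Qed.

(** For the converse, [pin_split] gives g up to a sign, which the bilinear form b does not see; b is
    multiplied by [nu h], and a nonzero value of b forces [nu h] to be 1. For Pi = 0 the form
    vanishes and its invariance would say nothing. *)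
Lemma KK_char (g : clif) : (exists s t, Pi s t != 0) ->
  KK p' g <-> [/\ Spin R p q g, Ad_preserves g E, Ad_preserves g E' &
    forall s t, b (rho g *m s) (rho g *m t) = b s t].
Proof.
move=> Pi0; split=> [gK|[gS gE gE' gb]].
  have gS := KK_Spin gK; have [s [h [us uh o n e]]] := gK.
  have ul : unit_seq setT (s ++ h).
    by apply/unit_seq_cat; split; apply: unit_seqT; eassumption.
  split=> //.
  - rewrite e -vprod_cat; apply/Ad_preserves_vprod; rewrite ?size_cat // => v hv.
    by rewrite rot_cat (rot_fixC uh) //; exact: rot_cspan.
  - rewrite e -vprod_cat; apply/Ad_preserves_vprod; rewrite ?size_cat // => v hv.
    by rewrite rot_cat (rot_fix us) //; exact: rot_cspan.
  - by move=> x y; rewrite e bform_vprod // n mul1r.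
move: gS; rewrite /Spin cspanT => /SpinInP[l [ul ol gl]]; rewrite -cspanT in ul.
have h1 := (Ad_preserves_vprod JE ul ol).1; rewrite -gl in h1.
have h2 := (Ad_preserves_vprod (predC JE) ul ol).1; rewrite -gl in h2.
have [s [h [us uh e]]] := pin_split ul (h1 gE) (h2 gE').
have o : ~~ odd (size s + size h).
  have : cl_even (vprod s * vprod h).
    have := even_vprod ol; case: e => -> //; rewrite -scaleN1r => /(evenZ (-1)).
    by rewrite scalerA mulrNN mulr1 scale1r.
  have ucat : unit_seq setT (s ++ h).
    by apply/unit_seq_cat; split; apply: unit_seqT; eassumption.
  by rewrite -vprod_cat -size_cat; exact: vprod_even_size ucat.
have eg : cl_even (vprod s * vprod h) by rewrite -vprod_cat; apply: even_vprod; rewrite size_cat.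
have [x [y bxy]] := bform_neq0 Pi0.
have gb' : b (rho (vprod s * vprod h) *m x) (rho (vprod s * vprod h) *m y) = b x y.
  rewrite -(gb x y) gl; case: e => -> //; rewrite -scaleN1r (rhoZ rhoP _ eg) -!scalemxAl.
  by rewrite !bformE -scalemxAr (PiZl PiP) (PiZr PiP) scalerA mulrNN mulr1 scale1r.
have n1 : nu h = 1.
  by move: gb'; rewrite bform_vprod // -{2}[b x y]mul1r => /(mulIf bxy).
have hK : KK p' (vprod s * vprod h) by exists s, h.
by rewrite gl; case: e => -> //; exact: KK_N.
Qed.


End Invariance.

(** * Compactness *)

Section Compactness.
Variables (R : realType) (p q : nat).
Local Notation clif := (clif R p q).
Local Notation Cl := (Cl R p q).

Lemma coef_continuous (A : blade p q) : continuous (fun x : Cl => x A).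
Proof. by move=> x; exact: (coef_cvg (nbhs_filter x) (A := A) (@id_continuous Cl x)). Qed.

Lemma closed_level (T : topologicalType) (f : T -> R) (a : R) :
  continuous f -> closed [set x | f x = a].
Proof.
move=> cf; apply: (@preimage_closed _ _ f [set y | y = a]); last exact: closed_eq.
by move=> x _; apply: cf.
Qed.

Lemma closed_even (T : topologicalType) (f : T -> Cl) :
  continuous f -> closed [set x | cl_even (f x)].
Proof.
move=> cf.
have -> : [set x | cl_even (f x)] =
    \bigcap_(C in [set C : blade p q | odd #|C|]) [set x | f x C = 0].
  by apply/seteqP; split=> x /= h C oC; apply: h.
apply: closed_bigI => C _; apply: closed_level => x.
exact: (coef_cvg (nbhs_filter x) (A := C) (cf x)).
Qed.

Lemma fst_cont (T U : topologicalType) : continuous (@fst T U).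
Proof. by move=> x; apply: cvg_fst. Qed.
Lemma snd_cont (T U : topologicalType) : continuous (@snd T U).
Proof. by move=> x; apply: cvg_snd. Qed.

Lemma mul2_continuous : continuous (fun z : Cl * Cl => cl_mul z.1 z.2).
Proof. by move=> z; exact: (mul_continuous (@fst_cont Cl Cl) (@snd_cont Cl Cl)). Qed.

Lemma image_compact (T U : topologicalType) (f : T -> U) (A : set T) :
  continuous f -> compact A -> compact (f @` A).
Proof. by move=> cf cA; apply: continuous_compact => //; exact: continuous_subspaceT. Qed.

Lemma compact_fun_bounded (T : topologicalType) (f : T -> R) (A : set T) :
  continuous f -> compact A -> exists M, forall x, A x -> f x <= M.
Proof.
move=> cf cA; have [M [_ MA]] := @compact_bounded R R _ (image_compact cf cA).
exists (M + 1) => x Ax.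
have := MA (M + 1); rewrite ltrDl ltr01 => /(_ isT (f x)) h.
by apply: le_trans (ler_norm _) _; apply: h; exists x.
Qed.

Section Definite.
Variables (J : pred 'I_(p + q)) (e : R).
Hypothesis Je : forall i, J i -> ip_sign R i = e.
Hypothesis ee : e = 1 \/ e = -1.

Lemma ip_definite (v : Vec R p q) : cspan J v -> ip v v = e * \sum_i v ord0 i ^+ 2.
Proof.
move=> hv; rewrite mulr_sumr; apply: eq_bigr => i _.
by have [/Je->|/hv->] := boolP (J i); rewrite ?expr2; ring.
Qed.

Definition unit_vecs : set Cl := [set x | exists v, [/\ cspan J v, unitv v & x = cvec v]].

Lemma unit_definite (v : Vec R p q) : cspan J v -> unitv v -> \sum_i v ord0 i ^+ 2 = 1.
Proof.
move=> hv; rewrite /unitv (ip_definite hv) => h.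
have : 0 <= \sum_i v ord0 i ^+ 2 by apply: sumr_ge0 => i _; exact: sqr_ge0.
by case: ee h => -> []; lra.
Qed.

(** A closed part of a cube that is compact by Tychonoff: the blades other than singletons of J have
    coefficient 0, and the squares of the others sum to 1. *)
Lemma compact_unit_vecs : compact unit_vecs.
Proof.
pose box : set Cl := [set x | forall A, `[-1, 1]%classic (x A)].
have cbox : compact box.
  by apply: (@tychonoff _ (fun _ : blade p q => R) (fun _ => `[-1, 1]%classic)) => A;
    exact: segment_compact.
pose bad : set (blade p q) := [set A | ~ exists2 i, J i & A = finset.set1 i].
pose D1 : set Cl := \bigcap_(A in bad) [set x : Cl | x A = 0].
pose D2 : set Cl := [set x : Cl | \sum_i x (finset.set1 i) ^+ 2 = 1].
have -> : unit_vecs = box `&` D1 `&` D2.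
  apply/seteqP; split=> [_ [v [hv uv ->]]|x [[xb x1] x2]].
    have s1 := unit_definite hv uv.
    have D2v : D2 (cvec v).
      by rewrite /D2 /= -[RHS]s1; apply: eq_bigr => i _; rewrite vec_coef1.
    have D1v : D1 (cvec v).
      move=> A bA /=; rewrite /cvec /vec big1 // => i _.
      have [Ai|] := eqVneq A (finset.set1 i); last by rewrite mul0r.
      have [Ji|/hv->] := boolP (J i); last by rewrite mulr0.
      by case: bA; exists i.
    split=> //; split=> // A /=.
    have [bA|] := pselect (bad A); first by rewrite (D1v A bA) in_itv /= lerN10 ler01.
    move/contrapT => [i Ji ->]; rewrite vec_coef1 in_itv /= -ler_norml.
    rewrite -(@ler_pXn2r _ 2) ?nnegrE // expr1n real_normK ?num_real // -s1.
    by rewrite (bigD1 i) //= lerDl sumr_ge0 // => j _; exact: sqr_ge0.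
  pose v : Vec R p q := \row_i x (finset.set1 i).
  have xv : x = cvec v.
    apply/funext => A; have [bA|] := pselect (bad A).
      rewrite x1 // /cvec /vec big1 // => i _.
      have [Ai|] := eqVneq A (finset.set1 i); last by rewrite mul0r.
      by rewrite mxE -Ai x1 // mulr0.
    by move/contrapT => [i Ji ->]; rewrite vec_coef1 mxE.
  have hv : cspan J v.
    move=> i iJ; rewrite mxE x1 // => -[j Jj /set1_inj ij].
    by rewrite ij Jj in iJ.
  exists v; split=> //; rewrite /unitv ip_definite //.
  rewrite (eq_bigr (fun i => x (finset.set1 i) ^+ 2)); last by move=> i _; rewrite mxE.
  by rewrite x2 mulr1.
apply: compact_closedI.
  apply: compact_closedI => //; apply: closed_bigI => A _.
  by apply: closed_level; exact: coef_continuous.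
have c2 : continuous (fun x : Cl => \sum_i x (finset.set1 i) * x (finset.set1 i)).
  move=> x; apply: (@rsum_cvg R _ _ (nbhs x) _ _ _
    (fun i (y : Cl) => y (finset.set1 i) * y (finset.set1 i))
    (fun i => x (finset.set1 i) * x (finset.set1 i))) => i _.
  have h := @coef_continuous (finset.set1 i) x.
  exact: (cvgM h h).
exact: (@closed_level _ _ 1 c2).
Qed.

Fixpoint upow n : set Cl := if n is n.+1 then
  [set cl_mul z.1 z.2 | z in (unit_vecs `|` [set (1 : clif)]) `*` upow n] else [set (1 : clif)].

Lemma compact_upow n : compact (upow n).
Proof.
elim: n => [|n IH] /=; first exact: compact_set1.
apply: image_compact; first exact: mul2_continuous.
by apply: compact_setX => //; apply: compactU; [exact: compact_unit_vecs|exact: compact_set1].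
Qed.

Lemma upow_vprod n s : unit_seq (cspan J) s -> (size s <= n)%N -> upow n (vprod s).
Proof.
elim: n s => [|n IH] [|v s] //=.
- by rewrite vprod_nil.
- move=> _ _; exists ((1 : clif), vprod [::]); last by rewrite /= clifME mul1r.
  by split=> /=; [right|apply: IH].
- move=> /unit_seq_cons[hv uv us]; rewrite ltnS => sn; rewrite vprod_cons.
  exists (cvec v, vprod s) => //; split=> /=; last exact: IH.
  by left; exists v.
Qed.

Lemma upow_Pin n : upow n `<=` PinIn (cspan J).
Proof.
elim: n => [|n IH] /=; first by move=> x ->; exact: PinIn1.
move=> _ [[x y] /= [hx /IH hy] <-]; apply: PinInM => //.
case: hx => [[v [hv uv ->]]|->]; last exact: PinIn1.
apply/PinInP; exists [:: v]; first by apply/unit_seq_cons; split.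
by rewrite vprod_cons vprod_nil mulr1.
Qed.

(** The sign left open by [pin_bounded] is realised by the two parallel unit vectors v and <v, v> v,
    whose product is -1; hence the extra 2 in the bound. *)
Lemma pin_exact (s : seq (Vec R p q)) : unit_seq (cspan J) s ->
  exists h, [/\ unit_seq (cspan J) h, (size h <= 2 * (p + q) + 2)%N & vprod s = vprod h].
Proof.
case: s => [_|v s us]; first by exists [::].
have [h [uh sh [eh|eh]]] := pin_bounded us.
  by exists h; split=> //; rewrite (leq_trans sh) // leq_addr.
have [hv uv _] := (unit_seq_cons (cspan J) v s).1 us.
exists (v :: ip v v *: v :: h); split.
- apply/unit_seq_cons; split=> //; apply/unit_seq_cons; split=> //; first exact: cspanZ.
  by rewrite /unitv ipZl ipZr mulrA unitv_sqr // mul1r.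
- by rewrite /= addn2 !ltnS.
- rewrite eh !vprod_cons vecZ mulrA -scalerAr vec_sqr scalerA mulrN unitv_sqr //.
  by rewrite scaleN1r mulN1r.
Qed.

Lemma compact_Pin : compact (PinIn (@cspan R p q J)).
Proof.
have -> : PinIn (@cspan R p q J) = upow (2 * (p + q) + 2).
  apply/seteqP; split; last exact: upow_Pin.
  move=> _ /PinInP[s us ->]; have [h [uh sh ->]] := pin_exact us.
  exact: upow_vprod.
exact: compact_upow.
Qed.

End Definite.
End Compactness.

(** * Connectedness of the quotient, compactness of Khat *)

Section KhatTopology.
Variables (R : realType) (p q p' : nat).
Hypotheses (p'3 : (p' %% 4 = 3)%N) (lep : (p' <= p)%N).
Local Notation clif := (clif R p q).
Local Notation Cl := (Cl R p q).
Local Notation JE := (@JE p q p').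
Local Notation E := (@cspan R p q JE).
Local Notation E' := (@cspan R p q (predC JE)).
Local Notation om := (@om R p q p' lep).
Local Notation KK := (@KK R p q p').
Local Notation omf := (@omf R p q p' lep).

(** The analogue of [KK_decomp] for all of Spin; as -1 lies in Spin_0, no sign remains. *)
Lemma Spin_decomp (g : clif) : Spin R p q g ->
  Spin0 R p q g \/ exists q0, Spin0 R p q (g * omf q0).
Proof.
rewrite /Spin /Spin0 cspanT => /SpinInP[s [us es ->]].
have nN1 : Spin0In (cspan predT) (-1 : clif).
  apply: (@Spin0_N1 R p q predT (i0 q p'3 lep) (i1 q p'3 lep)) => //.
    exact: (JE_pos lep (i0J q p'3 lep)).
  exact: (JE_pos lep (i1J q p'3 lep)).
have key (l : seq (Vec R p q)) : unit_seq (cspan predT) l -> ~~ odd (size l) -> nu l = 1 ->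
    Spin0In (cspan predT) (vprod l).
  move=> ul ol nl; case: (vprod_Spin0pm ul ol nl) => // /(Spin0M nN1).
  by rewrite mulN1r opprK.
have [n1|n1] := nu_pm us; first by left; exact: key.
right; have [q0|q0] : q = 0%N \/ (0 < q)%N by lia.
  by move: n1; rewrite -cspanT in us; rewrite (q0_nu us q0) -signr_odd (negbTE es); lra.
exists q0; have [h1 h2 h3] := fnegP R lep q0.
have -> : vprod s * omf q0 = vprod (s ++ om_seq R q lep ++ [:: fneg R p q0]).
  by rewrite !vprod_cat vprod_cons vprod_nil mulr1.
apply: key.
- rewrite -cspanT in us *; apply/unit_seq_cat; split=> //; apply/unit_seq_cat; split.
    exact: unit_seqT (@om_unit R p q p' lep).
  by apply/unit_seq_cons; split.
- by rewrite !size_cat size_om !oddD (odd_p' p'3) addbC.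
- rewrite !nu_cat n1 nu_cons nu_nil h3 (nu_E lep (@om_unit R p q p' lep)) size_om.
  by rewrite -signr_odd (odd_p' p'3) expr1; lra.
Qed.

(** A meets the connected group Spin_0 in a nonempty relatively clopen set, so contains it; right
    translation by elements of [KK] then reaches the coset represented by [omf]. *)
Lemma homog_half (A B : set Cl) : rel_open (Spin R p q) A -> rel_open (Spin R p q) B ->
  A `|` B = Spin R p q -> A `&` B = set0 ->
  (forall g h, A g -> KK h -> A (cl_mul g h)) -> A (1 : clif) -> B = set0.
Proof.
move=> [U [oU AE]] [V [oV BE]] AB AB0 sA A1.
have SA : Spin0 R p q `<=` A.
  have cS : connected (Spin0 R p q) by exact: component_connected.
  have sub x : Spin0 R p q x -> Spin R p q x by exact: connected_component_sub.
  have e : Spin0 R p q `&` U = Spin0 R p q.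
    apply: cS.
    - exists (1 : clif); split; first by rewrite /Spin0 cspanT; exact: Spin0_1.
      by move: A1; rewrite AE => -[].
    - by exists U.
    - exists (~` V); first exact: open_closedC.
      apply/seteqP; split=> x [xS xU]; split=> //.
        move=> xV; have : (A `&` B) x by rewrite AE BE; split; split=> //; exact: sub.
        by rewrite AB0.
      have : (A `|` B) x by rewrite AB; exact: sub.
      by rewrite AE BE => -[[]|[]].
  by move=> x xS; rewrite AE; split; [move: xS; rewrite -{1}e => -[]|exact: sub].
apply/seteqP; split=> // g' gB'; pose g : clif := g'; have gB : B g := gB'.
have gS : Spin R p q g by rewrite -AB; right.
have gA : A g.
  have [/SA//|[q0 /SA h]] := Spin_decomp gS.
  have -> : g = g * omf q0 * - omf q0.
    by rewrite mulrN -mulrA (omf_sqr R p'3 lep) mulrN1 opprK.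
  by apply: sA => //; apply: (KK_N p'3 lep); exact: omf_KK.
by have : (A `&` B) g by []; rewrite AB0.
Qed.

Lemma homog : homog_connected (Spin R p q) KK.
Proof.
move=> A B oA oB AB AB0 sA sB.
have : (A `|` B) (1 : clif) by rewrite AB /Spin cspanT; exact: SpinIn1.
case=> h1; [right; exact: homog_half sA h1|left].
by apply: (homog_half oB oA _ _ sB h1); rewrite ?[B `|` A]setUC ?[B `&` A]setIC.
Qed.

(** Phrased with the factors and not with words, so that compactness of the two Pin groups passes to
    [KK]: the remaining conditions are closed. *)
Lemma KK_closedE : KK = [set cl_mul z.1 z.2 | z in (PinIn E `*` PinIn E') `&`
  [set z | cl_even (cl_mul z.1 z.2)] `&` [set z | nrm z.2 = 1]].
Proof.
apply/seteqP; split=> [_ [s [h [us uh o n ->]]]|_ [[a c] /= [[[pa pc] ev] n] <-]].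
  exists (vprod s, vprod h) => //=; split; last by rewrite nrm_vprod.
  split; first by split; apply/PinInP; [exists s|exists h].
  by rewrite /= clifME -vprod_cat; apply: even_vprod; rewrite size_cat.
move: pa pc n ev => /PinInP[s us ->] /PinInP[h uh ->]; rewrite nrm_vprod => n ev.
exists s, h; split=> //; rewrite -size_cat.
have ucat : unit_seq setT (s ++ h).
  by apply/unit_seq_cat; split; apply: unit_seqT; eassumption.
by apply: (vprod_even_size ucat); rewrite vprod_cat.
Qed.

Lemma compact_PinE : compact (PinIn E).
Proof.
apply: (@compact_Pin R p q JE 1); last by left.
by move=> i /(JE_pos lep); rewrite /ip_sign => ->.
Qed.

(** e = 1 serves the case q = 0 and e = -1 the case p'' = 0; E' is definite in both. *)
Lemma KK_compact (e : R) : e = 1 \/ e = -1 ->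
  (forall i, predC JE i -> ip_sign R i = e) -> compact KK.
Proof.
move=> ee He; rewrite KK_closedE; apply: image_compact; first exact: mul2_continuous.
apply: compact_closedI.
  apply: compact_closedI; last by apply: closed_even; exact: mul2_continuous.
  by apply: compact_setX; [exact: compact_PinE|exact: (compact_Pin He ee)].
have cn : continuous (fun z : Cl * Cl => nrm z.2).
  move=> z; apply: (@continuous_comp _ _ _ (@snd Cl Cl) (@nrm R p q)).
    exact: snd_cont.
  exact: nrm_continuous.
exact: (@closed_level _ _ _ 1 cn).
Qed.

Lemma KK_noncompact : (p' < p)%N -> (0 < q)%N -> ~ compact KK.
Proof.
move=> ltp q0 cK.
have iP : (p' < p + q)%N by apply: leq_trans ltp _; exact: leq_addr.
pose i : 'I_(p + q) := Ordinal iP; pose j : 'I_(p + q) := Ordinal (jqP p q0).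
have ij : i != j by rewrite -val_eqE /= neq_ltn ltp.
have hi : ip (ev R i) (ev R i) = 1 by rewrite ip_ev_ev eqxx mulr1 /ip_sign /= ltp.
have hj : ip (ev R j) (ev R j) = -1 by rewrite ip_ev_ev eqxx mulr1 /ip_sign /= ltnn.
have hij : ip (ev R i) (ev R j) = 0 by rewrite ip_ev_ev (negbTE ij) mulr0.
have iE : E' (ev R i) by apply: cspan_ev; rewrite /= /JE ltnn.
have jE : E' (ev R j) by apply: cspan_ev; rewrite /= /JE -leqNgt /= ltnW.
(* The unit hyperboloid in a plane of E' of signature (1,1); the boost e_i [y t] has coefficient t,
   up to a fixed sign, on the blade {i, j}. *)
pose y t := Num.sqrt (1 + t ^+ 2) *: ev R i + t *: ev R j.
have yy t : ip (y t) (y t) = 1.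
  rewrite /y !(ipDl, ipDr, ipZl, ipZr) hi hj (ipC (ev R j)) hij.
  have s2 : Num.sqrt (1 + t ^+ 2) * Num.sqrt (1 + t ^+ 2) = 1 + t ^+ 2.
    by rewrite -expr2 sqr_sqrtr // addr_ge0 ?sqr_ge0.
  by rewrite !(mulr0, mulr1, addr0, add0r) s2 expr2; ring.
have yK t : KK (cvec (ev R i) * cvec (y t)).
  exists [::], [:: ev R i; y t]; split=> //.
  - apply/unit_seq_cons; split=> //; first by left.
    apply/unit_seq_cons; split=> //; last by left.
    by apply: cspan_lin => //; apply: cspanZ.
  - by rewrite !nu_cons nu_nil hi yy mulr1 mulrNN mulr1.
  - by rewrite vprod_nil mul1r !vprod_cons vprod_nil mulr1.
pose A := symdiff (finset.set1 i) (finset.set1 j).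
have A0 : A != finset.set0.
  by apply/eqP => /setP/(_ i); rewrite in_symdiff !inE eqxx (negbTE ij).
have cA t : (cvec (ev R i) * cvec (y t)) A = t * blade_sign R (finset.set1 i) (finset.set1 j).
  have -> : cvec (ev R i) * cvec (y t) = Num.sqrt (1 + t ^+ 2) *: (-1)%:A +
      t *: (blade_sign R (finset.set1 i) (finset.set1 j) *: bl R A).
    by rewrite /y vecD !vecZ mulrDr -!scalerAr vec_sqr hi !cvec_ev blM.
  rewrite add_coef !scale_coef one_coef (negbTE A0) bl_coef eqxx.
  by rewrite -[true%:R]/(1 : R) -[false%:R]/(0 : R); ring.
have [M MK] := compact_fun_bounded (@coef_continuous R p q A) cK.
have sg := blade_sign_sqr R (finset.set1 i) (finset.set1 j).
(* With this parameter the coefficient equals M + 1. *)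
have := MK _ (yK ((M + 1) * blade_sign R (finset.set1 i) (finset.set1 j))).
by rewrite cA -mulrA sg mulr1; lra.
Qed.

End KhatTopology.

(** * The case p'' = 0 *)

Section IotaKernel.
Variables (R : realType) (p q p' : nat).
Hypotheses (p'3 : (p' %% 4 = 3)%N) (lep : (p' <= p)%N).
Local Notation CL := (clif R p q).
Local Notation JE := (@JE p q p').
Local Notation E := (@cspan R p q JE).
Local Notation E' := (@cspan R p q (predC JE)).
Local Notation om := (@om R p q p' lep).
Local Notation KK := (@KK R p q p').
Local Notation emb := (@emb R p q).
Local Notation cgen := (@cgen R p q p' lep).
Local Notation iot := (gen_map cgen).

Lemma om_PinE (a : CL) : PinIn E a -> om * a = a * om.
Proof.
move=> /PinInP[s us ->]; elim: s us => [_|u r IH /unit_seq_cons[Eu _ ur]].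
  by rewrite vprod_nil mulr1 mul1r.
by rewrite vprod_cons mulrA (om_comm p'3 lep) // -!mulrA IH.
Qed.

Lemma iotaM (x y : clif R q 0) : Pin R q 0 x -> iot (x * y) = iot x * iot y.
Proof.
move=> /PinInP[s us ->]; elim: s us => [_|v s IH /unit_seq_cons[_ _ us]].
  by rewrite vprod_nil mul1r gen_map1 mul1r.
have A := @cgen_anti R p q p' p'3 lep; have B := @cgen_sqr R p q p' p'3 lep.
by rewrite vprod_cons -mulrA !(gen_map_vec A B) IH // mulrA.
Qed.

Lemma iota_comm (a c : CL) : SpinIn E a -> iotaPin R p q p' c -> c * a = a * c.
Proof.
move=> ha /(iotaPinP p'3 lep)[s us ->]; elim: s us => [_|v s IH /unit_seq_cons[_ uv us]].
  by rewrite big_nil mul1r mulr1.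
rewrite big_cons -mulrA IH // !mulrA; congr (_ * _).
have pv : PinIn E' (cvec (emb v)).
  apply/PinInP; exists [:: emb v]; last by rewrite vprod_cons vprod_nil mulr1.
  apply/unit_seq_cons; split=> //; first exact: emb_E'.
  by right; exact: emb_unit.
by rewrite -mulrA (SpinE_comm ha pv) mulrA om_PinE //; case: ha.
Qed.

Lemma iota_continuous : continuous (cl_iota R p q p').
Proof.
move=> x; apply: (cl_cvg (nbhs_filter x)) => C.
have e (y : Cl R q 0) : cl_iota R p q p' y C = \sum_B y B * gen_bl cgen B C.
  by rewrite (cl_iotaE lep) /gen_map sum_coef.
have H : \sum_B (y : Cl R q 0) B * gen_bl cgen B C @[y --> x] --> \sum_B x B * gen_bl cgen B C.
  apply: (@rsum_cvg R _ _ (nbhs x) _ _ _ (fun B (y : Cl R q 0) => y B * gen_bl cgen B C)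
    (fun B => x B * gen_bl cgen B C)) => B _.
  have h := @coef_continuous R q 0 B x.
  exact: (cvgM h (cvg_cst _)).
by move: H; rewrite -e -(funext e).
Qed.

(** A blade up to sign, since a real number with square 1 is a sign. *)
Definition isbl (x : CL) (A : blade p q) := exists2 a : R, a * a = 1 & x = a *: bl R A.

Lemma isblM x y A B : isbl x A -> isbl y B -> isbl (x * y) (symdiff A B).
Proof.
move=> [a a1 ->] [b b1 ->]; exists (a * b * blade_sign R A B).
  by rewrite mulrACA blade_sign_sqr mulr1 mulrACA a1 b1 mulr1.
by rewrite -scalerAl -scalerAr blM !scalerA.
Qed.

Lemma isbl1 : isbl 1 finset.set0.
Proof. by exists 1; rewrite ?mulr1 // bl0 scale1r. Qed.

Lemma isbl_ev i : isbl (cvec (ev R i)) (finset.set1 i).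
Proof. by exists 1; rewrite ?mulr1 // scale1r cvec_ev. Qed.

Lemma isbl_om : exists2 T, isbl om T & forall i, i \in T -> JE i.
Proof.
rewrite -[om]/(vprod (om_seq R q lep)) /om_seq.
have : forall i, i \in om_idx q lep -> JE i by move=> i; rewrite mem_om_idx.
elim: (om_idx q lep) => [_|j l IH H] /=.
  by exists finset.set0; [rewrite vprod_nil; exact: isbl1|move=> i; rewrite inE].
have [|T hT TJ] := IH; first by move=> i il; apply: H; rewrite inE il orbT.
exists (symdiff (finset.set1 j) T).
  by rewrite vprod_cons; apply: isblM => //; exact: isbl_ev.
move=> i; rewrite in_symdiff inE; case: eqP => [->|_] /=; last exact: TJ.
by move=> _; apply: H; rewrite mem_head.
Qed.

(** The factors omega contribute only indices of E, so outside E the blade T is a faithful copy of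
    A. *)
Lemma isbl_gen (A : blade q 0) :
  exists2 T, isbl (gen_bl cgen A) T & forall k, (kidx p k \in T) = (k \in A).
Proof.
have [T0 hT0 T0J] := isbl_om.
suff H (s : seq 'I_(q + 0)) : uniq s -> exists2 T,
    isbl (\prod_(k <- s | k \in A) cgen k) T & forall k, (kidx p k \in T) = (k \in s) && (k \in A).
  have [T hT TA] := H _ (enum_uniq 'I_(q + 0)); exists T => // k.
  by rewrite TA mem_enum.
elim: s => [_|j s IH /= /andP[js us]].
  by exists finset.set0; [rewrite big_nil; exact: isbl1|move=> k; rewrite inE].
have [T hT TA] := IH us; rewrite big_cons; case: ifP => jA; last first.
  exists T => // k; rewrite TA inE; case: eqP => [->|//].
  by rewrite jA (negbTE js).
exists (symdiff (symdiff T0 (finset.set1 (kidx p j))) T).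
  by apply: isblM => //; apply: isblM => //; exact: isbl_ev.
move=> k; rewrite !in_symdiff TA inE (_ : kidx p k \in T0 = false); last first.
  by apply/negP => /T0J; apply/negP; exact: (kidx_E' lep).
rewrite !inE (inj_eq (@kidx_inj p q)) /=.
by case: eqP => [->|//]; rewrite (negbTE js) jA.
Qed.

Lemma PinE_support (a : CL) (A : blade p q) i : PinIn E a -> i \in A -> ~~ JE i -> a A = 0.
Proof.
move=> /PinInP[s us ->]; elim: s A us => [|v s IH] A.
  rewrite vprod_nil one_coef => _ iA _; case: eqP => // e; by rewrite e inE in iA.
move=> /unit_seq_cons[hv _ us] iA iJ; rewrite vprod_cons mul_coef big1 // => B _.
have [iB|iB] := boolP (i \in B).
  rewrite /cvec /vec big1 ?mulr0 ?mul0r // => k _.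
  have [Bk|] := eqVneq B (finset.set1 k); last by rewrite mul0r.
  by move: iB; rewrite Bk inE => /eqP <-; rewrite hv // mulr0.
by rewrite IH ?mulr0 // in_symdiff (negbTE iB).
Qed.

(** Distinct blades have distinct images, so nothing cancels; the image of a nonempty blade contains
    an index outside E, where elements of Pin(E) have coefficient 0. *)
Lemma iota_scalar (x : clif R q 0) : PinIn E (iot x) -> x = (x finset.set0)%:A.
Proof.
move=> pE; apply/funext => A; rewrite scale_coef one_coef.
have [->|] := eqVneq; first by rewrite mulr1.
case/set0Pn => k kA; rewrite mulr0.
have [T [a a1 hT] TA] := isbl_gen A.
have kT : kidx p k \in T by rewrite TA.
have := PinE_support pE kT (kidx_E' lep k).
rewrite /gen_map sum_coef (bigD1 A) //= scale_coef hT scale_coef bl_coef eqxx.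
rewrite big1 ?addr0 => [|B BA].
  move=> /(congr1 ( *%R^~ a)); rewrite mul0r mulr1 -mulrA a1 mulr1; exact.
have [T2 [a2 _ ->] T2B] := isbl_gen B.
rewrite !scale_coef bl_coef (_ : (T == T2) = false) ?mulr0 //.
apply: contraNF BA => /eqP e; apply/eqP/setP => l.
by rewrite -T2B -TA e.
Qed.

(** The image of x is the inverse of a, hence in Pin(E), so x is a scalar c. Then c^2 is a spinor
    norm, 1 or -1, and being a square it is 1. *)
Lemma iota_kernel (a : CL) (x : clif R q 0) : SpinIn E a -> Pin R q 0 x ->
  a * iot x = 1 -> (a = 1 /\ x = 1) \/ (a = -1 /\ x = -1).
Proof.
move=> [pa _] px e.
have [a1 a2] := PinIn_inv pa.
have ix : iot x = cl_inv a by rewrite -[LHS]mul1r -a2 -mulrA e mulr1.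
have xE : x = (x finset.set0)%:A by apply: iota_scalar; rewrite ix; exact: PinInV.
have [s us xs] := (PinInP setT x).1 px.
have n1 : nu s = 1 \/ nu s = -1.
  by have := us; rewrite cspanT => /nu_pm.
have c2 : x finset.set0 * x finset.set0 = nu s.
  have := nrm_vprod s; rewrite -xs /nrm xE rvZ rv1 -scalerAl mul1r scalerA.
  by rewrite !scale_coef one_coef eqxx !mulr1.
have : x finset.set0 ^+ 2 = 1.
  rewrite expr2; case: n1 => h; rewrite c2 h //.
  by have := sqr_ge0 (x finset.set0); rewrite expr2 c2 h; lra.
move/eqP; rewrite sqrf_eq1 => /orP[] /eqP h; move: xE; rewrite h ?scale1r ?scaleN1r => xE.
  by left; split=> //; rewrite -e xE gen_map1 mulr1.
right; split=> //; apply: oppr_inj; rewrite opprK -e xE -scaleN1r gen_mapZ gen_map1.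
by rewrite scaleN1r mulrN1.
Qed.

End IotaKernel.

(** * Negative definite E': product decomposition and generation of the even algebra *)

Section Definite.
Variables (R : realType) (p q p' : nat).
Hypotheses (p'3 : (p' %% 4 = 3)%N) (pE : p' = p).
Local Notation CL := (clif R p q).
Local Notation JE := (@JE p q p').
Local Notation E := (@cspan R p q JE).
Local Notation E' := (@cspan R p q (predC JE)).
Local Notation KK := (@KK R p q p').

Lemma lep_eq : (p' <= p)%N. Proof. by rewrite pE. Qed.
Local Notation lep := lep_eq.
Local Notation om := (@om R p q p' lep).
Local Notation emb := (@emb R p q).

Lemma E'_sign (i : 'I_(p + q)) : predC JE i -> ip_sign R i = -1.
Proof. by rewrite /= /JE /ip_sign pE => /negbTE ->. Qed.

Lemma E'_nonpos (v : Vec R p q) : E' v -> ip v v <= 0.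
Proof.
move=> hv; rewrite (ip_definite E'_sign hv) mulN1r oppr_le0.
by apply: sumr_ge0 => i _; exact: sqr_ge0.
Qed.

Lemma E'_unit (v : Vec R p q) : E' v -> unitv v -> ip v v = -1.
Proof. by move=> /E'_nonpos h [e|//]; move: h; rewrite e; lra. Qed.

Lemma nu_E' h : unit_seq E' h -> nu h = 1.
Proof.
elim: h => [_|v h IH /unit_seq_cons[hv uv uh]]; first by rewrite nu_nil.
by rewrite nu_cons E'_unit // opprK mul1r IH.
Qed.

Lemma emb_surj (v : Vec R p q) : E' v -> exists w, emb w = v.
Proof.
move=> hv; exists (\row_k v ord0 (kidx p k)); apply/rowP => i.
have [iJ|iJ] := boolP (JE i).
  by rewrite (emb_E' lep) ?hv //= iJ.
have ip : (i - p < q + 0)%N.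
  by rewrite addn0 ltn_subLR ?ltn_ord //; move: iJ; rewrite /JE -leqNgt pE.
have -> : i = kidx p (Ordinal ip).
  by apply/val_inj; rewrite /= subnKC //; move: iJ; rewrite /JE -leqNgt pE.
by rewrite emb_coef mxE.
Qed.

(** Each letter is written v = omega (omega v): the second factor belongs to iota(Pin(q)), while
    omega and the signs from reordering are collected in Pin(E). *)
Lemma vprod_iota h : unit_seq E' h ->
  exists a c : CL, [/\ PinIn E a, iotaPin R p q p' c & vprod h = a * c].
Proof.
elim: h => [_|v h IH /unit_seq_cons[hv uv /IH[a [c [pa ic hE]]]]].
  exists 1, 1; rewrite vprod_nil mulr1; split=> //; first exact: PinIn1.
  by apply/(iotaPinP p'3 lep); exists [::]; rewrite ?big_nil.
have [w wv] := emb_surj hv.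
have uw : unitv w by move: uv; rewrite /unitv -wv ip_emb => -[] h0; [right|left]; lra.
have [s us aE] := (PinInP E a).1 pa.
have uv1 : unit_seq E' [:: v] by apply/unit_seq_cons; split.
have sw := vprod_swap us uv1; rewrite vprod_cons vprod_nil mulr1 -aE in sw.
exists ((-1) ^+ (size s * size [:: v]) *: (om * a)), (om * cvec v * c); split.
- have pm : PinIn E (om * a) by apply: PinInM => //; exact: om_Pin.
  rewrite -signr_odd; case: (odd _); rewrite ?expr1 ?expr0 ?scale1r ?scaleN1r //.
  exact: (PinE_N p'3 lep).
- move: ic => /(iotaPinP p'3 lep)[l ul ->]; apply/(iotaPinP p'3 lep); exists (w :: l).
    by apply/unit_seq_cons; split.
  by rewrite big_cons wv.
- rewrite vprod_cons hE mulrA sw -!scalerAl; congr (_ *: _).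
  by rewrite (om_PinE p'3 lep pa) !mulrA -(mulrA a om om) om_sqr // mulr1.
Qed.

Lemma KK_prod : KK = [set x | exists a c, SpinIn E a /\ iotaPin R p q p' c /\ x = cl_mul a c].
Proof.
apply/seteqP; split=> x.
  move=> xK; have [s [h [us uh o n xE]]] := xK; have [a [c [pa ic hE]]] := vprod_iota uh.
  exists (vprod s * a), c; split; last by split=> //; rewrite xE hE clifME mulrA.
  have ps : PinIn E (vprod s * a) by apply: PinInM => //; apply/PinInP; exists s.
  split=> //; apply/cl_evenP.
  have [pc /cl_evenP ec] := KK_Spin (KK_iota p'3 lep ic).
  have [_ /cl_evenP ex] := KK_Spin xK.
  (* x and c are even and c is invertible, so the remaining factor is even. *)
  move: ex; rewrite xE hE mulrA parM ec => /(congr1 (fun t => t * (cl_inv c : CL))).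
  have [c1 _] : c * cl_inv c = 1 /\ (cl_inv c : CL) * c = 1.
    by move: pc; rewrite cspanT; exact: PinIn_inv.
  by rewrite -!(mulrA _ c) c1 !mulr1.
move=> [a [c [ha [hc ->]]]]; have [_ hM _] := KK_group R q p'3 lep.
by apply: hM; [exact: KK_SpinE|exact: (KK_iota p'3 lep)].
Qed.

(** Words in [KK] list E before E', which fixes the order of a mixed pair; [nu h] is 1 because E' is
    negative definite. *)
Lemma pair_KK (i j : 'I_(p + q)) : KK (bl R (finset.set1 i) * bl R (finset.set1 j)) \/
  KK (bl R (finset.set1 j) * bl R (finset.set1 i)).
Proof.
have us k : JE k -> unit_seq E [:: ev R k].
  by move=> kJ; apply/unit_seq_cons; split=> //; [exact: cspan_ev|exact: ev_unit].
have uh k : ~~ JE k -> unit_seq E' [:: ev R k].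
  by move=> kJ; apply/unit_seq_cons; split=> //; [exact: cspan_ev|exact: ev_unit].
have v1 k : bl R (finset.set1 k) = vprod [:: ev R k].
  by rewrite vprod_cons vprod_nil mulr1 cvec_ev.
rewrite !v1; have [iJ|iJ] := boolP (JE i); have [jJ|jJ] := boolP (JE j).
- left; exists ([:: ev R i] ++ [:: ev R j]), [::]; split=> //.
  + by apply/unit_seq_cat; split; exact: us.
  + exact: nu_nil.
  + by rewrite vprod_cat vprod_nil mulr1.
- left; exists [:: ev R i], [:: ev R j]; split=> //; [exact: us|exact: uh|].
  exact/nu_E'/uh.
- right; exists [:: ev R j], [:: ev R i]; split=> //; [exact: us|exact: uh|].
  exact/nu_E'/uh.
- have uij : unit_seq E' ([:: ev R i] ++ [:: ev R j]).
    by apply/unit_seq_cat; split; exact: uh.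
  left; exists [::], ([:: ev R i] ++ [:: ev R j]); split=> //; first exact: nu_E'.
  by rewrite vprod_cat vprod_nil mul1r.
Qed.

(** Two indices are removed at a time: an even blade e_A is, up to sign, e_i e_j e_C, and e_i e_j
    lies in [KK] up to sign. *)
Lemma gen_alg_KK (x : Cl R p q) : cl_even x <-> gen_alg KK x.
Proof.
split=> [ex S S1 KS SD SZ SM|]; last first.
  apply; [exact: even1|by move=> y /KK_Spin[]|move=> y z; exact: evenD| |].
    by move=> a y; exact: evenZ.
  by move=> y z; exact: evenM.
have S0 : S (0 : CL) by rewrite -(scale0r (1 : CL)); apply: SZ.
have S2 (i j : 'I_(p + q)) : i != j -> S (bl R (finset.set1 i) * bl R (finset.set1 j)).
  move=> ij; have [/KS//|/KS h] := pair_KK i j.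
  have := bl1_anti R i j; rewrite (negbTE ij) !mulr0 scale0r => /eqP.
  by rewrite addr_eq0 => /eqP ->; rewrite -scaleN1r; apply: SZ.
have Sbl n (A : blade p q) : (#|A| < n)%N -> ~~ odd #|A| -> S (bl R A).
  elim: n A => // n IH A An oA.
  have [->|] := eqVneq A finset.set0; first by rewrite bl0.
  case/set0Pn => i iA; pose B := symdiff (finset.set1 i) A.
  have BE : B = A :\ i.
    by apply/setP => k; rewrite in_symdiff !inE; case: eqP => [->|//]; rewrite iA.
  have AB : symdiff (finset.set1 i) B = A by rewrite symdiffK.
  clearbody B.
  have cB : #|A| = #|B|.+1 by rewrite BE (cardsD1 i A) iA.
  have : B != finset.set0.
    by apply: contraNneq oA => B0; rewrite cB B0 cards0.
  case/set0Pn => j jB; pose C := symdiff (finset.set1 j) B.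
  have CE : C = B :\ j.
    apply/setP => k; rewrite in_symdiff finset.in_setD1 finset.in_set1.
    by case: eqP => [->|//]; rewrite jB.
  have cC : #|B| = #|C|.+1 by rewrite CE (cardsD1 j B) jB.
  have SC : S (bl R C).
    apply: IH; first by move: An; rewrite cB cC ltnS => /ltnW.
    by move: oA; rewrite cB cC /= negbK.
  have ij : i != j by move: jB; rewrite BE !inE eq_sym => /andP[].
  have e : bl R (finset.set1 i) * bl R (finset.set1 j) * bl R C =
     (blade_sign R (finset.set1 j) C * blade_sign R (finset.set1 i) B) *: bl R A.
    rewrite -mulrA blM -scalerAr.
    have -> : symdiff (finset.set1 j) C = B by rewrite symdiffK.
    by rewrite blM AB scalerA.
  have sq : blade_sign R (finset.set1 j) C * blade_sign R (finset.set1 i) B *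
    (blade_sign R (finset.set1 j) C * blade_sign R (finset.set1 i) B) = 1.
    by rewrite mulrACA !blade_sign_sqr mulr1.
  rewrite -[bl R A]scale1r -sq -scalerA -e; apply: SZ; apply: SM => //; exact: S2.
rewrite (blE x); elim/big_ind: _ => [//|y z|A _]; first exact: SD.
have [oA|oA] := boolP (odd #|A|); first by rewrite ex // scale0r.
by apply: SZ; exact: Sbl oA.
Qed.

End Definite.

(** * Maximality of Khat among compact subgroups *)

Section MaximalCompact.
Variables (R : realType) (p q p' : nat).
Hypotheses (p'3 : (p' %% 4 = 3)%N) (pE : p' = p).
Local Notation CL := (clif R p q).
Local Notation Cl := (Cl R p q).
Local Notation Vec := (Vec R p q).
Local Notation JE := (@JE p q p').
Local Notation E := (@cspan R p q JE).
Local Notation E' := (@cspan R p q (predC JE)).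
Local Notation KK := (@KK R p q p').
Local Notation lep := (lep_eq pE).
Local Notation e0 := (e0 R q p'3 lep).
Local Notation e1 := (e1 R q p'3 lep).

Definition prN (v : Vec) : Vec := \row_i (if JE i then 0 else v ord0 i).
(** For v = cosh t u + sinh t z with u in E, z in E', <u, u> = 1 and <z, z> = -1, this is sinh^2
    t. *)
Definition boost (v : Vec) : R := - ip (prN v) (prN v).

Lemma prN_E' v : E' (prN v).
Proof. by move=> i /=; rewrite negbK mxE => ->. Qed.

Lemma prN_E v : E (v - prN v).
Proof. by move=> i /negbTE iJ; rewrite !mxE iJ subrr. Qed.

Lemma ip_prN v w : E' w -> ip v w = ip (prN v) w.
Proof.
move=> hw; have e : ip (v - prN v) w = 0 := cspan_ip (prN_E v) hw.
by move: e; rewrite ipDl ipNl => /eqP; rewrite subr_eq0 => /eqP.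
Qed.

Lemma boost_ge0 v : 0 <= boost v.
Proof. by rewrite oppr_ge0; apply: (E'_nonpos pE); exact: prN_E'. Qed.

(** Cauchy-Schwarz in the negative definite space E', read off from the norm of <v, z> z +
    [prN v]. *)
Lemma boost_CS v z : E' z -> ip z z = -1 -> ip v z ^+ 2 <= boost v.
Proof.
move=> hz zz.
have := E'_nonpos pE (cspan_lin (ip v z) hz (prN_E' v)).
rewrite !(ipDl, ipDr, ipZl, ipZr) zz -(ip_prN v hz) (ipC z) -(ip_prN v hz) /boost expr2.
lra.
Qed.

Lemma ip_split v : ip v v = ip (v - prN v) (v - prN v) - boost v.
Proof.
have h : ip (v - prN v) (prN v) = 0 := cspan_ip (prN_E v) (prN_E' v).
rewrite /boost opprK -{1 2}[v](subrK (prN v)) !(ipDl (v - prN v)) !(ipDr _ (v - prN v)).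
by rewrite h (ipC (prN v)) h addr0 add0r.
Qed.

Lemma E_coef v : E v -> v ord0 (i0 q p'3 lep) ^+ 2 <= ip v v.
Proof.
move=> hv; have sg i : JE i -> ip_sign R i = 1.
  by move=> /(JE_pos lep); rewrite /ip_sign => ->.
rewrite (ip_definite sg hv) mul1r.
by rewrite (bigD1 (i0 q p'3 lep)) //= lerDl sumr_ge0 // => i _; exact: sqr_ge0.
Qed.

(** Prefixing e_2, which is orthogonal to e_1, changes the parity without moving e_1. The free
    parity is later matched with that of a word in E'. *)
Lemma move_e0 u (b : bool) : E u -> ip u u = 1 ->
  exists a, [/\ unit_seq E a, odd (size a) = b & vrot a u = e0].
Proof.
move=> hu uu; have h1 : unitv e0 by exact: ev_unit.
have [|h [_ rh uh]] := move_vec (w := u) h1; first by rewrite ip_e0 uu.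
have uhE : unit_seq E h.
  move=> v /uh[uv [x [y e]]]; split=> //; rewrite e; apply: cspan_lin; first exact: e0E.
  exact: cspanZ.
have [ob|ob] := eqVneq (odd (size h)) b; first by exists h.
exists (e1 :: h); split.
- by apply/unit_seq_cons; split=> //; [exact: e1E|exact: ev_unit].
- by move: ob => /=; case: (odd _); case: b.
- by rewrite /= rh refl_orth // ipC ip_e01.
Qed.

Lemma move_E' z w : E' z -> E' w -> ip z z = -1 -> ip w w = -1 ->
  exists2 b, unit_seq E' b & vrot b z = w.
Proof.
move=> hz hw zz ww; have uw : unitv w by right.
have [|h [_ rh uh]] := move_vec (w := z) uw; first by rewrite ww zz.
exists h => // v /uh[uv [x [y e]]]; split=> //; rewrite e.
by apply: cspan_lin => //; exact: cspanZ.
Qed.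

Lemma prod_KK a b : unit_seq E a -> unit_seq E' b -> odd (size a) = odd (size b) ->
  KK (vprod (a ++ b)).
Proof.
move=> ua ub o; exists a, b; split=> //; last by rewrite vprod_cat.
  by rewrite oddD o addbb.
exact: (nu_E' pE).
Qed.

(* If T moves e0 by a hyperbolic angle t, then T k T moves it by at least 2t, where
   k is chosen in KK to align the two boosts. *)
Lemma boost_double l : unit_seq setT l -> 0 < boost (vrot l e0) ->
  exists a b, [/\ unit_seq E a, unit_seq E' b, odd (size a) = odd (size b) &
    4 * boost (vrot l e0) <= boost (vrot (l ++ (a ++ b) ++ l) e0)].
Proof.
move=> ul; set w := vrot l e0; set B := boost w => B0.
have iT x y : ip (vrot l x) (vrot l y) = ip x y by rewrite (ip_rot _ _ ul).
have ww : ip w w = 1 by rewrite iT ip_e0.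
pose wE := w - prN w.
have wEE : ip wE wE = 1 + B by have := ip_split w; rewrite ww -/wE -/B; lra.
pose c := Num.sqrt (1 + B); pose s := Num.sqrt B.
have c0 : 0 < c by rewrite sqrtr_gt0; lra.
have s0 : 0 < s by rewrite sqrtr_gt0.
have cc : c * c = 1 + B by rewrite -expr2 sqr_sqrtr //; lra.
have ss : s * s = B by rewrite -expr2 sqr_sqrtr // ltW.
pose u := c^-1 *: wE; pose z := s^-1 *: prN w.
have uE : E u by apply/cspanZ/prN_E.
have zE : E' z by apply/cspanZ/prN_E'.
have uu : ip u u = 1.
  by rewrite /u ipZl ipZr wEE -cc mulrA; field; rewrite gt_eqF.
have zz : ip z z = -1.
  rewrite /z ipZl ipZr -[ip (prN w) _]opprK -/(boost w) -/B -ss.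
  by field; rewrite gt_eqF.
have wuz : w = c *: u + s *: z.
  by rewrite !scalerA !divff ?gt_eqF // !scale1r subrK.
clearbody u z.
have wz : ip w z = - s.
  by rewrite wuz ipDl !ipZl (cspan_ip uE zE) zz mulr0 add0r mulrN1.
pose y := vrot (rev l) z.
have Ty x : ip (vrot l x) z = ip x y.
  by rewrite -[z in LHS](rot_rev (s := rev l) z (unit_seq_rev ul)) revK iT.
have y0 : ip e0 y = - s by rewrite -Ty.
have yy : ip y y = -1 by rewrite (ip_rot _ _ (unit_seq_rev ul)).
(* As <y, y> = -1, [boost y] is 1 plus the squared length of the E-part of y, whose coordinate along
   e_1 is -s with s^2 = B. *)
have By : 1 + B <= boost y.
  have := ip_split y; rewrite yy.
  have := E_coef (prN_E y).
  have -> : (y - prN y) ord0 (i0 q p'3 lep) = - s.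
    by rewrite -y0 ip_ev /ip_sign (JE_pos lep (i0J q p'3 lep)) mul1r !mxE i0J subr0.
  by rewrite expr2 mulrNN ss; lra.
pose d := Num.sqrt (boost y).
have d0 : 0 < d by rewrite sqrtr_gt0; lra.
have dd : d * d = boost y by rewrite -expr2 sqr_sqrtr // boost_ge0.
have cd : c <= d by rewrite ler_wsqrtr.
pose z' := d^-1 *: prN y.
have z'E : E' z' by apply/cspanZ/prN_E'.
have z'z' : ip z' z' = -1.
  rewrite /z' ipZl ipZr -[ip (prN y) _]opprK -/(boost y) -dd.
  by field; rewrite gt_eqF.
have z'y : ip z' y = - d.
  rewrite ipC (ip_prN _ z'E) /z' ipZr -[ip (prN y) _]opprK -/(boost y) -dd.
  by field; rewrite gt_eqF.
clearbody z'.
have [b ub rb] := move_E' zE z'E zz z'z'.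
have [a [ua oa ra]] := move_e0 (odd (size b)) uE uu.
exists a, b; split=> //.
(* The middle word sends u to e_1 and z to z', the direction of the E'-part of y. *)
have -> : vrot (l ++ (a ++ b) ++ l) e0 = vrot l (c *: e0 + s *: z').
  rewrite !rot_cat -/w wuz; congr (vrot l _).
  rewrite rot_lin (rot_fixC ub uE).
  have sc t r x : vrot t (r *: x) = r *: vrot t x :> Vec.
    rewrite -[r *: x]addr0 rot_lin (_ : vrot t 0 = 0) ?addr0 //.
    by apply: rot_orth => v _; rewrite ipC ip0l.
  by rewrite (sc b) rb rot_lin ra (sc a) (rot_fix ua z'E).
(* Pairing with z, the image of y, gives - s c - s d with d >= c. The square is at least 4 s^2 c^2 =
   4 B (1 + B), the identity sinh 2t = 2 sinh t cosh t. *)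
apply: le_trans (boost_CS _ zE zz).
rewrite Ty ipDl !ipZl y0 z'y.
have h2 : s * c <= s * d by rewrite ler_pM2l.
have h1 : 0 < s * c by rewrite mulr_gt0.
have h4 : (2 * (s * c)) ^+ 2 <= (s * c + s * d) ^+ 2.
  by rewrite ler_pXn2r ?nnegrE //; lra.
have -> : (c * - s + s * - d) ^+ 2 = (s * c + s * d) ^+ 2 by ring.
apply: le_trans h4.
have -> : (2 * (s * c)) ^+ 2 = 4 * ((s * s) * (c * c)) by ring.
rewrite ss cc ler_pM2l //; have := mulr_ge0 (ltW B0) (ltW B0); lra.
Qed.

(** On Spin, x e_1 x~ is the rotated e_1 up to sign, and squaring its coordinates removes the sign.
    This form is continuous on the whole algebra, hence bounded on compact sets. *)
Definition boostf (x : Cl) : R :=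
  \sum_(i | ~~ JE i) (cl_mul (cl_mul x (cvec e0)) (rv x : Cl)) (finset.set1 i) *
    (cl_mul (cl_mul x (cvec e0)) (rv x : Cl)) (finset.set1 i).

Lemma boostf_continuous : continuous boostf.
Proof.
have cm : continuous (fun x : Cl => cl_mul (cl_mul x (cvec e0)) (rv x : Cl)).
  apply: (@mul_continuous R p q _ (fun x : Cl => cl_mul x (cvec e0))); last exact: rv_continuous.
  exact: (@mul_continuous R p q _ id (fun=> cvec e0) (@id_continuous Cl) (@cst_continuous _ _ _)).
move=> x; apply: (@rsum_cvg R _ _ (nbhs x) _ _ _
  (fun i (y : Cl) => (cl_mul (cl_mul y (cvec e0)) (rv y : Cl)) (finset.set1 i) *
    (cl_mul (cl_mul y (cvec e0)) (rv y : Cl)) (finset.set1 i))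
  (fun i => (cl_mul (cl_mul x (cvec e0)) (rv x : Cl)) (finset.set1 i) *
    (cl_mul (cl_mul x (cvec e0)) (rv x : Cl)) (finset.set1 i))) => i _.
have h := coef_cvg (nbhs_filter x) (A := finset.set1 i) (cm x).
exact: (cvgM h h).
Qed.

Lemma boostfE l : unit_seq setT l -> ~~ odd (size l) -> boostf (vprod l) = boost (vrot l e0).
Proof.
move=> ul ol; rewrite /boostf.
have -> : cl_mul (cl_mul (vprod l) (cvec e0)) (rv (vprod l)) = nu l *: cvec (vrot l e0) :> CL.
  rewrite !clifME; have := rot_conj e0 ul; rewrite -signr_odd (negbTE ol) scale1r => <-.
  by rewrite -mulrA vprod_rv -scalerAr mulr1.
rewrite /boost (ip_definite (E'_sign R pE) (prN_E' _)) mulN1r opprK.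
rewrite big_mkcond; apply: eq_bigr => i _; rewrite mxE scale_coef vec_coef1.
case: ifP => [/negbTE -> | /negbFE ->]; last by rewrite expr0n.
by rewrite mulrACA (nu_sqr ul) mul1r expr2.
Qed.

(** The characterisation of [KK] without b: since E' is negative definite, [nu h] is 1 for every
    word in E'. *)
Lemma KK_preserve l : unit_seq setT l -> ~~ odd (size l) ->
  (forall v, E v -> E (vrot l v)) -> (forall v, E' v -> E' (vrot l v)) -> KK (vprod l).
Proof.
move=> ul ol h1 h2; have [s [h [us uh e]]] := pin_split ul h1 h2.
have ucat : unit_seq setT (s ++ h).
  by apply/unit_seq_cat; split; apply: unit_seqT; eassumption.
have o : ~~ odd (size (s ++ h)).
  apply: (vprod_even_size ucat); rewrite vprod_cat.
  have := even_vprod ol; case: e => -> //; rewrite -scaleN1r => /(evenZ (-1)).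
  by rewrite scalerA mulrNN mulr1 scale1r.
have hK : KK (vprod s * vprod h).
  rewrite -vprod_cat; apply: prod_KK => //; move: o; rewrite size_cat oddD.
  by case: (odd _); case: (odd _).
by case: e => -> //; exact: (KK_N p'3 lep).
Qed.

Lemma boost0 v : boost v = 0 -> E v.
Proof.
move/eqP; rewrite oppr_eq0 => /eqP; rewrite (ip_definite (E'_sign R pE) (prN_E' v)).
move/eqP; rewrite mulN1r oppr_eq0 psumr_eq0; last by move=> i _; exact: sqr_ge0.
move/allP => h i /negbTE iJ; have := h i (mem_index_enum _).
by rewrite mxE iJ sqrf_eq0 => /eqP.
Qed.

Lemma max_compact (H : set Cl) : H `<=` Spin R p q -> subgroup_closed H -> compact H ->
  KK `<=` H -> H = KK.
Proof.
move=> HS [H1 HM HV] cH KH.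
have HP (x : Cl) : H x -> exists l, [/\ unit_seq setT l, ~~ odd (size l) & x = vprod l].
  by move=> /HS; rewrite /Spin cspanT => /SpinInP.
have [M HMb] := compact_fun_bounded boostf_continuous cH.
have b0 l : unit_seq setT l -> ~~ odd (size l) -> H (vprod l) -> boost (vrot l e0) = 0.
  move=> ul ol hl; apply/eqP/negPn/negP => nz.
  have F0 : 0 < boost (vrot l e0) by rewrite lt0r nz boost_ge0.
  set F := boost (vrot l e0) in F0 *.
  (* The factor 4 of [boost_double] is used only to gain F at each step; linear growth already
     contradicts the bound M. *)
  have grow n : exists l', [/\ unit_seq setT l', ~~ odd (size l'), H (vprod l') &
      n.+1%:R * F <= boost (vrot l' e0)].
    elim: n => [|n [l' [ul' ol' hl' le']]]; first by exists l; rewrite mul1r.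
    have Fl : F <= n.+1%:R * F by rewrite ler_peMl ?ler1n // ltW.
    have [|a [b [ua ub oab leb]]] := boost_double ul'.
      by apply: lt_le_trans F0 _; apply: le_trans Fl le'.
    exists (l' ++ (a ++ b) ++ l'); split.
    - apply/unit_seq_cat; split=> //; apply/unit_seq_cat; split=> //.
      by apply/unit_seq_cat; split; apply: unit_seqT; eassumption.
    - by rewrite !size_cat !oddD oab addbb addFb addbb.
    - rewrite vprod_cat [vprod (_ ++ l')]vprod_cat; apply: (HM) => //; apply: (HM) => //.
      by apply: KH; exact: prod_KK.
    - by apply: le_trans leb; rewrite -natr1 mulrDl mul1r; lra.
  have [n nM] : exists n, M < n.+1%:R * F.
    exists (Num.truncn (M / F)); rewrite -ltr_pdivrMr //; exact: truncnS_gt.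
  have [l' [ul' ol' hl' le']] := grow n.
  have := HMb _ hl'; rewrite boostfE // => h.
  by have := lt_le_trans nM (le_trans le' h); rewrite ltxx.
(* Each e_i in E is the image of e_1 under an element of Spin(E), which lies in [KK] and so in H;
   hence [b0] applies to every e_i. *)
have pE' l : unit_seq setT l -> ~~ odd (size l) -> H (vprod l) -> forall v, E v -> E (vrot l v).
  move=> ul ol hl v hv.
  have hev i : JE i -> E (vrot l (ev R i)).
    move=> iJ; have ei : ip (ev R i) (ev R i) = 1.
      by rewrite ip_ev_ev eqxx mulr1 /ip_sign (JE_pos lep iJ).
    have [a [ua oa ra]] := move_e0 false (cspan_ev R iJ) ei.
    have hl2 : H (vprod (l ++ rev a)).
      rewrite vprod_cat; apply: HM => //; apply: KH; rewrite -[rev a]cats0.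
      by apply: prod_KK; rewrite ?size_rev //; exact: unit_seq_rev.
    have := b0 (l ++ rev a).
    rewrite rot_cat -ra (rot_rev _ ua) => h; apply: boost0; apply: h => //.
      by apply/unit_seq_cat; split=> //; apply: unit_seq_rev; exact: unit_seqT ua.
    by rewrite size_cat size_rev oddD oa addbF.
  rewrite [v]vec_evE.
  suff K r : E (vrot l (\sum_(i <- r) v ord0 i *: ev R i)) by exact: K.
  elim: r => [|i r IH].
    rewrite big_nil (_ : vrot l 0 = 0); first exact: cspan0.
    by apply: rot_orth => u _; rewrite ipC ip0l.
  rewrite big_cons rot_lin; have [iJ|/hv->] := boolP (JE i); last by rewrite scale0r add0r.
  by apply: cspan_lin => //; exact: hev.
apply/seteqP; split=> // x xH; have [l [ul ol xl]] := HP _ xH; subst x.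
apply: KK_preserve => //; first exact: pE'.
move=> v hv i; rewrite /= negbK => iJ.
(* E' is preserved because the inverse rotation preserves E; it is given by the reversed word, the
   inverse in H up to sign. *)
have hi : ip (ev R i) (vrot l v) = 0.
  have ulr := unit_seq_rev ul.
  rewrite -(ip_rot _ _ ulr) (rot_rev _ ul).
  apply: cspan_ip hv; apply: pE' => //; rewrite ?size_rev //; last exact: cspan_ev.
  have -> : vprod (rev l) = nu l *: (cl_inv (vprod l) : CL).
    by rewrite (vprod_inv ul) rv_vprod scalerA (nu_sqr ul) scale1r.
  have hV := HV _ xH.
  have [->|->] : nu l = 1 \/ nu l = -1.
    by have := ul; rewrite cspanT => /nu_pm.
    by rewrite scale1r.
  have -> : -1 *: (cl_inv (vprod l) : CL) = (-1 : CL) * cl_inv (vprod l).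
    by rewrite scaleN1r mulN1r.
  by apply: HM => //; apply: KH; apply: (KK_N p'3 lep); case: (KK_group R q p'3 lep).
by move: hi; rewrite ip_ev /ip_sign (JE_pos lep iJ) mul1r.
Qed.

End MaximalCompact.

Theorem mainTheorem5 (R : realType) (p' p'' q m : nat)
  (rho : Cl R (p' + p'') q -> 'M[R]_m)
  (Pi : 'cV[R]_m -> 'cV[R]_m -> Vec R (p' + p'') q) :
  (p' %% 4 = 3)%N ->
  is_Cl0_module rho ->
  is_wedge2_map Pi ->
  equivariant rho Pi ->
  (exists s t, Pi s t != 0) ->
  let p := (p' + p'')%N in
  let E := EE R p q p' in
  let E' := EE' R p q p' in
  let K := Kgrp R p q p' in
  let Kh := Khat R p q p' in
  let b := bform p' rho Pi in
  (* (1) *)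
  [/\ (forall g, Kh g <->
         [/\ Spin R p q g, Ad_preserves g E, Ad_preserves g E' &
             forall s t, b (rho g *m s) (rho g *m t) = b s t]),
      connected_component Kh (cl_one R p q) = K &
      K = Kh `&` Spin0 R p q]
  (* (2) *)
  /\ homog_connected (Spin R p q) Kh
  (* (3) *)
  /\ (compact Kh <-> (q = 0 \/ p'' = 0)%N)
  /\ (p'' = 0%N ->
      [/\ Kh = [set x | exists a c, SpinIn E a /\ iotaPin R p q p' c
                                    /\ x = cl_mul a c],
          max_compact_subgroup (Spin R p q) Kh,
          (exists phi : Cl R p q * Cl R q 0 -> Cl R p q,
             let D := [set ab : Cl R p q * Cl R q 0 | SpinIn E ab.1 /\ Pin R q 0 ab.2] in
             [/\ {within D, continuous phi},
                 (forall ab ab', D ab -> D ab' ->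
                    phi (cl_mul ab.1 ab'.1, cl_mul ab.2 ab'.2)
                    = cl_mul (phi ab) (phi ab')),
                 phi @` D = Kh &
                 (forall ab, D ab -> (phi ab = cl_one R p q <->
                    (ab = (cl_one R p q, cl_one R q 0)
                     \/ ab = (cl_scale (-1) (cl_one R p q),
                              cl_scale (-1) (cl_one R q 0)))))]) &
          (forall x, cl_even x <-> gen_alg Kh x)]).
Proof.
move=> p'3 rhoP PiP PiE Pi0 p E E' K Kh b.
have lep : (p' <= p)%N by exact: leq_addr.
have EP : E = cspan (@JE p q p') by exact: EEE.
have E'P : E' = cspan (predC (@JE p q p')) by exact: EE'E.
have KP : K = K0 p' by exact: KgrpE.
have KhP : Kh = KK p' by exact: (KhatE R q p'3 lep).
split; [|split; [|split]].
- rewrite KhP KP EP E'P; have [h1 h2] := K_component R q p'3 lep; split=> // g.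
  exact: (KK_char p'3 lep rhoP PiP PiE).
- by rewrite KhP; exact: homog.
- rewrite KhP; split=> [cK|].
    have [q0|q0] : q = 0%N \/ (0 < q)%N by lia.
      by left.
    have [p0|p0] : p'' = 0%N \/ (0 < p'')%N by lia.
      by right.
    by case: (KK_noncompact _ q0 cK); rewrite /p; lia.
  case=> h0; [apply: (@KK_compact R p q p' lep 1); first by left
             |apply: (@KK_compact R p q p' lep (-1)); first by right].
    move=> i _; rewrite /ip_sign (_ : (i < p)%N) //.
    by apply: leq_trans (ltn_ord i) _; rewrite h0 addn0.
  have pE : p' = p by rewrite /p h0 addn0.
  by move=> i; exact: (E'_sign R pE).
- move=> p0; have pE : p' = p by rewrite /p p0 addn0.
  rewrite KhP EP.
  have KKc : compact (@KK R p q p').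
    apply: (@KK_compact R p q p' lep (-1)); first by right.
    by move=> i; exact: (E'_sign R pE).
  split.
  + exact: (KK_prod R q p'3 pE).
  + split=> //; first by move=> x; exact: KK_Spin.
      exact: (KK_group R q p'3 lep).
    by move=> H *; exact: (max_compact p'3 pE).
  (* The quotient by the pair (-1, -1) is expressed by the homomorphism sending (a, x) to a iota(x);
     it is multiplicative because Spin(E) commutes with iota(Pin(q)). *)
  + exists (fun ab => cl_mul ab.1 (cl_iota R p q p' ab.2)); split.
    * apply: continuous_subspaceT.
      apply: (@mul_continuous R p q _ (fun ab : Cl R p q * Cl R q 0 => ab.1)
        (fun ab => cl_iota R p q p' ab.2)); first exact: fst_cont.
      move=> ab; apply: (@continuous_comp _ _ _ (@snd (Cl R p q) (Cl R q 0)) (cl_iota R p q p')).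
        exact: snd_cont.
      exact: (@iota_continuous R p q p' lep).
    * move=> [a x] [a' x'] /= [ha hx] [ha' hx'].
      rewrite !(cl_iotaE lep) !clifME (iotaM p'3 lep _ hx).
      have ix : iotaPin R p q p' (gen_map (cgen R lep) x) by exists x; rewrite (cl_iotaE lep).
      have c := iota_comm p'3 lep ha' ix.
      have key (u v w t : clif R p q) : w * v = v * w -> u * v * (w * t) = u * w * (v * t).
        by move=> e; rewrite mulrA -(mulrA u) -e !mulrA.
      exact: key c.
    * rewrite (KK_prod R q p'3 pE); apply/seteqP; split=> y.
        move=> [[a x] [/= ha hx] <-]; exists a, (cl_iota R p q p' x).
        by split=> //; split=> //; exists x.
      move=> [a [_ [ha [[x [hx ->]] ->]]]].
      by exists (a, x).
    * move=> [a x] /= [ha hx]; rewrite (cl_iotaE lep).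
      split=> [/(iota_kernel ha hx) [[-> ->]|[-> ->]]|].
      - by left.
      - by right; rewrite !clifZE !scaleN1r.
      - case=> -[-> ->]; first by rewrite clifME gen_map1 mulr1.
        rewrite !clifZE gen_mapZ gen_map1 clifME -scalerAl -scalerAr scalerA.
        by rewrite mulrNN mulr1 scale1r mulr1.
  + by move=> x; exact: (gen_alg_KK pE).
Qed.
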